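(* (Non-self-adjoint Mehler's formula.) For all $c\in\mathbb{C}$ with $\operatorname{Re}(c)>0$, all $\tau\in S_c$ and all $f\in L^2(\mathbb{R})$, $$e^{-H_c\tau}f(x)=\int_{\mathbb{R}}K_c(\tau,x,y)f(y)\,dy ,$$ where $$K_c(\tau,x,y)=w_1\exp\left[w_3xy-w_2(x^2+y^2)\right]\qquad(x,y\in\mathbb{R}),$$ with $$\lambda=\exp[-2c^{1/2}\tau],\quad w_1=c^{1/4}\lambda^{1/2}[\pi(1-\lambda^2)]^{-1/2},\quad w_2=\frac{c^{1/2}(1+\lambda^2)}{2(1-\lambda^2)},\quad w_3=\frac{2c^{1/2}\lambda}{1-\lambda^2}.$$
   Context: For $c\in\mathbb{C}$ with $\operatorname{Re}(c)>0$, the complex harmonic oscillator $H_c f(x)=-f''(x)+c\,x^2f(x)$ is the m-sectorial operator on $L^2(\mathbb{R})$ associated with the closed m-sectorial form $$Q_c(f,g)=\int_{\mathbb{R}} f'\overline{g'}\,dx + c\int_{\mathbb{R}}x^2 f\overline{g}\,dx$$ with form domain $W^{1,2}(\mathbb{R})\cap\{f\in L^2(\mathbb{R}):\int x^2|f(x)|^2dx<\infty\}$. Powers of $c$ and of $1-\lambda^2$ are principal branches ($|\lambda|<1$ for $\tau\in S_c$), and $\lambda^{1/2}=\exp[-c^{1/2}\tau]$. With $S(-\alpha,\beta)=\{z\in\mathbb{C}: -\alpha<\arg z<\beta\}$, let $$S_c=\begin{cases}\overline{S(-\frac{\pi}{2},\frac{\pi}{2}-\arg(c))}\setminus\{0\}&\text{if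 }\operatorname{Im}(c)>0,\\ S(-\frac{\pi}{2},\frac{\pi}{2})&\text{if }\operatorname{Im}(c)=0,\\ \overline{S(-\frac{\pi}{2}-\arg(c),\frac{\pi}{2})}\setminus\{0\}&\text{if }\operatorname{Im}(c)<0.\end{cases}$$ Here $S(-\frac{\pi}{2}-\arg(c),\frac{\pi}{2})=\{z:-\frac{\pi}{2}-\arg(c)<\arg z<\frac{\pi}{2}\}$. The operators $e^{-H_c\tau}$ are those of the holomorphic contraction semigroup generated by $-H_c$ on the interior of $S_c$; for $\tau=te^{i\vartheta}$ ($t>0$) on an edge of $S_c$ (only when $\operatorname{Im}(c)\ne0$), $e^{-H_c\tau}$ denotes the $C_0$ one-parameter semigroup in $t$ generated by $-e^{i\vartheta}H_c$. *)

(* Defs.v *)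
From HB Require Import structures.
From mathcomp Require Import all_boot all_order all_algebra.
From mathcomp Require Import complex.
From mathcomp Require Import all_classical all_reals all_analysis.

Set Implicit Arguments.
Unset Strict Implicit.
Unset Printing Implicit Defensive.

Import Order.TTheory GRing.Theory Num.Theory.
Import numFieldNormedType.Exports.
Import ComplexField.

Local Open Scope classical_set_scope.
Local Open Scope ring_scope.
Local Open Scope complex_scope.

Notation ReC := (@complex.Re _).
Notation ImC := (@complex.Im _).

Section ComplexFunctions.
Context {R : realType}.
Implicit Types z c tau : R[i].

Definition Cexp z : R[i] := (expR (ReC z))%:C * (cos (ImC z) +i* sin (ImC z)).

(* Principal argument, in ]-pi, pi]; the value at 0 is irrelevant. *)
Definition Carg z : R :=
  let a := acos (ReC z / Normc.normc z) in if 0 <= ImC z then a else - a.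

(* Principal branch |z|^a e^(i a arg z) of z^a. *)
Definition Cpow z (a : R) : R[i] :=
  (Normc.normc z `^ a)%:C * Cexp (0 +i* (a * Carg z)).

(* R[i]^o is R[i], with the topology of the modulus. *)
Definition sector (a b : R) : set R[i]^o :=
  [set z : R[i] | z != 0 /\ a < Carg z < b].

Definition Sset c : set R[i]^o :=
  if 0 < ImC c then closure (sector (- (pi / 2)) (pi / 2 - Carg c)) `\ 0
  else if ImC c == 0 then sector (- (pi / 2)) (pi / 2)
  else closure (sector (- (pi / 2) - Carg c) (pi / 2)) `\ 0.

Definition mehler_kernel c tau (x y : R) : R[i] :=
  let lambda := Cexp (- (2 * Cpow c 2^-1 * tau)) in
  let sqrt_lambda := Cexp (- (Cpow c 2^-1 * tau)) in
  let w1 := Cpow c 4^-1 * sqrt_lambda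
            * Cpow (pi%:C * (1 - lambda ^+ 2)) (- 2^-1) in
  let w2 := Cpow c 2^-1 * (1 + lambda ^+ 2) / (2 * (1 - lambda ^+ 2)) in
  let w3 := 2 * Cpow c 2^-1 * lambda / (1 - lambda ^+ 2) in
  w1 * Cexp (w3 * (x * y)%:C - w2 * (x ^+ 2 + y ^+ 2)%:C).

End ComplexFunctions.

Section L2.
Context {R : realType}.
Local Notation mu := (@lebesgue_measure R).
Implicit Types f g h : R -> R[i].

Definition Cmeasurable f :=
  measurable_fun setT (ReC \o f) /\ measurable_fun setT (ImC \o f).

Definition Cintegrable f :=
  mu.-integrable setT (EFin \o (ReC \o f)) /\
  mu.-integrable setT (EFin \o (ImC \o f)).

Definition Cintegral f : R[i] :=
  (\int[mu]_x ReC (f x)) +i* (\int[mu]_x ImC (f x)).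

Definition L2norm f : \bar R := 'N[mu]_2%:E [EFin \o (fun x => Normc.normc (f x))].

(* Elements of L^2(R; C) are represented by functions, equality being
   equality almost everywhere. *)
Definition L2 f := Cmeasurable f /\ (L2norm f < +oo)%E.

Definition inner f g : R[i] := Cintegral (fun x => f x * conjc (g x)).

Definition test_function (phi : R -> R) :=
  (forall n (x : R), derivable (derive1n n phi) x 1) /\
  (exists M : R, forall x, M < `|x| -> phi x = 0).

Definition is_weak_derivative f g := forall phi, test_function phi ->
  Cintegral (fun x => f x * (derive1 phi x)%:C) =
  - Cintegral (fun x => g x * (phi x)%:C).

Definition W12 f := L2 f /\ exists2 g, L2 g & is_weak_derivative f g.

(* The weak derivative of f in W^{1,2}, which is unique up to a.e. equality. *)
Definition weak_derivative f : R -> R[i] :=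
  xget (fun=> 0) [set g | L2 g /\ is_weak_derivative f g].

End L2.

Section Semigroups.
Context {R : realType}.
Local Notation mu := (@lebesgue_measure R).
Local Notation fct := (R -> R[i]).
Local Notation op := (fct -> fct).
Implicit Types f g h : fct.

(* Everywhere defined bounded linear operators on L^2. *)
Definition bounded_operator (T : op) :=
  [/\ forall f, L2 f -> L2 (T f),
      forall f g, L2 f -> L2 g -> ae_eq mu setT f g ->
        ae_eq mu setT (T f) (T g),
      forall (a : R[i]) f g, L2 f -> L2 g ->
        ae_eq mu setT (T (fun x => a * f x + g x))
                      (fun x => a * T f x + T g x) &
      exists M : R, forall f, L2 f -> (L2norm (T f) <= M%:E * L2norm f)%E].

Definition C0_semigroup (T : R -> op) :=
  [/\ forall t : R, 0 <= t -> bounded_operator (T t),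
      forall f, L2 f -> ae_eq mu setT (T 0 f) f,
      forall (s t : R) f, 0 <= s -> 0 <= t -> L2 f ->
        ae_eq mu setT (T (s + t) f) (T s (T t f)) &
      forall f, L2 f ->
        L2norm (fun x => T t f x - f x) @[t --> (0 : R)^'+] --> (0 : \bar R)].

(* Unbounded operators are given by their graphs. *)
Definition generator (T : R -> op) f g :=
  [/\ L2 f, L2 g &
      L2norm (fun x => (t^-1)%:C * (T t f x - f x) - g x)
        @[t --> (0 : R)^'+] --> (0 : \bar R)].

Definition generates (A : fct -> fct -> Prop) (T : R -> op) :=
  C0_semigroup T /\ forall f g, A f g <-> generator T f g.

Definition holomorphic_contraction_semigroup (Sigma : set R[i]^o)
    (A : fct -> fct -> Prop) (T : R[i] -> op) :=
  [/\ generates A (fun t => T t%:C),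
      forall z, Sigma z -> bounded_operator (T z) /\
        forall f, L2 f -> (L2norm (T z f) <= L2norm f)%E,
      forall (z w : R[i]) f, Sigma z -> Sigma w -> L2 f ->
        ae_eq mu setT (T (z + w) f) (T z (T w f)),
      forall f, L2 f ->
        L2norm (fun x => T z f x - f x)
          @[z --> within Sigma (nbhs (0 : R[i]^o))] --> (0 : \bar R) &
      forall (z : R[i]) f, Sigma z -> L2 f -> exists2 g, L2 g &
        L2norm (fun x => (w : R[i])^-1 * (T (z + (w : R[i])) f x - T z f x) - g x)
          @[w --> (0 : R[i]^o)^'] --> (0 : \bar R)].

Definition scale_operator (a : R[i]) (A : fct -> fct -> Prop) f g :=
  exists2 h, A f h & g = (fun x => a * h x).

End Semigroups.

Section Oscillator.
Context {R : realType}.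
Local Notation mu := (@lebesgue_measure R).
Implicit Types (c tau : R[i]) (f g h : R -> R[i]).

Definition form_domain f :=
  W12 f /\
  (\int[mu]_x (x ^+ 2 * Normc.normc (f x) ^+ 2)%:E < +oo)%E.

Definition Qform c f g : R[i] :=
  Cintegral (fun x => weak_derivative f x * conjc (weak_derivative g x))
  + c * Cintegral (fun x => (x ^+ 2)%:C * f x * conjc (g x)).

(* Graph of the operator associated with the form: h = H_c f. *)
Definition Hop c f h :=
  [/\ form_domain f, L2 h & forall v, form_domain v -> Qform c f v = inner h v].

(* E is the operator e^(- H_c tau), for tau in Sset c. In the second case,
   t and theta are the modulus and an argument of tau. *)
Definition is_exp_oscillator c tau (E : (R -> R[i]) -> (R -> R[i])) :=
  (interior (Sset c) tau /\
   exists2 T, holomorphic_contraction_semigroup (interior (Sset c))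
                (scale_operator (- 1) (Hop c)) T
            & E = T tau)
  \/
  ((Sset c `\` interior (Sset c)) tau /\
   exists t theta T,
     [/\ 0 < t, tau = t%:C * Cexp (0 +i* theta),
         generates (scale_operator (- Cexp (0 +i* theta)) (Hop c)) T
       & E = T t]).

End Oscillator.

(* Main.v *)
(* Let q be the principal square root of c. Gaussians stay Gaussian under the
   flow: exp(- q x^2 / 2 + s x), s complex, is carried by e^(- H_c tau) to
   exp(- q x^2 / 2 + sigma x + kappa) with sigma = s lambda and
   kappa = - q tau + s^2 (1 - lambda^2) / (4 q), because this curve solves
   u' = - H_c u inside the domain of H_c and a C0-semigroup follows every such
   curve. In the interior of S_c the semigroup used is r |-> e^(- r tau H_c),
   whose generator extends - tau H_c by holomorphy. Completing the square in a
   complex Gaussian integral shows that the Mehler kernel has the same effect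
   on these functions.

   It remains to pass from these Gaussians to all of L^2. The functions h for
   which multiplication by h preserves the agreement of the two operators on
   exponential multiples form an algebra that contains the exponentials and is
   closed under bounded pointwise limits; the trigonometric polynomials
   (1 - sin((x - m) / (k l))^(2 k))^(k^(2 k + 1)) tend boundedly to the
   indicator of |x - m| < l, so this algebra contains every bounded measurable
   function. *)

Require Import Defs.
From HB Require Import structures.
From mathcomp Require Import all_boot all_order all_algebra.
From mathcomp Require Import complex ring lra.
From mathcomp Require Import all_classical all_reals all_analysis measurable_realfun.

Set Implicit Arguments.
Unset Strict Implicit.
Unset Printing Implicit Defensive.

Import Order.TTheory GRing.Theory Num.Theory.
Import numFieldNormedType.Exports.
Import ComplexField.

Local Open Scope classical_set_scope.
Local Open Scope ring_scope.
Local Open Scope complex_scope.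


(** The operator is not self-adjoint, so no spectral theorem describes the semigroup; only the
    action of its generator on a few explicit functions is at hand. The width q / 2 is the one for
    which the x^2 terms of H_c u cancel, which reduces the flow to explicitly solvable equations for
    the two remaining parameters. Membership of tau in S_c enters through Re (q tau) > 0 and |Im q
    Im (q tau)| <= Re q Re (q tau); these give both |lambda| < 1 and the decay of the kernel, edges
    included. On an edge the semigroup is only known to be strongly continuous, so a bound that is
    uniform on compact time intervals has to come from the uniform boundedness principle, and thus
    from the completeness of L^2. Boundedness of the kernel operator on L^2 is not known beforehand:
    in a limit the kernel side converges pointwise by domination, the semigroup side in norm, and
    Fatou's lemma identifies the two limits. *)

Notation nrm := Normc.normc.

Arguments Cexp : simpl never.

(** * Modulus, components and exponential of complex numbers *)

Section ComplexBasics.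
Context {R : realType}.
Implicit Types z w : R[i].

Lemma ReCD z w : ReC (z + w) = ReC z + ReC w. Proof. by case: z w => a b []. Qed.
Lemma ImCD z w : ImC (z + w) = ImC z + ImC w. Proof. by case: z w => a b []. Qed.
Lemma ReCN z : ReC (- z) = - ReC z. Proof. by case: z. Qed.
Lemma ImCN z : ImC (- z) = - ImC z. Proof. by case: z. Qed.
Lemma ReCM z w : ReC (z * w) = ReC z * ReC w - ImC z * ImC w.
Proof. by case: z w => a b []. Qed.
Lemma ImCM z w : ImC (z * w) = ReC z * ImC w + ImC z * ReC w.
Proof. by case: z w => a b [c d] /=; rewrite addrC [b * c]mulrC; ring. Qed.
Lemma ReCJ z : ReC (conjc z) = ReC z. Proof. by case: z. Qed.
Lemma ImCJ z : ImC (conjc z) = - ImC z. Proof. by case: z. Qed.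
Definition ReImE := (ReCD, ImCD, ReCN, ImCN, ReCM, ImCM, ReCJ, ImCJ).

Lemma complex_eq z w : ReC z = ReC w -> ImC z = ImC w -> z = w.
Proof. by case: z w => a b [c d] /= -> ->. Qed.

Lemma nrmE z : nrm z = Num.sqrt (ReC z ^+ 2 + ImC z ^+ 2).
Proof. by case: z. Qed.

Lemma nrm_ge0 z : 0 <= nrm z. Proof. by rewrite nrmE sqrtr_ge0. Qed.

Lemma sqr_nrm z : nrm z ^+ 2 = ReC z ^+ 2 + ImC z ^+ 2.
Proof. by rewrite nrmE sqr_sqrtr// addr_ge0// sqr_ge0. Qed.

Lemma nrm0 : nrm (0 : R[i]) = 0. Proof. exact: Normc.normc0. Qed.

Lemma nrm_eq0 z : (nrm z == 0) = (z == 0).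
Proof.
by apply/eqP/eqP => [/Normc.eq0_normc//|->]; exact: nrm0.
Qed.

Lemma nrm_gt0 z : (0 < nrm z) = (z != 0).
Proof. by rewrite lt_neqAle nrm_ge0 andbT eq_sym nrm_eq0. Qed.

Lemma nrmD z w : nrm (z + w) <= nrm z + nrm w.
Proof. exact: le_normcD. Qed.

Lemma nrmN z : nrm (- z) = nrm z. Proof. exact: normcN. Qed.

Lemma nrmB z w : nrm (z - w) <= nrm z + nrm w.
Proof. by rewrite (le_trans (nrmD _ _))// nrmN. Qed.

Lemma nrmM z w : nrm (z * w) = nrm z * nrm w. Proof. exact: Normc.normcM. Qed.

Lemma nrmX z n : nrm (z ^+ n) = nrm z ^+ n.
Proof.
by elim: n => [|n IH]; rewrite ?expr0 ?Normc.normc1// !exprS nrmM IH.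
Qed.

Lemma nrmV z : nrm z^-1 = (nrm z)^-1. Proof. exact: Normc.normcV. Qed.

Lemma nrm_real (x : R) : nrm x%:C = `|x|.
Proof. by rewrite nrmE /= expr0n addr0 sqrtr_sqr. Qed.

Lemma nrmJ z : nrm (conjc z) = nrm z.
Proof. by rewrite !nrmE ReCJ ImCJ sqrrN. Qed.

Lemma Re_le_nrm z : `|ReC z| <= nrm z.
Proof. by rewrite -sqrtr_sqr nrmE ler_wsqrtr// lerDl sqr_ge0. Qed.

Lemma Im_le_nrm z : `|ImC z| <= nrm z.
Proof. by rewrite -sqrtr_sqr nrmE ler_wsqrtr// lerDr sqr_ge0. Qed.

Lemma nrm_le_ReIm z : nrm z <= `|ReC z| + `|ImC z|.
Proof.
rewrite -(@ler_pXn2r _ 2)// ?nnegrE ?addr_ge0 ?nrm_ge0//.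
rewrite sqr_nrm sqrrD !real_normK ?num_real// -addrA lerD2l lerDr.
by rewrite mulrn_wge0// mulr_ge0.
Qed.

Lemma rcM (x y : R) : (x * y)%:C = x%:C * y%:C :> R[i].
Proof. exact: rmorphM. Qed.

Lemma rcD (x y : R) : (x + y)%:C = x%:C + y%:C :> R[i].
Proof. exact: rmorphD. Qed.

Lemma Re_scale (x : R) z : ReC (x%:C * z) = x * ReC z.
Proof. by rewrite ReCM /= mul0r subr0. Qed.

Lemma Im_scale (x : R) z : ImC (x%:C * z) = x * ImC z.
Proof. by rewrite ImCM /= mul0r addr0. Qed.

Lemma Re_half z : ReC (z / 2) = ReC z / 2.
Proof.
have -> : z / 2 = (2^-1)%:C * z by rewrite mulrC fmorphV rmorph_nat.
by rewrite Re_scale mulrC.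
Qed.

Lemma Re_Cexp z : ReC (Cexp z) = expR (ReC z) * cos (ImC z).
Proof. by rewrite /Cexp Re_scale. Qed.

Lemma Im_Cexp z : ImC (Cexp z) = expR (ReC z) * sin (ImC z).
Proof. by rewrite /Cexp Im_scale. Qed.

Lemma CexpD z w : Cexp (z + w) = Cexp z * Cexp w.
Proof.
apply: complex_eq.
- rewrite Re_Cexp ReCM !Re_Cexp !Im_Cexp ReCD ImCD expRD cosD; ring.
- rewrite Im_Cexp ImCM !Re_Cexp !Im_Cexp ReCD ImCD expRD sinD; ring.
Qed.

Lemma Cexp0 : Cexp (0 : R[i]) = 1.
Proof.
by apply: complex_eq; rewrite ?Re_Cexp ?Im_Cexp /= ?cos0 ?sin0 expR0 ?mulr1 ?mulr0.
Qed.

Lemma nrm_Cexp z : nrm (Cexp z) = expR (ReC z).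
Proof.
rewrite /Cexp nrmM nrm_real ger0_norm ?expR_ge0// nrmE /= cos2Dsin2 sqrtr1.
by rewrite mulr1.
Qed.

Lemma Cexp_neq0 z : Cexp z != 0.
Proof. by rewrite -nrm_eq0 nrm_Cexp gt_eqF// expR_gt0. Qed.

Lemma Cexp_real (x : R) : Cexp x%:C = (expR x)%:C.
Proof. by apply: complex_eq; rewrite ?Re_Cexp ?Im_Cexp /= ?cos0 ?sin0 ?mulr1 ?mulr0. Qed.

Lemma CexpX z n : Cexp (z *+ n) = Cexp z ^+ n.
Proof. by elim: n => [|n IH]; rewrite ?Cexp0// mulrS CexpD IH exprS. Qed.

End ComplexBasics.

(** * Curves in the complex plane *)

Section Curves.
Context {R : realType}.
Implicit Types (f g : R -> R[i]) (x : R) (d e : R[i]).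

(** Componentwise, so that the real product rule, mean value theorem and fundamental theorem of
    calculus apply to each part. *)
Definition cderive f x d :=
  is_derive x 1 (ReC \o f) (ReC d) /\ is_derive x 1 (ImC \o f) (ImC d).

Lemma cderive_eq f x d e : cderive f x d -> d = e -> cderive f x e.
Proof. by move=> + <-. Qed.

Lemma cderive_cst d x : cderive (fun=> d) x 0.
Proof. by split => /=; exact: is_derive_cst. Qed.

Lemma cderive_real (f : R -> R) (d x : R) :
  is_derive x 1 f d -> cderive (fun x => (f x)%:C) x d%:C.
Proof. by move=> df; split => //=; exact: is_derive_cst. Qed.

Lemma cderive_id x : cderive (fun x => x%:C) x 1.
Proof. by apply: (@cderive_real id); exact: is_derive_id. Qed.

Lemma cderiveD f g x d e : cderive f x d -> cderive g x e ->
  cderive (fun x => f x + g x) x (d + e).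
Proof.
move=> [df1 df2] [dg1 dg2]; split.
- rewrite ReCD [X in is_derive _ _ X](_ : _ = (ReC \o f) + (ReC \o g)); last first.
    by apply/funext => y /=; rewrite ReCD.
  exact: is_deriveD.
- rewrite ImCD [X in is_derive _ _ X](_ : _ = (ImC \o f) + (ImC \o g)); last first.
    by apply/funext => y /=; rewrite ImCD.
  exact: is_deriveD.
Qed.

Lemma cderiveM f g x d e : cderive f x d -> cderive g x e ->
  cderive (fun x => f x * g x) x (d * g x + f x * e).
Proof.
move=> [df1 df2] [dg1 dg2]; split.
- rewrite [X in is_derive _ _ X](_ : _ =
    (ReC \o f) * (ReC \o g) - (ImC \o f) * (ImC \o g)); last first.
    by apply/funext => y /=; rewrite ReCM.
  apply: is_derive_eq; rewrite !ReImE /GRing.scale/=; ring.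
- rewrite [X in is_derive _ _ X](_ : _ =
    (ReC \o f) * (ImC \o g) + (ImC \o f) * (ReC \o g)); last first.
    by apply/funext => y /=; rewrite ImCM.
  apply: (is_derive_eq (is_deriveD (is_deriveM df1 dg2) (is_deriveM df2 dg1))).
  by rewrite ImCD !ImCM /GRing.scale/=; ring.
Qed.

Lemma cderiveZ d f x e : cderive f x e -> cderive (fun x => d * f x) x (d * e).
Proof.
move=> df; have := cderiveM (cderive_cst d x) df.
by rewrite mul0r add0r.
Qed.

Lemma cderiveN f x e : cderive f x e -> cderive (fun x => - f x) x (- e).
Proof.
move=> /(cderiveZ (-1)); rewrite mulN1r.
by rewrite (_ : (fun x => -1 * f x) = fun x => - f x)//; apply/funext => y; rewrite mulN1r.
Qed.

Lemma cderiveB f g x d e : cderive f x d -> cderive g x e ->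
  cderive (fun x => f x - g x) x (d - e).
Proof. by move=> df /cderiveN; exact: cderiveD. Qed.

Lemma cderive_Cexp f x d : cderive f x d ->
  cderive (fun x => Cexp (f x)) x (d * Cexp (f x)).
Proof.
move=> [df1 df2].
have de : is_derive x 1 (expR \o (ReC \o f)) (ReC d * expR (ReC (f x))).
  by apply: is_derive_eq; rewrite mulrC.
have dc : is_derive x 1 (cos \o (ImC \o f)) (- (ImC d * sin (ImC (f x)))).
  by apply: is_derive_eq; rewrite /GRing.scale/=; ring.
have ds : is_derive x 1 (sin \o (ImC \o f)) (ImC d * cos (ImC (f x))).
  by apply: is_derive_eq; rewrite mulrC.
split.
- rewrite [X in is_derive _ _ X](_ : _ =
    (expR \o (ReC \o f)) * (cos \o (ImC \o f))); last first.
    by apply/funext => y; exact: Re_Cexp.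
  apply: is_derive_eq; rewrite [RHS]ReCM Re_Cexp Im_Cexp /GRing.scale/=; ring.
- rewrite [X in is_derive _ _ X](_ : _ =
    (expR \o (ReC \o f)) * (sin \o (ImC \o f))); last first.
    by apply/funext => y; exact: Im_Cexp.
  apply: is_derive_eq; rewrite [RHS]ImCM Re_Cexp Im_Cexp /GRing.scale/=; ring.
Qed.

Lemma is_derive_continuous (f : R -> R) x (l : R) :
  is_derive x 1 f l -> {for x, continuous f}.
Proof. by move=> [df _]; apply/differentiable_continuous/derivable1_diffP. Qed.

(* The factor 2 comes from treating real and imaginary parts separately. *)
Lemma cderive_lipschitz f (df : R -> R[i]) a b M : a <= b ->
  (forall x, a <= x <= b -> cderive f x (df x)) ->
  (forall x, a <= x <= b -> nrm (df x) <= M) ->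
  nrm (f b - f a) <= 2 * (M * (b - a)).
Proof.
move=> ab cdf dfM; apply: (le_trans (nrm_le_ReIm _)).
have mvt (h : R[i] -> R) : (forall z w, h (z - w) = h z - h w) ->
    (forall z, `|h z| <= nrm z) ->
    (forall x, a <= x <= b -> is_derive x 1 (h \o f) (h (df x))) ->
    `|h (f b - f a)| <= M * (b - a).
  move=> hB hn hd.
  have [y| |y yab] := @MVT_segment _ (h \o f) (h \o df) a b ab.
  - by rewrite in_itv/= => /andP[ay yb]; apply: hd; rewrite !ltW.
  - apply: derivable_within_continuous => y; rewrite in_itv/= => yab.
    by have := hd _ yab => -[].
  - rewrite hB => ->; rewrite normrM [X in _ * X]ger0_norm ?subr_ge0// ler_wpM2r ?subr_ge0//.
    by apply: (le_trans (hn _)); apply: dfM; move: yab; rewrite in_itv.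
rewrite mulrDl mul1r lerD//; apply: mvt.
- by move=> z w; rewrite !ReImE.
- exact: Re_le_nrm.
- by move=> x /cdf[].
- by move=> z w; rewrite !ReImE.
- exact: Im_le_nrm.
- by move=> x /cdf[].
Qed.

End Curves.


(** * Componentwise convergence of complex sequences *)

Section ComplexLimits.
Context {R : realType}.
Implicit Types (u v : nat -> R[i]) (k l : R[i]).

Definition ccvg u l :=
  (fun n => ReC (u n)) @ \oo --> ReC l /\ (fun n => ImC (u n)) @ \oo --> ImC l.

Lemma ccvg_cst l : ccvg (fun=> l) l.
Proof. by split; exact: cvg_cst. Qed.

Lemma ccvgD u v k l : ccvg u k -> ccvg v l -> ccvg (fun n => u n + v n) (k + l).
Proof.
move=> [u1 u2] [v1 v2]; split.
- by rewrite ReCD; under eq_fun do rewrite ReCD; exact: cvgD.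
- by rewrite ImCD; under eq_fun do rewrite ImCD; exact: cvgD.
Qed.

Lemma ccvgM u v k l : ccvg u k -> ccvg v l -> ccvg (fun n => u n * v n) (k * l).
Proof.
move=> [u1 u2] [v1 v2]; split.
- by rewrite ReCM; under eq_fun do rewrite ReCM; apply: cvgB; exact: cvgM.
- by rewrite ImCM; under eq_fun do rewrite ImCM; apply: cvgD; exact: cvgM.
Qed.

Lemma ccvgN u k : ccvg u k -> ccvg (fun n => - u n) (- k).
Proof.
move=> [u1 u2]; split.
- by rewrite ReCN; under eq_fun do rewrite ReCN; exact: cvgN.
- by rewrite ImCN; under eq_fun do rewrite ImCN; exact: cvgN.
Qed.

Lemma ccvgB u v k l : ccvg u k -> ccvg v l -> ccvg (fun n => u n - v n) (k - l).
Proof. by move=> uk /ccvgN; exact: ccvgD. Qed.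

Lemma ccvg_real (u : nat -> R) (k : R) :
  u @ \oo --> k -> ccvg (fun n => (u n)%:C) k%:C.
Proof. by move=> uk; split => //=; exact: cvg_cst. Qed.

Lemma ccvg_nrm u k : ccvg u k -> (fun n => nrm (u n)) @ \oo --> nrm k.
Proof.
move=> [u1 u2]; rewrite nrmE; under eq_fun do rewrite nrmE.
apply: continuous_cvg; first exact: sqrt_continuous.
by apply: cvgD; under eq_fun do rewrite expr2; rewrite expr2; exact: cvgM.
Qed.

Lemma ccvg_uniq u k l : ccvg u k -> ccvg u l -> k = l.
Proof.
by move=> [k1 k2] [l1 l2]; apply: complex_eq;
  [exact: (cvg_unique _ k1 l1) | exact: (cvg_unique _ k2 l2)].
Qed.

Lemma ccvg_nrm_sqr u k : ccvg u k ->
  (fun n => (nrm (u n) ^+ 2)%:E) @ \oo --> ((nrm k ^+ 2)%:E : \bar R).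
Proof.
move=> uk; apply: cvg_EFin; first exact: nearW.
by under eq_fun do rewrite /= expr2; rewrite expr2; apply: cvgM; exact: ccvg_nrm.
Qed.

End ComplexLimits.

(** * Square-integrable complex functions *)

(** Feeds the instance hint below, by which [filterS] and its variants combine almost-everywhere
    statements. *)
Lemma ae_lebesgue_filter (R : realType) :
  Filter (nbhs (almost_everywhere (@lebesgue_measure R))).
Proof. exact: ae_filter_ringOfSetsType. Qed.

#[global] Hint Extern 0 (Filter (nbhs (almost_everywhere _))) =>
  (exact: ae_lebesgue_filter) : typeclass_instances.

Section ComplexMeasurable.
Context {R : realType}.
Implicit Types f g : R -> R[i].

Lemma Cmeas_nrm f : Cmeasurable f -> measurable_fun setT (fun x => nrm (f x)).
Proof.
move=> [m1 m2]; under eq_fun do rewrite nrmE.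
apply: (measurableT_comp (continuous_measurable_fun (@sqrt_continuous R))).
by apply: measurable_funD; exact: measurable_funX.
Qed.

Lemma Cmeas_cst (a : R[i]) : Cmeasurable (fun=> a : R[i]).
Proof. by split; exact: measurable_cst. Qed.

Lemma Cmeas_real (f : R -> R) : measurable_fun setT f -> Cmeasurable (fun x => (f x)%:C).
Proof. by move=> mf; split => //=; exact: measurable_cst. Qed.

Lemma CmeasD f g : Cmeasurable f -> Cmeasurable g -> Cmeasurable (fun x => f x + g x).
Proof.
move=> [f1 f2] [g1 g2]; split.
- by rewrite /comp; under eq_fun do rewrite ReCD; exact: measurable_funD.
- by rewrite /comp; under eq_fun do rewrite ImCD; exact: measurable_funD.
Qed.

Lemma CmeasM f g : Cmeasurable f -> Cmeasurable g -> Cmeasurable (fun x => f x * g x).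
Proof.
move=> [f1 f2] [g1 g2]; split.
- by rewrite /comp; under eq_fun do rewrite ReCM; apply: measurable_funB; exact: measurable_funM.
- by rewrite /comp; under eq_fun do rewrite ImCM; apply: measurable_funD; exact: measurable_funM.
Qed.

Lemma CmeasZ (a : R[i]) f : Cmeasurable f -> Cmeasurable (fun x => a * f x).
Proof. by apply: CmeasM; exact: Cmeas_cst. Qed.

Lemma CmeasN f : Cmeasurable f -> Cmeasurable (fun x => - f x).
Proof. by move=> /(CmeasZ (-1)); under eq_fun do rewrite mulN1r. Qed.

Lemma CmeasB f g : Cmeasurable f -> Cmeasurable g -> Cmeasurable (fun x => f x - g x).
Proof. by move=> mf /CmeasN; exact: CmeasD. Qed.

Lemma Cmeas_conj f : Cmeasurable f -> Cmeasurable (fun x => conjc (f x)).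
Proof.
move=> [f1 f2]; split; rewrite /comp.
- by under eq_fun do rewrite ReCJ.
- by under eq_fun do rewrite ImCJ; exact: measurableT_comp.
Qed.

Lemma Cmeas_cvg (f : nat -> R -> R[i]) g : (forall n, Cmeasurable (f n)) ->
  (forall x, ccvg (f ^~ x) (g x)) -> Cmeasurable g.
Proof.
move=> mf fg; split.
- apply: (@measurable_fun_cvg _ _ _ _ (fun n => ReC \o f n)) => //.
  + by move=> n; have [] := mf n.
  + by move=> x _; have [] := fg x.
- apply: (@measurable_fun_cvg _ _ _ _ (fun n => ImC \o f n)) => //.
  + by move=> n; have [] := mf n.
  + by move=> x _; have [] := fg x.
Qed.

Lemma continuous_Cmeas f : continuous (ReC \o f) -> continuous (ImC \o f) -> Cmeasurable f.
Proof. by move=> f1 f2; split; exact: continuous_measurable_fun. Qed.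

Lemma cderive_Cmeas f df : (forall x, cderive f x (df x)) -> Cmeasurable f.
Proof.
by move=> fdf; apply: continuous_Cmeas => x; have [f1 f2] := fdf x;
  [exact: (is_derive_continuous f1)|exact: (is_derive_continuous f2)].
Qed.

End ComplexMeasurable.

Section SquareIntegrable.
Context {R : realType}.
Local Notation mu := (@lebesgue_measure R).
Implicit Types f g h : R -> R[i].

(** A real number, to be used with [lra]; it takes the default value 0 when the norm is infinite,
    hence the [L2] hypotheses that accompany it. *)
Definition N2 f : R := fine (L2norm f).

Lemma L2norm_sqr f : (L2norm f `^ 2 = \int[mu]_x (nrm (f x) ^+ 2)%:E)%E.
Proof.
rewrite /L2norm poweR_Lnorm ?pnatr_eq0//; apply: eq_integral => x _.
by rewrite /= ger0_norm ?nrm_ge0// powR_mulrn// nrm_ge0.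
Qed.

Lemma L2norm_ge0 f : (0 <= L2norm f)%E. Proof. exact: Lnorm_ge0. Qed.

Lemma N2_ge0 f : 0 <= N2 f. Proof. by rewrite fine_ge0// L2norm_ge0. Qed.

Lemma L2P f :
  L2 f <-> Cmeasurable f /\ (\int[mu]_x (nrm (f x) ^+ 2)%:E < +oo)%E.
Proof.
rewrite /L2 -L2norm_sqr; split => -[mf f2]; split => //; first exact: poweR_lty.
by apply: lty_poweRy f2; rewrite pnatr_eq0.
Qed.

Lemma L2norm_fin f : L2 f -> L2norm f = (N2 f)%:E.
Proof. by move=> [_ f2]; rewrite /N2 fineK// ge0_fin_numE ?L2norm_ge0. Qed.

Lemma N2_sqr f : L2 f -> ((N2 f ^+ 2)%:E = \int[mu]_x (nrm (f x) ^+ 2)%:E)%E.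
Proof.
by move=> f2; rewrite -L2norm_sqr L2norm_fin// poweR_EFin powR_mulrn// N2_ge0.
Qed.

Lemma L2_meas f : L2 f -> Cmeasurable f. Proof. by case. Qed.

Lemma meas_nrm_sqr f : Cmeasurable f ->
  measurable_fun setT (fun x => (nrm (f x) ^+ 2)%:E : \bar R).
Proof. by move=> mf; apply/measurable_EFinP; apply: measurable_funX; exact: Cmeas_nrm. Qed.

Lemma L2_integrable f : L2 f -> mu.-integrable setT (fun x => (nrm (f x) ^+ 2)%:E).
Proof.
move=> /L2P[mf f2]; apply/integrableP; split; first exact: meas_nrm_sqr.
by apply: le_lt_trans f2; under eq_integral do rewrite gee0_abs ?lee_fin ?sqr_ge0//.
Qed.

Lemma L2_le f g : Cmeasurable f -> L2 g -> (forall x, nrm (f x) <= nrm (g x)) -> L2 f.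
Proof.
move=> mf /L2P[mg g2] fg; apply/L2P; split => //; apply: le_lt_trans g2.
apply: ge0_le_integral => //.
- by move=> x _; rewrite lee_fin sqr_ge0.
- exact: meas_nrm_sqr.
- exact: meas_nrm_sqr.
- by move=> x _; rewrite lee_fin ler_pXn2r ?nnegrE ?nrm_ge0.
Qed.

Lemma le_N2 f g : L2 f -> L2 g -> (forall x, nrm (f x) <= nrm (g x)) -> N2 f <= N2 g.
Proof.
move=> f2 g2 fg.
rewrite -(@ler_pXn2r _ 2)// ?nnegrE ?N2_ge0// -lee_fin !N2_sqr//.
apply: ge0_le_integral => //.
- by move=> x _; rewrite lee_fin sqr_ge0.
- exact: meas_nrm_sqr (L2_meas f2).
- exact: meas_nrm_sqr (L2_meas g2).
- by move=> x _; rewrite lee_fin ler_pXn2r ?nnegrE ?nrm_ge0.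
Qed.

Lemma L2norm_ae f g : Cmeasurable f -> Cmeasurable g -> ae_eq mu setT f g ->
  L2norm f = L2norm g.
Proof.
move=> mf mg fg.
have e2 : (L2norm f `^ 2 = L2norm g `^ 2)%E.
  rewrite !L2norm_sqr; apply: ae_eq_integral => //; try exact: meas_nrm_sqr.
  by move: fg; apply: filterS => x /= fg _; rewrite fg.
have : ((L2norm f `^ 2) `^ 2^-1 = (L2norm g `^ 2) `^ 2^-1)%E by rewrite e2.
by rewrite -!poweRrM divff ?pnatr_eq0// !poweRe1 ?L2norm_ge0.
Qed.

Lemma N2_ae f g : Cmeasurable f -> Cmeasurable g -> ae_eq mu setT f g -> N2 f = N2 g.
Proof. by move=> mf mg fg; rewrite /N2 (L2norm_ae mf mg fg). Qed.

(** Minkowski's inequality for the real functions [F] and [G], after the pointwise triangle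
    inequality. The comparison is made on squares, where the norm is an integral, and the square
    root is taken last. *)
Lemma L2normD f g : Cmeasurable f -> Cmeasurable g ->
  (L2norm (fun x => f x + g x)%R <= L2norm f + L2norm g)%E.
Proof.
move=> mf mg; have mfg := CmeasD mf mg.
pose F x := nrm (f x); pose G x := nrm (g x).
apply: le_trans (@minkowski_EFin _ _ _ mu F G 2 _ _ _);
  [|exact: Cmeas_nrm|exact: Cmeas_nrm|by rewrite ler1n].
have le2 : (L2norm (fun x => f x + g x)%R `^ 2 <=
    'N[mu]_2%:E[EFin \o (F \+ G)%R] `^ 2)%E.
  rewrite L2norm_sqr poweR_Lnorm ?pnatr_eq0//.
  apply: ge0_le_integral => //.
  - by move=> x _; rewrite lee_fin sqr_ge0.
  - exact: meas_nrm_sqr.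
  - apply: (@measurableT_comp _ _ _ _ _ _ (fun x => x `^ 2)%E) => //=.
      exact: measurable_poweR.
    apply: measurableT_comp => //.
    apply/measurable_EFinP.
    apply/measurable_EFinP; apply: measurableT_comp => //.
    by apply: measurable_funD; exact: Cmeas_nrm.
  - move=> x _; rewrite /= lee_fin powR_mulrn// ler_pXn2r ?nnegrE ?nrm_ge0//.
    by rewrite (le_trans (nrmD _ _))// ler_norm.
have := @gt0_ler_poweR R 2^-1 _ _ _ _ _ le2.
rewrite -!poweRrM divff ?pnatr_eq0// !poweRe1 ?L2norm_ge0 ?Lnorm_ge0//; apply.
- by rewrite invr_ge0.
- by rewrite in_itv/= leey poweR_ge0.
- by rewrite in_itv/= leey poweR_ge0.
Qed.

Lemma L2D f g : L2 f -> L2 g -> L2 (fun x => f x + g x).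
Proof.
move=> [mf f2] [mg g2]; split; first exact: CmeasD.
by apply: le_lt_trans (L2normD mf mg) _; exact: lte_add_pinfty.
Qed.

Lemma N2D f g : L2 f -> L2 g -> N2 (fun x => f x + g x) <= N2 f + N2 g.
Proof.
move=> f2 g2; rewrite -lee_fin EFinD -!L2norm_fin//; last exact: L2D.
by apply: L2normD; exact: L2_meas.
Qed.

Lemma L2Z (a : R[i]) f : L2 f -> L2 (fun x => a * f x).
Proof.
move=> /L2P[mf f2]; apply/L2P; split; first exact: CmeasZ.
under eq_integral do rewrite nrmM exprMn EFinM.
rewrite ge0_integralZl//; first by rewrite lte_mul_pinfty// lee_fin sqr_ge0.
- exact: meas_nrm_sqr.
- by move=> x _; rewrite lee_fin sqr_ge0.
- by rewrite lee_fin sqr_ge0.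
Qed.

Lemma N2Z (a : R[i]) f : L2 f -> N2 (fun x => a * f x) = nrm a * N2 f.
Proof.
move=> f2; apply/eqP; rewrite -(@eqrXn2 _ 2)// ?mulr_ge0 ?N2_ge0 ?nrm_ge0//.
apply/eqP; apply: EFin_inj; rewrite N2_sqr; last exact: L2Z.
under eq_integral do rewrite nrmM exprMn EFinM.
rewrite ge0_integralZl//; first by rewrite exprMn [RHS]EFinM N2_sqr.
- by apply: meas_nrm_sqr; exact: L2_meas.
- by move=> x _; rewrite lee_fin sqr_ge0.
- by rewrite lee_fin sqr_ge0.
Qed.

Lemma L2N f : L2 f -> L2 (fun x => - f x).
Proof. by move=> /(L2Z (-1)); under eq_fun do rewrite mulN1r. Qed.

Lemma N2N f : L2 f -> N2 (fun x => - f x) = N2 f.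
Proof.
move=> f2; have := N2Z (-1) f2; under eq_fun do rewrite mulN1r.
by rewrite nrmN (_ : nrm 1 = 1) ?mul1r//; exact: Normc.normc1.
Qed.

Lemma L2B f g : L2 f -> L2 g -> L2 (fun x => f x - g x).
Proof. by move=> f2 /L2N; exact: L2D. Qed.

Lemma N2B f g : L2 f -> L2 g -> N2 (fun x => f x - g x) <= N2 f + N2 g.
Proof. by move=> f2 g2; rewrite -(N2N g2); apply: N2D => //; exact: L2N. Qed.

Lemma N2_dist f g : L2 f -> L2 g ->
  N2 (fun x => f x - g x) = N2 (fun x => g x - f x).
Proof.
move=> f2 g2; rewrite -(N2N (L2B f2 g2)).
by congr N2; apply/funext => x; rewrite opprB.
Qed.

Lemma N2_triangle g f h : L2 f -> L2 g -> L2 h ->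
  N2 (fun x => f x - h x) <= N2 (fun x => f x - g x) + N2 (fun x => g x - h x).
Proof.
move=> f2 g2 h2; apply: le_trans (N2D (L2B f2 g2) (L2B g2 h2)).
by under [in leRHS]eq_fun do rewrite addrA subrK.
Qed.

Lemma L2_0 : L2 (fun=> 0 : R[i]).
Proof.
apply/L2P; split; first exact: Cmeas_cst.
by under eq_integral do rewrite nrm0 expr0n/=; rewrite integral0.
Qed.

Lemma N2_0 : N2 (fun=> 0 : R[i]) = 0.
Proof.
rewrite -[RHS](mul0r (N2 (fun=> 0 : R[i]))) -nrm0 -(N2Z _ L2_0).
by congr N2; apply/funext => x; rewrite mul0r.
Qed.

Lemma N2_eq0 f : L2 f -> N2 f = 0 -> ae_eq mu setT f (fun=> 0).
Proof.
move=> f2 f0; have := N2_sqr f2; rewrite f0 expr0n/= => /esym i0.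
have /(ae_eq_integral_abs mu measurableT (meas_nrm_sqr (L2_meas f2))) :
    (\int[mu]_x `|(nrm (f x) ^+ 2)%:E| = 0)%E.
  by rewrite -[RHS]i0; apply: eq_integral => x _; rewrite gee0_abs ?lee_fin ?sqr_ge0.
apply: filterS => x /= /(_ I) [] /eqP; rewrite sqrf_eq0 nrm_eq0 => /eqP //.
Qed.

Lemma N2_dominated (f : nat -> R -> R[i]) g :
  (forall n, Cmeasurable (f n)) -> L2 g -> (forall n x, nrm (f n x) <= nrm (g x)) ->
  (forall x, ccvg (f ^~ x) 0) -> (fun n => N2 (f n)) @ \oo --> (0 : R).
Proof.
move=> mf g2 fg f0.
have f2 n : L2 (f n) by apply: L2_le g2 _.
have cv : {ae mu, forall x, setT x -> (nrm (f n x) ^+ 2)%:E @[n --> \oo] --> (0%E : \bar R)}.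
  apply: aeW => x _; rewrite -(_ : (nrm (0 : R[i]) ^+ 2)%:E = 0%E); last first.
    by rewrite nrm0 expr0n.
  exact: ccvg_nrm_sqr.
have dom : {ae mu, forall x n, setT x ->
    (`|(nrm (f n x) ^+ 2)%:E| <= (nrm (g x) ^+ 2)%:E)%E}.
  apply: aeW => x n _.
  by rewrite gee0_abs ?lee_fin ?sqr_ge0// ler_pXn2r ?nnegrE ?nrm_ge0.
have [_ _] := @dominated_convergence _ _ _ mu setT measurableT
  (fun n x => (nrm (f n x) ^+ 2)%:E) _ (fun x => (nrm (g x) ^+ 2)%:E)
  (fun n => meas_nrm_sqr (mf n)) (measurable_cst _) cv (L2_integrable g2) dom.
rewrite integral0 => H.
have sq0 : (fun n => N2 (f n) ^+ 2) @ \oo --> (0 : R).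
  move/fine_cvgP : H => [_]; apply: cvg_trans; apply: near_eq_cvg.
  by apply: nearW => n /=; rewrite -N2_sqr.
rewrite -(@sqrtr0 R); under eq_fun do rewrite -(ger0_norm (N2_ge0 _)) -sqrtr_sqr.
by apply: continuous_cvg => //; exact: sqrt_continuous.
Qed.

(** By Fatou's lemma the integral of liminf |h n|^2 is at most the limit of the squared norms, which
    is 0. A norm limit and a pointwise limit are thus identified without passing to a
    subsequence. *)
Lemma N2_fatou (h : nat -> R -> R[i]) g : (forall n, L2 (h n)) ->
  (fun n => N2 (h n)) @ \oo --> (0 : R) ->
  {ae mu, forall x, ccvg (h ^~ x) (g x)} -> {ae mu, forall x, g x = 0}.
Proof.
move=> h2 h0 hg.
pose F n x := (nrm (h n x) ^+ 2)%:E.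
have mF n : measurable_fun setT (F n) := meas_nrm_sqr (L2_meas (h2 n)).
have F0 n x : setT x -> (0 <= F n x)%E by rewrite lee_fin sqr_ge0.
have sq0 : (fun n => \int[mu]_x F n x)%E @ \oo --> (0%E : \bar R).
  under eq_fun do rewrite -N2_sqr//.
  apply: cvg_EFin; first exact: nearW.
  by rewrite /comp/= -(mulr0 0); under eq_fun do rewrite expr2; exact: cvgM.
have := fatou mu measurableT mF F0.
rewrite [X in (_ <= X)%E -> _](_ : _ = 0%E); last first.
  by rewrite is_cvg_limn_einfE; [exact/cvg_lim|apply/cvg_ex; exists 0%E].
move=> le0.
have li0 x : setT x -> (0 <= limn_einf (F ^~ x))%E.
  move=> _; rewrite limn_einf_lim; apply: lime_ge; first exact: is_cvg_einfs.
  by apply: nearW => n; apply: le_ereal_inf_tmp => _ [m _ <-]; exact: F0.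
(* No measurability of [g] is assumed, so the lower limit, which is measurable, stands in for
   |g|^2. *)
have mli : measurable_fun setT (fun x => limn_einf (F ^~ x)).
  rewrite (_ : (fun _ => _) =
      fun x => (- limn_esup (fun n => - F n x))%E); last first.
    apply/funext => x; rewrite -limn_einfN; congr limn_einf.
    by apply/funext => n; rewrite /comp oppeK.
  apply: measurableT_comp => //; apply: measurable_fun_limn_esup => n;
     exact: measurableT_comp.
have ae0 : ae_eq mu setT (fun x => limn_einf (F ^~ x)) (cst 0%E).
  apply/(ae_eq_integral_abs mu measurableT mli).
  under eq_integral do rewrite gee0_abs ?li0//.
  by apply/eqP; rewrite eq_le le0 integral_ge0.
apply: filterS2 hg ae0 => x hg /(_ I).
have /cvg_lim cF : F ^~ x @ \oo --> ((nrm (g x) ^+ 2)%:E : \bar R).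
  exact: ccvg_nrm_sqr.
rewrite is_cvg_limn_einfE.
  by rewrite cF// => -[] /eqP; rewrite sqrf_eq0 nrm_eq0 => /eqP.
by apply/cvgP; exact: ccvg_nrm_sqr hg.
Qed.


Lemma L2_mul_integrable f g : L2 f -> L2 g ->
  mu.-integrable setT (EFin \o (fun x => nrm (f x) * nrm (g x))).
Proof.
move=> f2 g2; apply: (@le_integrable _ _ _ mu setT measurableT _
    (fun x => (nrm (f x) ^+ 2)%:E + (nrm (g x) ^+ 2)%:E)%E).
- apply/measurable_EFinP; apply: measurable_funM;
    exact: Cmeas_nrm (L2_meas _).
- move=> x _; rewrite /= lee_fin.
  rewrite !ger0_norm ?addr_ge0 ?sqr_ge0 ?mulr_ge0 ?nrm_ge0//.
  have := sqr_ge0 (nrm (f x) - nrm (g x)); have := sqr_ge0 (nrm (f x) + nrm (g x)).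
  by rewrite !expr2; lra.
- by apply: integrableD => //; exact: L2_integrable.
Qed.

Lemma Cintegrable_le f (G : R -> R) : Cmeasurable f ->
  mu.-integrable setT (EFin \o G) -> (forall x, nrm (f x) <= G x) -> Cintegrable f.
Proof.
move=> [m1 m2] iG fG; split.
- apply: le_integrable iG => //; first exact/measurable_EFinP.
  move=> x _; rewrite /= lee_fin.
  by rewrite (le_trans (Re_le_nrm _))// (le_trans (fG x))// ler_norm.
- apply: le_integrable iG => //; first exact/measurable_EFinP.
  move=> x _; rewrite /= lee_fin.
  by rewrite (le_trans (Im_le_nrm _))// (le_trans (fG x))// ler_norm.
Qed.

Lemma L2_Cintegrable f g : L2 f -> L2 g -> Cintegrable (fun x => f x * g x).
Proof.
move=> f2 g2; apply: (Cintegrable_le _ (L2_mul_integrable f2 g2)).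
- by apply: CmeasM; exact: L2_meas.
- by move=> x; rewrite nrmM.
Qed.

Lemma L2_conj f : L2 f -> L2 (fun x => conjc (f x)).
Proof.
by move=> f2; apply: (L2_le (Cmeas_conj (L2_meas f2)) f2) => x; rewrite nrmJ.
Qed.

Lemma CintegrableZ (a : R[i]) f : Cintegrable f -> Cintegrable (fun x => a * f x).
Proof.
move=> [f1 f2]; split; rewrite /comp.
- under eq_fun do rewrite ReCM EFinB !EFinM.
  by apply: integrableB => //; exact: integrableZl.
- under eq_fun do rewrite ImCM EFinD !EFinM.
  by apply: integrableD => //; exact: integrableZl.
Qed.

Lemma CintegralD f g : Cintegrable f -> Cintegrable g ->
  Cintegral (fun x => f x + g x) = Cintegral f + Cintegral g.
Proof.
move=> [f1 f2] [g1 g2]; apply: complex_eq; rewrite ?ReCD ?ImCD /=.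
- by under eq_Rintegral do rewrite ReCD; rewrite RintegralD.
- by under eq_Rintegral do rewrite ImCD; rewrite RintegralD.
Qed.

Lemma integrable_scale (k : R) (h : R -> R) : mu.-integrable setT (EFin \o h) ->
  mu.-integrable setT (EFin \o (fun x => k * h x)).
Proof.
by move=> ih; rewrite /comp; under eq_fun do rewrite EFinM; exact: integrableZl.
Qed.

Lemma CintegralZ (a : R[i]) f : Cintegrable f ->
  Cintegral (fun x => a * f x) = a * Cintegral f.
Proof.
move=> [f1 f2]; apply: complex_eq; rewrite ?[RHS]ReCM ?[RHS]ImCM /=.
- under eq_Rintegral do rewrite ReCM.
  rewrite RintegralB//; [|exact: integrable_scale..].
  by rewrite !RintegralZl.
- under eq_Rintegral do rewrite ImCM.
  rewrite RintegralD//; [|exact: integrable_scale..].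
  by rewrite !RintegralZl.
Qed.

Lemma Cintegral_conj f : Cintegrable f ->
  Cintegral (fun x => conjc (f x)) = conjc (Cintegral f).
Proof.
move=> [f1 f2]; apply: complex_eq; rewrite ?ReCJ ?ImCJ /=.
- by under eq_Rintegral do rewrite ReCJ.
- under eq_Rintegral do rewrite ImCJ -mulN1r.
  by rewrite RintegralZl// mulN1r.
Qed.

Lemma Rintegral_ae (f g : R -> R) : measurable_fun setT f -> measurable_fun setT g ->
  ae_eq mu setT f g -> \int[mu]_x f x = \int[mu]_x g x.
Proof.
move=> mf mg fg; rewrite /Rintegral; congr fine.
apply: ae_eq_integral => //; [exact/measurable_EFinP|exact/measurable_EFinP|].
by move: fg; apply: filterS => x fg /fg /= ->.
Qed.

Lemma Cintegral_ae f g : Cmeasurable f -> Cmeasurable g -> ae_eq mu setT f g ->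
  Cintegral f = Cintegral g.
Proof.
move=> [f1 f2] [g1 g2] fg; apply: complex_eq => /=; apply: Rintegral_ae => //;
  by move: fg; apply: filterS => x /= + /[dup] H => /(_ H) ->.
Qed.

Lemma Rintegral_dominated (f : nat -> R -> R) (g G : R -> R) :
  (forall n, measurable_fun setT (f n)) -> mu.-integrable setT (EFin \o G) ->
  (forall n x, `|f n x| <= G x) -> (forall x, f ^~ x @ \oo --> g x) ->
  (fun n => \int[mu]_x f n x) @ \oo --> \int[mu]_x g x.
Proof.
move=> mf iG fG fg.
have mg : measurable_fun setT g by apply: measurable_fun_cvg => // x _; exact: fg.
have cv : {ae mu, forall x, setT x -> (f n x)%:E @[n --> \oo] --> (g x)%:E}.
  by apply: aeW => x _; apply: cvg_EFin; [exact: nearW|exact: fg].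
have dom : {ae mu, forall x n, setT x -> (`|(f n x)%:E| <= (G x)%:E)%E}.
  by apply: aeW => x n _; exact: fG.
have [ig _] := @dominated_convergence _ _ _ mu setT measurableT
  (fun n x => (f n x)%:E) (fun x => (g x)%:E) (fun x => (G x)%:E)
  (fun n => (measurable_EFinP _ _).2 (mf n)) ((measurable_EFinP _ _).2 mg)
  cv iG
  dom.
rewrite /Rintegral => H; apply: fine_cvg; rewrite fineK//.
exact: integrable_fin_num.
Qed.

Lemma Cintegral_dominated (f : nat -> R -> R[i]) g (G : R -> R) :
  (forall n, Cmeasurable (f n)) -> mu.-integrable setT (EFin \o G) ->
  (forall n x, nrm (f n x) <= G x) -> (forall x, ccvg (f ^~ x) (g x)) ->
  ccvg (fun n => Cintegral (f n)) (Cintegral g).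
Proof.
move=> mf iG fG fg; split => /=; apply: (Rintegral_dominated _ iG) => /=.
- by move=> n; have [] := mf n.
- by move=> n x; rewrite (le_trans (Re_le_nrm _)).
- by move=> x; have [] := fg x.
- by move=> n; have [] := mf n.
- by move=> n x; rewrite (le_trans (Im_le_nrm _)).
- by move=> x; have [] := fg x.
Qed.

End SquareIntegrable.


(** * Completeness of L^2 *)

Section RieszFischer.
Context {R : realType}.
Local Notation mu := (@lebesgue_measure R).
Implicit Types f g h : R -> R[i].

(** Fatou's lemma for the squared moduli: balls of L^2 are closed under almost-everywhere limits. *)
Lemma L2_fatou (h : nat -> R -> R[i]) g (C : R) : (forall n, L2 (h n)) ->
  (forall n, N2 (h n) <= C) -> Cmeasurable g ->
  {ae mu, forall x, ccvg (h ^~ x) (g x)} -> L2 g /\ N2 g <= C.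
Proof.
move=> h2 hC mg hg.
have C0 : 0 <= C by apply: le_trans (hC 0%N); exact: N2_ge0.
pose F n x := (nrm (h n x) ^+ 2)%:E.
have mF n : measurable_fun setT (F n) := meas_nrm_sqr (L2_meas (h2 n)).
have F0 n x : setT x -> (0 <= F n x)%E by rewrite lee_fin sqr_ge0.
have le1 := fatou mu measurableT mF F0.
have mli : measurable_fun setT (fun x => limn_einf (F ^~ x)).
  rewrite (_ : (fun _ => _) =
      fun x => (- limn_esup (fun n => - F n x))%E); last first.
    apply/funext => x; rewrite -limn_einfN; congr limn_einf.
    by apply/funext => n; rewrite /comp oppeK.
  apply: measurableT_comp => //; apply: measurable_fun_limn_esup => n;
     exact: measurableT_comp.
have gE : (\int[mu]_x (nrm (g x) ^+ 2)%:E <= (C ^+ 2)%:E)%E.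
  have -> : (\int[mu]_x (nrm (g x) ^+ 2)%:E = \int[mu]_x limn_einf (F ^~ x))%E.
    apply: ae_eq_integral => //; first exact: meas_nrm_sqr.
    move: hg; apply: filterS => x /ccvg_nrm_sqr hg _.
    by rewrite is_cvg_limn_einfE; [exact/esym/cvg_lim|exact/cvgP/hg].
  apply: le_trans le1 _; rewrite limn_einf_lim.
  apply: lime_le; first exact: is_cvg_einfs.
  apply: nearW => n; apply: (@le_trans _ _ (\int[mu]_x F n x)%E).
    by apply: ereal_inf_lbound; exists n => /=.
  by rewrite -N2_sqr// lee_fin ler_pXn2r ?nnegrE ?N2_ge0.
have g2 : L2 g by apply/L2P; split => //; apply: le_lt_trans gE _; rewrite ltry.
split => //; rewrite -(@ler_pXn2r _ 2)// ?nnegrE ?N2_ge0//.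
by rewrite -lee_fin N2_sqr.
Qed.

(** The partial sums [S n] of the moduli of the increments have bounded norms, so by monotone
    convergence their limit is finite almost everywhere, and there the telescoping series converges
    absolutely. The rate 3^-n is the one met in the gliding hump argument, and 3/2 * 3^-n is the
    tail sum of 3^-k over k >= n. *)
Lemma L2_complete (g : nat -> R -> R[i]) : (forall n, L2 (g n)) ->
  (forall n, N2 (fun x => g n.+1 x - g n x) <= 3^-1 ^+ n) ->
  exists2 f, L2 f & forall n, N2 (fun x => f x - g n x) <= 3 / 2 * 3^-1 ^+ n.
Proof.
move=> g2 gg.
pose d k x := nrm (g k.+1 x - g k x).
have d0 k x : 0 <= d k x := nrm_ge0 _.
pose S n x : R := \sum_(0 <= k < n) d k x.
have S0 n x : 0 <= S n x by rewrite /S sumr_ge0.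
have Snd x : nondecreasing_seq (S ^~ x).
  by apply/nondecreasing_seqP => n; rewrite /S big_nat_recr//= lerDl.
have geo n m : (n <= m)%N -> 3 / 2 * (3^-1 ^+ n - 3^-1 ^+ m) <= 3 / 2 * 3^-1 ^+ n :> R.
  by move=> _; rewrite ler_pM2l ?divr_gt0// gerDl oppr_le0 exprn_ge0 ?invr_ge0.
have geoS m : 3 / 2 * (3^-1 ^+ m - 3^-1 ^+ m.+1) = 3^-1 ^+ m :> R.
  by rewrite exprS; field.
have S2 n : L2 (fun x => (S n x)%:C) /\
    N2 (fun x => (S n x)%:C) <= 3 / 2 * (3^-1 ^+ 0 - 3^-1 ^+ n).
  elim: n => [|n [IH1 IH2]].
    rewrite (_ : (fun x => _) = fun=> 0); first by rewrite N2_0 subrr mulr0; split => //; exact: L2_0.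
    by apply/funext => x; rewrite /S big_geq.
  have d2 : L2 (fun x => (d n x)%:C).
    apply: (L2_le _ (L2B (g2 n.+1) (g2 n))) => [|x].
      exact: (Cmeas_real (Cmeas_nrm (CmeasB (L2_meas (g2 n.+1)) (L2_meas (g2 n))))).
    by rewrite nrm_real ger0_norm.
  have dN : N2 (fun x => (d n x)%:C) <= 3^-1 ^+ n.
    apply: le_trans (gg n); apply: le_N2 => //; first exact: L2B.
    by move=> x; rewrite nrm_real ger0_norm.
  have SE : (fun x => (S n.+1 x)%:C) = (fun x => (S n x)%:C + (d n x)%:C).
    by apply/funext => x; rewrite /S big_nat_recr//= -rcD.
  rewrite SE; split; first exact: L2D.
  apply: le_trans (N2D IH1 d2) _; apply: le_trans (lerD IH2 dN) _.
  by have := geoS n; lra.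
pose F n x := (S n x ^+ 2)%:E.
have FE n x : F n x = (nrm (S n x)%:C ^+ 2)%:E.
  by rewrite /F nrm_real ger0_norm.
have mF n : measurable_fun setT (F n).
  rewrite (_ : F n = fun x => (nrm (S n x)%:C ^+ 2)%:E) ?funeqE//.
  by apply: meas_nrm_sqr; apply: L2_meas; have [] := S2 n.
have F0 n x : setT x -> (0 <= F n x)%E by rewrite lee_fin sqr_ge0.
have Fnd x : setT x -> nondecreasing_seq (F ^~ x).
  by move=> _ n m nm; rewrite lee_fin ler_pXn2r ?nnegrE// Snd.
have FleT n x : (F n x <= limn (F ^~ x))%E.
  rewrite (cvg_lim _ (ereal_nondecreasing_cvgn (Fnd x I)))//.
  by apply: ereal_sup_ubound; exists n.
have mc := monotone_convergence mu measurableT mF F0 Fnd.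
have mlF : measurable_fun setT (fun x => limn (F ^~ x)).
  apply: (@emeasurable_fun_cvg _ _ _ setT F) => // x _.
  exact: (ereal_nondecreasing_is_cvgn (Fnd x I)).
have iF : mu.-integrable setT (fun x => limn (F ^~ x)).
  apply/integrableP; split => //.
  under eq_integral do rewrite gee0_abs ?(le_trans (F0 0%N _ I) (FleT _ _))//.
  rewrite mc; apply: (@le_lt_trans _ _ ((3 / 2) ^+ 2)%:E); last by rewrite ltry.
  apply: lime_le.
    apply: ereal_nondecreasing_is_cvgn => n m nm; apply: ge0_le_integral => //.
    - by move=> x _; exact: F0.
    - exact: mF.
    - exact: mF.
    - by move=> x _; exact: (Fnd x I _ _ nm).
  apply: nearW => n; under eq_integral do rewrite FE; have [Sn2 SnN] := S2 n.
  rewrite -N2_sqr// lee_fin ler_pXn2r ?nnegrE ?N2_ge0 ?divr_ge0//.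
  by apply: le_trans SnN _; apply: le_trans (geo _ _ _) _ => //; rewrite expr0 mulr1.
pose E := [set x | (limn (F ^~ x) < +oo)%E].
have mE : measurable E.
  have := emeasurable_fun_infty_o measurableT mlF +oo%E.
  by rewrite setTI.
have aeE : {ae mu, forall x, E x}.
  have := integrable_ae measurableT iF; apply: filterS => x /(_ I).
  by rewrite /E/= fin_numElt => /andP[].
have cvE x : E x -> exists l, ccvg (g ^~ x) l.
  move=> Ex.
  have SB n : S n x <= 1 + fine (limn (F ^~ x)).
    have FxB := FleT n x.
    have Tf : limn (F ^~ x) \is a fin_num.
      by rewrite ge0_fin_numE// (le_trans _ FxB)// F0.
    have : S n x ^+ 2 <= fine (limn (F ^~ x)) by rewrite -lee_fin fineK.
    have := sqr_ge0 (S n x - 1); rewrite !expr2; have := S0 n x; lra.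
  have cS : cvgn (S ^~ x).
    by apply: nondecreasing_is_cvgn => //; exists (1 + fine (limn (F ^~ x))) => _ [n _ <-].
  have abscv (p : R[i] -> R) : (forall z w, p (z - w) = p z - p w) ->
      (forall z, `|p z| <= nrm z) -> cvgn (fun n => p (g n x)).
    move=> pB pn.
    have : cvgn (series (fun k => p (g k.+1 x) - p (g k x))).
      apply: normed_cvg; apply: (@series_le_cvg _ _ (d ^~ x)) => //= n.
      by rewrite -pB; exact: pn.
    move=> cc; have -> : (fun n => p (g n x)) =
        (fun=> p (g 0%N x)) + series (fun k => p (g k.+1 x) - p (g k x)).
      by apply/funext => n; rewrite /series/= fctE telescope_sumr// addrC subrK.
    by apply: is_cvgD => //; exact: is_cvg_cst.
  have ReB (z w : R[i]) : ReC (z - w) = ReC z - ReC w by rewrite ReCD ReCN.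
  have ImB (z w : R[i]) : ImC (z - w) = ImC z - ImC w by rewrite ImCD ImCN.
  have /cvg_ex[/= a ca] := abscv _ ReB (@Re_le_nrm _).
  have /cvg_ex[/= b cb] := abscv _ ImB (@Im_le_nrm _).
  by exists (a +i* b).
(* The default value 0 off [E] makes [f] the limit at every point of the measurable functions
   [\1_E * g n]. *)
pose f x := if pselect (E x) is left Ex then projT1 (cid (cvE x Ex)) else 0.
have fE x : E x -> ccvg (g ^~ x) (f x).
  by move=> Ex; rewrite /f; case: pselect => // Ex'; case: cid.
have mf : Cmeasurable f.
  apply: (@Cmeas_cvg _ (fun n x => (\1_E x)%:C * g n x)).
    move=> n; apply: CmeasM; last exact: L2_meas.
    by apply: Cmeas_real; exact: measurable_indic.
  move=> x; have [Ex|nEx] := pselect (E x).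
    rewrite indicE mem_set//= -[f x]mul1r; apply: ccvgM (fE _ Ex); exact: ccvg_cst.
  rewrite indicE memNset//=; under eq_fun do rewrite mul0r.
  by rewrite /f; case: pselect => // _; exact: ccvg_cst.
have key n : L2 (fun x => f x - g n x) /\ N2 (fun x => f x - g n x) <= 3 / 2 * 3^-1 ^+ n.
  apply: (@L2_fatou (fun m x => g (n + m)%N x - g n x)).
  - by move=> m; exact: L2B.
  - move=> m; apply: le_trans (geo n (n + m)%N (leq_addr _ _)).
    elim: m => [|m IH].
      rewrite addn0 subrr mulr0 (_ : (fun _ => _) = fun=> 0) ?N2_0//.
      by apply/funext => x; rewrite subrr.
    rewrite addnS; apply: le_trans (N2_triangle (g2 _) (g2 (n + m)%N) (g2 n)) _.
    apply: le_trans (lerD (gg _) IH) _.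
    by have := geoS (n + m)%N; lra.
  - by apply: CmeasB => //; exact: L2_meas.
  - move: aeE; apply: filterS => x /fE [f1 f2].
    apply: ccvgB; last exact: ccvg_cst.
    by split; [rewrite -(cvg_shiftn n) in f1|rewrite -(cvg_shiftn n) in f2];
      under eq_fun do rewrite addnC.
exists f; last by move=> n; have [] := key n.
have := L2D (key 0%N).1 (g2 0%N).
by under eq_fun do rewrite subrK.
Qed.

End RieszFischer.


(** * Bounded operators and semigroups *)

Section Operators.
Context {R : realType}.
Local Notation mu := (@lebesgue_measure R).
Local Notation fct := (R -> R[i]).
Implicit Types (f g h : fct) (T : fct -> fct).

Definition L2dist f g : R := N2 (fun x => f x - g x).

Lemma L2dist_ae f f' g g' : L2 f -> L2 f' -> L2 g -> L2 g' ->
  ae_eq mu setT f f' -> ae_eq mu setT g g' -> L2dist f g = L2dist f' g'.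
Proof.
move=> f2 f'2 g2 g'2 ff' gg'; apply: N2_ae; try by apply: CmeasB; exact: L2_meas.
by apply: filterS2 ff' gg' => x /= ff' gg' I; rewrite ff'// gg'.
Qed.

Lemma L2dist_eq0 f g : L2 f -> L2 g -> L2dist f g = 0 -> ae_eq mu setT f g.
Proof.
move=> f2 g2 /(N2_eq0 (L2B f2 g2)); apply: filterS => x /= fg /fg /eqP.
by rewrite subr_eq0 => /eqP.
Qed.

Lemma L2distxx f : L2dist f f = 0.
Proof.
by rewrite /L2dist (_ : (fun _ => _) = fun=> 0) ?N2_0//; apply/funext => x; rewrite subrr.
Qed.

Lemma L2dist_triangle g f h : L2 f -> L2 g -> L2 h ->
  L2dist f h <= L2dist f g + L2dist g h.
Proof. exact: N2_triangle. Qed.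

Lemma L2distC f g : L2 f -> L2 g -> L2dist f g = L2dist g f.
Proof. exact: N2_dist. Qed.

Lemma L2dist_ge0 f g : 0 <= L2dist f g. Proof. exact: N2_ge0. Qed.

Lemma L2dist0 f : L2dist f (fun=> 0) = N2 f.
Proof. by congr N2; apply/funext => x; rewrite subr0. Qed.

Lemma N2_leD f g : L2 f -> L2 g -> N2 f <= N2 g + L2dist f g.
Proof.
move=> f2 g2; have := L2dist_triangle f2 g2 L2_0; rewrite !L2dist0; lra.
Qed.

Lemma op_L2 T f : bounded_operator T -> L2 f -> L2 (T f). Proof. by case=> + _ _ _; apply. Qed.

Lemma opB T f g : bounded_operator T -> L2 f -> L2 g ->
  ae_eq mu setT (T (fun x => f x - g x)) (fun x => T f x - T g x).
Proof.
move=> [T2 Tae Tlin _] f2 g2.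
have := Tlin (-1) g f g2 f2.
rewrite (_ : (fun x => -1 * g x + f x) = fun x => f x - g x); last first.
  by apply/funext => x; rewrite mulN1r addrC.
by apply: filterS => x /= H I; rewrite H// mulN1r addrC.
Qed.

Lemma op_bound T : bounded_operator T ->
  exists2 M : R, 0 <= M & forall f, L2 f -> N2 (T f) <= M * N2 f.
Proof.
move=> bT; have [T2 _ _ [M TM]] := bT; exists (Num.max M 0).
  by rewrite le_max lexx orbT.
move=> f f2; have := TM _ f2; rewrite !L2norm_fin//; last exact: T2.
rewrite -EFinM lee_fin => /le_trans; apply.
by rewrite ler_wpM2r ?N2_ge0// le_max lexx.
Qed.

Lemma op_dist T M : bounded_operator T -> (forall f, L2 f -> N2 (T f) <= M * N2 f) ->
  forall f g, L2 f -> L2 g -> L2dist (T f) (T g) <= M * L2dist f g.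
Proof.
move=> bT TM f g f2 g2; apply: le_trans (TM _ (L2B f2 g2)).
rewrite le_eqVlt; apply/orP; left; apply/eqP/N2_ae.
- by apply/CmeasB; apply: L2_meas; exact: op_L2.
- by apply/L2_meas/op_L2/L2B.
- by have := opB bT f2 g2; apply: filterS => x /= H I; rewrite H.
Qed.

Lemma opZ T (a : R[i]) f : bounded_operator T -> L2 f ->
  ae_eq mu setT (T (fun x => a * f x)) (fun x => a * T f x).
Proof.
move=> bT f2; have [T2 Tae Tlin _] := bT.
have [M _ TM] := op_bound bT.
have T0 : ae_eq mu setT (T (fun=> 0)) (fun=> 0).
  apply: N2_eq0; first exact/T2/L2_0.
  by apply/eqP; rewrite eq_le N2_ge0 andbT -(mulr0 M) -N2_0; exact/TM/L2_0.
have := Tlin a f (fun=> 0) f2 L2_0.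
rewrite (_ : (fun x => a * f x + 0) = fun x => a * f x); last first.
  by apply/funext => x; rewrite addr0.
by apply: filterS2 T0 => x /= T0 H I; rewrite H// T0// addr0.
Qed.

(* Sokal's gliding hump: add or subtract 3^-k times a near-maximizer of the
   k-th operator, whichever makes the k-th image larger. *)
Lemma uniform_boundedness (S : nat -> fct -> fct) :
  (forall n, bounded_operator (S n)) ->
  (forall f, L2 f -> exists C, forall n, N2 (S n f) <= C) ->
  exists M : R, forall n f, L2 f -> N2 (S n f) <= M * N2 f.
Proof.
move=> bS ptS; apply: contrapT => /forallNP unb.
(* Norms of the images of the unit ball; the supremum [P n] below is the operator norm of [S n]. *)
pose A n := [set r : R | exists f, [/\ L2 f, N2 f <= 1 & r = N2 (S n f)]].
have A0 n : A n 0.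
  exists (fun=> 0); split; [exact: L2_0|by rewrite N2_0|].
  have [M _ SM] := op_bound (bS n).
  by apply/eqP; rewrite eq_le N2_ge0/= -(mulr0 M) -N2_0; exact/SM/L2_0.
have Asup n : has_sup (A n).
  split; first by exists 0.
  have [M M0 SM] := op_bound (bS n); exists M => _ [f [f2 f1 ->]].
  by apply: le_trans (SM _ f2) _; rewrite -[leRHS]mulr1 ler_wpM2l.
pose P n := sup (A n).
have P0 n : 0 <= P n by apply: ub_le_sup => //; case: (Asup n).
have SP n f : L2 f -> N2 (S n f) <= P n * N2 f.
  move=> f2; have [f0|fn0] := eqVneq (N2 f) 0.
    have [M _ SM] := op_bound (bS n).
    by rewrite f0 mulr0; apply: le_trans (SM _ f2) _; rewrite f0 mulr0.
  have fp : 0 < N2 f by rewrite lt_neqAle eq_sym fn0 N2_ge0.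
  pose k : R[i] := ((N2 f)^-1)%:C.
  have nk : nrm k = (N2 f)^-1 by rewrite nrm_real ger0_norm// invr_ge0 ltW.
  have : A n (N2 (S n (fun x => k * f x))).
    exists (fun x => k * f x); split => //; first exact: L2Z.
    by rewrite N2Z// nk mulVf.
  move=> /(ub_le_sup (Asup n).2); rewrite -/(P n).
  rewrite (_ : N2 _ = (N2 f)^-1 * N2 (S n f)); last first.
    rewrite -nk -N2Z; last exact: op_L2.
    apply: N2_ae; [by apply/L2_meas/op_L2/L2Z|by apply/L2_meas/L2Z/op_L2|exact: opZ].
  by rewrite ler_pdivrMl// mulrC.
have big (M : R) : exists n, M < P n.
  apply: contrapT => /forallNP nM; apply: (unb M) => n f f2.
  apply: le_trans (SP n f f2) _; rewrite ler_wpM2r ?N2_ge0//.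
  by rewrite leNgt; apply/negP/nM.
have nx k := cid (big (4 ^+ k)).
pose m k := projT1 (nx k).
have Pm k : 4 ^+ k < P (m k) by rewrite /m; case: (nx k).
have ph k : exists f, [/\ L2 f, N2 f <= 1 & 2 / 3 * P (m k) <= N2 (S (m k) f)].
  have Pp : 0 < P (m k) by apply: le_lt_trans (Pm k); rewrite exprn_ge0.
  have [_ [f [f2 f1 ->]] lt] := @sup_adherent _ (A (m k)) (P (m k) / 3) (divr_gt0 Pp (ltr0Sn _ _)) (Asup _).
  exists f; split => //; apply/ltW; move: lt; rewrite -/(P _); apply: le_lt_trans.
  by rewrite le_eqVlt; apply/orP; left; apply/eqP; field.
pose phi k := projT1 (cid (ph k)).
have phiP k : [/\ L2 (phi k), N2 (phi k) <= 1 & 2 / 3 * P (m k) <= N2 (S (m k) (phi k))].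
  by rewrite /phi; case: cid.
pose e k : R[i] := (3^-1 ^+ k)%:C.
have ne k : nrm (e k) = 3^-1 ^+ k by rewrite nrm_real ger0_norm// exprn_ge0// invr_ge0.
pose up k (y : fct) : fct := fun x => y x + e k * phi k x.
pose dn k (y : fct) : fct := fun x => y x - e k * phi k x.
pose c k := 3^-1 ^+ k * (2 / 3 * P (m k)).
pose nxt k y := if c k <= N2 (S (m k) (up k y)) then up k y else dn k y.
pose X := fix X k := if k is k.+1 then nxt k (X k) else (fun=> 0).
have ephi2 k : L2 (fun x => e k * phi k x) by apply: L2Z; have [] := phiP k.
have X2 k : L2 (X k).
  elim: k => [|k IH] /=; first exact: L2_0.
  by rewrite /nxt; case: ifP => _; [exact: L2D|exact: L2B].
have Xd k : N2 (fun x => X k.+1 x - X k x) <= 3^-1 ^+ k.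
  have le1 : N2 (fun x => e k * phi k x) <= 3^-1 ^+ k.
    have [p2 p1 _] := phiP k; by rewrite N2Z// ne ler_piMr.
  apply: le_trans le1; rewrite /= /nxt; case: ifP => _.
    by rewrite /up; under eq_fun do rewrite addrC addKr.
  by rewrite /dn; under eq_fun do rewrite addrC addKr; rewrite N2N.
(* The two candidates differ by twice the hump [e k * phi k], whose image has norm at least [c k];
   hence their images cannot both be smaller than [c k]. *)
have Xbig k : c k <= N2 (S (m k) (X k.+1)).
  rewrite /= /nxt; case: ifP => // /negbT; rewrite -ltNge => upc.
  have Sm2 f : L2 f -> L2 (S (m k) f) by exact/op_L2.
  have ud : N2 (S (m k) (fun x => (e k *+ 2) * phi k x)) <=
      N2 (S (m k) (up k (X k))) + N2 (S (m k) (dn k (X k))).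
    have u2 : L2 (up k (X k)) by exact: L2D.
    have d2 : L2 (dn k (X k)) by exact: L2B.
    apply: le_trans (N2B (Sm2 _ u2) (Sm2 _ d2)).
    rewrite le_eqVlt; apply/orP; left; apply/eqP/N2_ae.
    - by apply/L2_meas/Sm2/L2Z; have [] := phiP k.
    - by apply/L2_meas/L2B; exact: Sm2.
    - have := opB (bS (m k)) u2 d2; rewrite (_ : (fun x => _) = fun x => (e k *+ 2) * phi k x)//.
      by apply/funext => x; rewrite /up /dn mulr2n mulrDl; ring.
  have : 2 * c k <= N2 (S (m k) (fun x => (e k *+ 2) * phi k x)).
    have [p2 p1 p3] := phiP k.
    rewrite (_ : N2 _ = (2 * 3^-1 ^+ k) * N2 (S (m k) (phi k))).
      by rewrite -mulrA ler_pM2l// /c ler_wpM2l// exprn_ge0// invr_ge0.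
    have n2 : nrm (e k *+ 2) = 2 * 3^-1 ^+ k by rewrite normcMn ne mulr_natl.
    rewrite -n2 -N2Z; last exact: Sm2.
    apply: N2_ae; [by apply/L2_meas/Sm2/L2Z|by apply/L2_meas/L2Z/Sm2|exact: opZ].
  lra.
have [x x2 xX] := L2_complete X2 Xd.
have [C SC] := ptS _ x2.
(* The humps after the k-th sum to at most 3/2 * 3^-(k+1), half of 3^-k. So the image of [x] under
   [S (m k)] has norm at least (2/3 - 1/2) * 3^-k * P (m k), and P (m k) > 4^k. *)
have low k : (4 / 3) ^+ k <= 6 * C.
  have h1 := SC (m k); have h2 := Xbig k.
  have h3 : N2 (S (m k) (X k.+1)) <= N2 (S (m k) x) + L2dist (S (m k) (X k.+1)) (S (m k) x).
    by apply: N2_leD; exact: op_L2.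
  have h4 := op_dist (bS (m k)) (SP (m k)) (X2 k.+1) x2.
  have h5 : L2dist (X k.+1) x <= 3 / 2 * 3^-1 ^+ k.+1 by rewrite L2distC//; exact: xX.
  have h6 : P (m k) * L2dist (X k.+1) x <= P (m k) * (3 / 2 * 3^-1 ^+ k.+1).
    by rewrite ler_wpM2l.
  have h7 : 3^-1 ^+ k * 4 ^+ k <= 3^-1 ^+ k * P (m k).
    by rewrite ler_wpM2l ?exprn_ge0 ?invr_ge0// ltW.
  have h8 : P (m k) * (3 / 2 * 3^-1 ^+ k.+1) = 3^-1 ^+ k * P (m k) / 2.
    by rewrite exprS; field.
  have h9 : (4 / 3) ^+ k = 3^-1 ^+ k * 4 ^+ k :> R by rewrite exprMn mulrC.
  rewrite h9; move: h2; rewrite /c; lra.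
have bern k : k%:R / 3 <= (4 / 3 : R) ^+ k.
  elim: k => [|k IH]; first by rewrite mul0r expr0.
  have : 1 <= (4 / 3 : R) ^+ k by rewrite exprn_ege1//; lra.
  by rewrite exprS -[k.+1%:R]natr1; lra.
have C0 : 0 <= 18 * C by rewrite mulr_ge0//; apply: le_trans (SC 0%N); exact: N2_ge0.
have := archi_boundP C0; have := le_trans (bern (Num.bound (18 * C))) (low _); lra.
Qed.

End Operators.

(** * Strongly continuous semigroups in epsilon-delta form *)

Section Semigroups.
Context {R : realType}.
Local Notation mu := (@lebesgue_measure R).
Local Notation fct := (R -> R[i]).
Implicit Types (f g h : fct) (T : R -> fct -> fct).

Lemma cvg_ereal0_lt (X : Type) (F : set_system X) {FF : Filter F} (u : X -> \bar R) (e : R) :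
  u @ F --> (0 : \bar R) -> 0 < e -> \forall t \near F, (u t < e%:E)%E.
Proof.
move=> u0 /(@nbhs_open_ereal_lt _ 0 (fun=> e)); exact: u0.
Qed.

Lemma at_right0P (P : set R) : (\forall t \near (0 : R)^'+, P t) ->
  exists2 d : R, 0 < d & forall t, 0 < t < d -> P t.
Proof.
move=> /nbhs_ballP[d /= d0 dP]; exists d => // t /andP[t0 td].
by apply: dP => //=; rewrite /ball/= sub0r normrN gtr0_norm.
Qed.

Definition strongly_continuous0 T := forall f, L2 f -> forall e : R, 0 < e ->
  exists2 d : R, 0 < d & forall t, 0 < t < d -> L2dist (T t f) f < e.

(** The limit of the difference quotient, multiplied through by t: an error [e * t] is what the mean
    value inequality consumes. *)
Definition has_generator T f g := [/\ L2 f, L2 g & forall e : R, 0 < e ->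
  exists2 d : R, 0 < d & forall t, 0 < t < d ->
    N2 (fun x => T t f x - f x - t%:C * g x) <= e * t].

Definition is_semigroup T :=
  [/\ forall t : R, 0 <= t -> bounded_operator (T t),
      forall f, L2 f -> ae_eq mu setT (T 0 f) f,
      forall (s t : R) f, 0 <= s -> 0 <= t -> L2 f ->
        ae_eq mu setT (T (s + t) f) (T s (T t f)) &
      strongly_continuous0 T].

Lemma C0_semigroup_is T : C0_semigroup T -> is_semigroup T.
Proof.
move=> [bT T0 Tsg Tc]; split=> // f f2 e e0.
have [d d0 H] := at_right0P (cvg_ereal0_lt (Tc f f2) e0).
exists d => // t td; rewrite -lte_fin -L2norm_fin; first exact: H.
by apply: L2B => //; apply: op_L2 => //; apply: bT; case/andP : td => /ltW.
Qed.

Lemma generator_has T f g : (forall t : R, 0 <= t -> bounded_operator (T t)) ->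
  generator T f g -> has_generator T f g.
Proof.
move=> bT [f2 g2 fg]; split => // e e0.
have [d d0 H] := at_right0P (cvg_ereal0_lt fg e0); exists d => // t td.
have t0 : 0 < t by case/andP : td.
have Tf2 : L2 (T t f) by apply: op_L2 => //; apply: bT; exact: ltW.
rewrite (_ : (fun x => _) =
    fun x => t%:C * ((t^-1)%:C * (T t f x - f x) - g x)); last first.
  by apply/funext => x; rewrite mulrBr mulrA -rcM divff ?gt_eqF// mul1r.
have h2 : L2 (fun x => (t^-1)%:C * (T t f x - f x) - g x).
  by apply: L2B => //; apply/L2Z/L2B.
rewrite N2Z// nrm_real gtr0_norm// mulrC ler_pM2r//.
by rewrite ltW// -lte_fin -L2norm_fin//; exact: H.
Qed.

(** If no bound held near 0, there would be times [r k] tending to 0 at which some function is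
    expanded by more than k. Strong continuity makes the operators [T (r k)] pointwise bounded,
    which contradicts uniform boundedness. The semigroup law then spreads the bound from [[0, d]] to
    [[0, t]], one factor for each step of length [d]. *)
Lemma semigroup_bounded T : is_semigroup T -> forall t : R, 0 <= t ->
  exists2 M : R, 0 <= M & forall r, 0 <= r <= t -> forall f, L2 f -> N2 (T r f) <= M * N2 f.
Proof.
move=> [bT T0 Tsg Tc].
have [d d0 [M M0 TM]] : exists2 d : R, 0 < d & exists2 M : R, 0 <= M &
    forall r, 0 <= r <= d -> forall f, L2 f -> N2 (T r f) <= M * N2 f.
  apply: contrapT => nb.
  have bad (k : nat) : exists r : R, [/\ 0 <= r, r <= k.+1%:R^-1 &
      exists f, L2 f /\ k%:R * N2 f < N2 (T r f)].
    apply: contrapT => /forallNP bad; apply: nb; exists k.+1%:R^-1 => //.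
    exists k%:R => // r /andP[r0 rk] f f2; rewrite leNgt; apply/negP => lt.
    by apply: (bad r); split => //; exists f.
  pose r k := projT1 (cid (bad k)).
  have rP k : [/\ 0 <= r k, r k <= k.+1%:R^-1 & exists f, L2 f /\ k%:R * N2 f < N2 (T (r k) f)].
    by rewrite /r; case: cid.
  have [M SM] : exists M : R, forall n f, L2 f -> N2 (T (r n) f) <= M * N2 f.
    apply: uniform_boundedness => [n|f f2]; first by apply: bT; have [] := rP n.
    have [d d0 fd] := Tc f f2 1 ltr01.
    pose K := Num.bound d^-1.
    (* From index [K] on, [r n < d] and [N2 f + 1] suffices; the sum takes care of the finitely many
       earlier indices. *)
    exists (N2 f + 1 + \sum_(j < K) N2 (T (r j) f)) => n.
    have [nK|Kn] := ltnP n K.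
      rewrite (bigD1 (Ordinal nK))//= [X in _ + X]addrC addrA lerDr.
      by rewrite !addr_ge0 ?N2_ge0// sumr_ge0// => j _; exact: N2_ge0.
    rewrite -[leLHS]addr0 lerD//; last by rewrite sumr_ge0// => j _; exact: N2_ge0.
    have [r0 rn _] := rP n.
    have Tf2 : L2 (T (r n) f) by apply: op_L2 => //; exact: bT.
    have [rn0|rn0] := eqVneq (r n) 0.
      rewrite rn0 (N2_ae _ _ (T0 f f2)) ?lerDl//; last exact: L2_meas.
      by rewrite -rn0; exact: L2_meas.
    apply: le_trans (N2_leD Tf2 f2) _; rewrite lerD2l ltW// fd//.
    rewrite lt_neqAle eq_sym rn0 r0/=; apply: le_lt_trans rn _.
    rewrite invf_plt ?posrE//; apply: lt_le_trans (archi_boundP _) _.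
      by rewrite invr_ge0 ltW.
    by rewrite ler_nat; exact: leq_trans Kn _.
  have [_ _ [f [f2 lt]]] := rP (Num.bound `|M|).
  have := SM (Num.bound `|M|) f f2; rewrite leNgt => /negP; apply.
  apply: le_lt_trans lt; rewrite ler_wpM2r ?N2_ge0//.
  apply: le_trans (ler_norm _) _; apply/ltW/archi_boundP; exact: normr_ge0.
have M1 : 1 <= Num.max M 1 by rewrite le_max lexx orbT.
have step (n : nat) : forall r, 0 <= r <= n%:R * d -> forall f, L2 f ->
    N2 (T r f) <= Num.max M 1 ^+ n.+1 * N2 f.
  elim: n => [|n IH] r /andP[r0 rn] f f2.
    rewrite expr1; apply: (@le_trans _ _ (M * N2 f)).
      by apply: TM => //; rewrite r0/= (le_trans rn)// mul0r ltW.
    by rewrite ler_wpM2r ?N2_ge0// le_max lexx.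
  have [rd|dr] := lerP r d.
    apply: (@le_trans _ _ (M * N2 f)); first by apply: TM => //; rewrite r0.
    rewrite ler_wpM2r ?N2_ge0//; apply: (@le_trans _ _ (Num.max M 1)).
      by rewrite le_max lexx.
    by rewrite -[leLHS]expr1 ler_weXn2l.
  have rd0 : 0 <= r - d by rewrite subr_ge0 ltW.
  have Tf2 : L2 (T (r - d) f) by apply: op_L2 => //; exact: bT.
  have := Tsg d (r - d) f (ltW d0) rd0 f2; rewrite addrC subrK => /N2_ae ->; last 2 first.
  - by apply/L2_meas/op_L2 => //; exact: bT.
  - by apply/L2_meas/op_L2 => //; apply: bT; exact: ltW.
  apply: (@le_trans _ _ (M * N2 (T (r - d) f))); first by apply: TM => //; rewrite lexx ltW.
  rewrite exprS -mulrA ler_pM ?N2_ge0//; first by rewrite le_max lexx.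
  by apply: IH => //; rewrite rd0/= lerBlDr (le_trans rn)// -natr1 mulrDl mul1r.
move=> t t0; pose n := Num.bound (t / d).
exists (Num.max M 1 ^+ n.+1); first by rewrite exprn_ge0// (le_trans _ M1).
move=> r /andP[r0 rt]; apply: step; rewrite r0/= (le_trans rt)//.
by rewrite -ler_pdivrMr// ltW// archi_boundP// divr_ge0// ltW.
Qed.

End Semigroups.


(** * A one-sided mean value inequality *)

Section MeanValue.
Context {R : realType}.
Implicit Types q : R -> R.

(** Continuous induction: the supremum of the times up to which q r <= q 0 + (L + e) r + e is such a
    time by the left hypothesis, and the right derivative carries the bound beyond it. The additive
    [e] gives room to leave 0, where only a continuity condition is imposed: the orbits to which
    this is applied may be known to be differentiable at positive times only. *)
Lemma right_mean_value q (L t : R) : 0 <= L -> 0 <= t ->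
  (forall e, 0 < e -> exists2 d, 0 < d & forall k, 0 < k < d -> q k <= q 0 + e) ->
  (forall s, 0 < s <= t -> forall e, 0 < e -> exists2 d, 0 < d &
     forall r, s - d < r < s -> 0 <= r -> q s <= q r + e) ->
  (forall s, 0 < s < t -> forall e, 0 < e -> exists2 d, 0 < d &
     forall k, 0 < k < d -> s + k <= t -> q (s + k) <= q s + (L + e) * k) ->
  q t <= q 0 + L * t.
Proof.
move=> L0 t0 c0 lc rd; apply/ler_addgt0Pr => e' e'0.
(* Chosen so that the slope error [e * t] and the additive error [e] add up to [e']. *)
pose e := e' / (t + 1).
have t1 : 0 < t + 1 by rewrite ltr_wpDl.
have e0 : 0 < e by rewrite divr_gt0.
have Le0 : 0 <= L + e by rewrite addr_ge0// ltW.
pose A := [set s | 0 <= s <= t /\ forall r, 0 <= r <= s -> q r <= q 0 + (L + e) * r + e].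
have A0 : A 0.
  split; first by rewrite lexx.
  by move=> r /le_anti <-; rewrite mulr0 addr0 lerDl ltW.
have supA : has_sup A by split; [exists 0|exists t => s [/andP[]]].
pose sg := sup A.
have sg0 : 0 <= sg by apply: ub_le_sup => //; case: supA.
have sgt : sg <= t by apply: ge_sup => [|s [/andP[]]//]; exists 0.
have below r : 0 <= r < sg -> q r <= q 0 + (L + e) * r + e.
  move=> /andP[r0 rs]; have [s [_ sA] rs'] := sup_gt (ex_intro _ 0 A0) rs.
  by apply: sA; rewrite r0 ltW.
have Asg : A sg.
  split; first by rewrite sg0.
  move=> r /andP[r0]; rewrite le_eqVlt => /predU1P[->|rs]; last by apply: below; rewrite r0.
  move: sg0; rewrite le_eqVlt => /predU1P[<-|sgp].
    by rewrite mulr0 addr0 lerDl ltW.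
  apply/ler_addgt0Pr => e2 e20; have sgI' : 0 < sg <= t by rewrite sgp.
  have [d d0 H] := lc sg sgI' e2 e20.
  pose r' := Num.max 0 (sg - d / 2).
  have r'0 : 0 <= r' by rewrite le_max lexx.
  have r's : r' < sg by rewrite gt_max sgp/= ltrBlDr ltrDl divr_gt0.
  have r'd : sg - d < r'.
    by rewrite lt_max; apply/orP; right; rewrite ltrD2l ltrN2 gtr_pMr// invf_lt1// ltr1n.
  apply: le_trans (H r' _ r'0) _; first by rewrite r'd.
  rewrite lerD2r; apply: le_trans (below r' _) _; first by rewrite r'0.
  by rewrite lerD2r lerD2l ler_wpM2l// ltW.
have ext s : sg < s -> s <= t -> (forall r, sg < r <= s -> q r <= q 0 + (L + e) * r + e) -> False.
  move=> ss st H; have : A s.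
    split; first by rewrite st (le_trans sg0 (ltW ss)).
    move=> r /andP[r0 rs]; have [rsg|sgr] := lerP r sg; first by apply: Asg.2; rewrite r0.
    by apply: H; rewrite sgr.
  by move=> /(ub_le_sup supA.2); rewrite leNgt ss.
move: (sgt); rewrite le_eqVlt => /predU1P[sgE|slt].
  have E : e * (t + 1) = e' by rewrite divfK// gt_eqF.
  have : q t <= q 0 + (L + e) * t + e by apply: Asg.2; rewrite sgE t0 lexx.
  by move: E; lra.
exfalso; move: sg0; rewrite le_eqVlt => /predU1P[sg00|sgp].
  have [d d0 H] := c0 e e0.
  apply: (ext (Num.min (d / 2) t)).
  - by rewrite -sg00 lt_min divr_gt0//= sg00.
  - by rewrite ge_min lexx orbT.
  - move=> r; rewrite -sg00 => /andP[r0]; rewrite le_min => /andP[rd2 rt].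
    have rd' : r < d by apply: le_lt_trans rd2 _; rewrite gtr_pMr// invf_lt1// ltr1n.
    apply: le_trans (H r _) _; first by rewrite r0.
    by rewrite lerD2r lerDl mulr_ge0// ltW.
have sgI : 0 < sg < t by rewrite sgp.
have [d d0 H] := rd sg sgI e e0.
apply: (ext (Num.min (sg + d / 2) t)).
- by rewrite lt_min slt andbT ltrDl divr_gt0.
- by rewrite ge_min lexx orbT.
- move=> r /andP[sr]; rewrite le_min => /andP[rd2 rt].
  have k0 : 0 < r - sg by rewrite subr_gt0.
  have kd : r - sg < d.
    by rewrite ltrBlDl; apply: le_lt_trans rd2 _; rewrite ltrD2l gtr_pMr// invf_lt1// ltr1n.
  have := H (r - sg); rewrite k0 kd addrC subrK => /(_ isT rt).
  have := Asg.2 sg; rewrite lexx (ltW sgp) => /(_ isT).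
  rewrite mulrBr; lra.
Qed.

End MeanValue.

(** * Curves followed by a semigroup *)

Section Propagation.
Context {R : realType}.
Local Notation mu := (@lebesgue_measure R).
Local Notation fct := (R -> R[i]).
Implicit Types (f g h : fct) (S : R -> fct -> fct).

Lemma semigroup_dist S M t : is_semigroup S -> 0 <= t ->
  (forall r, 0 <= r <= t -> forall f, L2 f -> N2 (S r f) <= M * N2 f) ->
  forall r k f g, 0 <= r -> 0 <= k -> r + k <= t -> L2 f -> L2 g ->
  L2dist (S (r + k) f) (S r g) <= M * L2dist (S k f) g.
Proof.
move=> [bS S0 Ssg Sc] t0 SM r k f g r0 k0 rkt f2 g2.
have Skf : L2 (S k f) by apply: op_L2 => //; exact: bS.
rewrite (@L2dist_ae _ _ (S r (S k f)) _ (S r g)).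
- apply: op_dist => //; first exact: bS.
  by move=> h h2; apply: SM => //; rewrite r0 (le_trans _ rkt)// lerDl.
- by apply: op_L2 => //; apply: bS; exact: addr_ge0.
- by apply: op_L2 => //; exact: bS.
- by apply: op_L2 => //; exact: bS.
- by apply: op_L2 => //; exact: bS.
- exact: Ssg.
- exact: ae_eq_refl.
Qed.

(* s |-> S (t - s) (u s) has derivative zero, hence the same value at 0 and t. *)
Lemma semigroup_propagation S (t : R) (u B : R -> fct) : is_semigroup S -> 0 <= t ->
  (forall s, 0 <= s <= t -> has_generator S (u s) (B s)) ->
  (forall s, 0 <= s < t -> forall e, 0 < e -> exists2 d, 0 < d & forall k, 0 < k < d ->
     N2 (fun x => u (s + k) x - u s x - k%:C * B s x) <= e * k) ->
  (forall s, 0 < s <= t -> forall e, 0 < e -> exists2 d, 0 < d & forall r,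
     s - d < r < s -> 0 <= r -> L2dist (u s) (u r) <= e) ->
  ae_eq mu setT (S t (u 0)) (u t).
Proof.
move=> sgS t0 gen du lu; have [bS S0 Ssg Sc] := sgS.
have [M M0 SM] := semigroup_bounded sgS t0.
have u2 s : 0 <= s <= t -> L2 (u s) by move=> /gen[].
have S2 r f : 0 <= r -> L2 f -> L2 (S r f) by move=> /bS bT; exact: op_L2.
pose v s := S (t - s) (u s).
have v2 s : 0 <= s <= t -> L2 (v s).
  by move=> /[dup] st /andP[s0 sst]; apply: S2; [rewrite subr_ge0|exact: u2].
have I0 : 0 <= (0 : R) <= t by rewrite lexx.
have It : 0 <= t <= t by rewrite lexx t0.
pose q s := L2dist (v s) (v 0).
have qD s r : 0 <= s <= t -> 0 <= r <= t -> q s <= q r + L2dist (v s) (v r).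
  by move=> sI rI; rewrite addrC; apply: L2dist_triangle; exact: v2.
(* Up to sign, the increment of [v] is S (t - s - k) applied to u (s + k) - S k (u s), and both
   terms equal u s + k B s up to o(k). With two errors of [e1 * k] and a bound [M] for the outer
   operator, [e1] is [e / (2 (M + 1))]. *)
have right s : 0 <= s < t -> forall e, 0 < e -> exists2 d, 0 < d &
    forall k, 0 < k < d -> s + k <= t -> q (s + k) <= q s + (0 + e) * k.
  move=> /andP[s0 st] e e0.
  have sI : 0 <= s <= t by rewrite s0 ltW.
  pose e1 := e / (2 * (M + 1)).
  have M1 : 0 < 2 * (M + 1) by rewrite mulr_gt0// ltr_wpDl.
  have e10 : 0 < e1 by rewrite divr_gt0.
  have [us2 B2 gs] := gen s sI.
  have [d1 d10 H1] := gs e1 e10.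
  have sI' : 0 <= s < t by rewrite s0.
  have [d2 d20 H2] := du s sI' e1 e10.
  exists (Num.min d1 d2); first by rewrite lt_min d10.
  move=> k /andP[k0]; rewrite lt_min => /andP[kd1 kd2] skt.
  have skI : 0 <= s + k <= t by rewrite skt addr_ge0// ltW.
  apply: le_trans (qD _ _ skI sI) _; rewrite lerD2l add0r L2distC; [|exact: v2..].
  have tsk : t - s = (t - (s + k)) + k by rewrite opprD addrA subrK.
  rewrite /v tsk.
  have uk2 := u2 _ skI.
  have Sk2 : L2 (S k (u s)) by apply: S2 => //; exact: ltW.
  have kB2 : L2 (fun x => k%:C * B s x) by exact: L2Z.
  apply: le_trans (semigroup_dist sgS t0 SM _ _ _ us2 uk2) _.
  - by rewrite subr_ge0.
  - exact: ltW.
  - by rewrite -tsk gerDl oppr_le0.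
  have ub : u s = u s by [].
  pose m x := u s x + k%:C * B s x.
  have m2 : L2 m by exact: L2D.
  have le1 : L2dist (S k (u s)) m <= e1 * k.
    by rewrite /L2dist /m; under eq_fun do rewrite opprD addrA; apply: H1; rewrite k0.
  have le2 : L2dist m (u (s + k)) <= e1 * k.
    rewrite L2distC// /L2dist /m; under eq_fun do rewrite opprD addrA.
    by apply: H2; rewrite k0.
  apply: (@le_trans _ _ (M * (2 * (e1 * k)))).
    rewrite ler_wpM2l//; apply: le_trans (L2dist_triangle Sk2 m2 uk2) _; lra.
  have -> : M * (2 * (e1 * k)) = (e * k) * (M / (M + 1)).
    by rewrite /e1; field; rewrite gt_eqF//= ltr_wpDl.
  rewrite ler_piMr ?mulr_ge0 ?ltW// ltr_pdivrMr ?ltr_wpDl//; lra.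
(* Here v r = S (t - s) (S (s - r) (u r)): u r is close to u s by continuity of the curve, and S (s
   - r) (u s) is close to u s by strong continuity. The first error passes through two operators,
   whence [M * M]. *)
have left s : 0 < s <= t -> forall e, 0 < e -> exists2 d, 0 < d &
    forall r, s - d < r < s -> 0 <= r -> q s <= q r + e.
  move=> /andP[s0 st] e e0.
  have sI : 0 <= s <= t by rewrite st ltW.
  have M1 : 0 < 2 * (M + 1) by rewrite mulr_gt0// ltr_wpDl.
  have MM1 : 0 < 2 * (M * M + 1) by rewrite mulr_gt0// ltr_wpDl// mulr_ge0.
  have us2 := u2 _ sI.
  have [d1 d10 H1] := Sc (u s) us2 (e / (2 * (M + 1))) (divr_gt0 e0 M1).
  have sI' : 0 < s <= t by rewrite s0.
  have [d2 d20 H2] := lu s sI' (e / (2 * (M * M + 1))) (divr_gt0 e0 MM1).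
  exists (Num.min d1 d2); first by rewrite lt_min d10.
  move=> r /andP[rd rs] r0.
  have rd1 : s - r < d1.
    by move: rd; rewrite ltrBlDl -ltrBlDr lt_min => /andP[].
  have rd2 : s - d2 < r.
    by move: rd; rewrite ltrBlDl -ltrBlDr lt_min => /andP[_]; lra.
  have rI : 0 <= r <= t by rewrite r0 (le_trans (ltW rs)).
  apply: le_trans (qD _ _ sI rI) _; rewrite lerD2l L2distC; [|exact: v2..].
  have trs : t - r = (t - s) + (s - r) by rewrite addrA subrK.
  have sr0 : 0 <= s - r by rewrite subr_ge0 ltW.
  have ur2 := u2 _ rI.
  have Ss2 := S2 _ _ sr0 us2; have Sr2 := S2 _ _ sr0 ur2.
  rewrite /v trs; apply: le_trans (semigroup_dist sgS t0 SM _ _ _ ur2 us2) _ => //.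
  - by rewrite subr_ge0.
  - by rewrite -trs gerDl oppr_le0.
  have le1 : L2dist (S (s - r) (u s)) (u s) <= e / (2 * (M + 1)).
    by apply/ltW/H1; rewrite rd1 subr_gt0 rs.
  have le2 : L2dist (S (s - r) (u r)) (S (s - r) (u s)) <= M * (e / (2 * (M * M + 1))).
    apply: le_trans (op_dist (bS _ sr0) _ ur2 us2) _ => [h h2|].
      by apply: SM => //; rewrite sr0/= (le_trans _ st)// gerDl oppr_le0.
    rewrite ler_wpM2l// L2distC//; apply: H2 => //; by rewrite rd2.
  apply: (@le_trans _ _ (M * (M * (e / (2 * (M * M + 1))) + e / (2 * (M + 1))))).
    by rewrite ler_wpM2l//; apply: le_trans (L2dist_triangle Sr2 Ss2 us2) _; exact: lerD.
  have -> : M * (M * (e / (2 * (M * M + 1))) + e / (2 * (M + 1))) =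
      e / 2 * (M * M / (M * M + 1)) + e / 2 * (M / (M + 1)).
    by field; rewrite !gt_eqF//= ltr_wpDl// mulr_ge0.
  rewrite [leRHS](splitr e); apply: lerD; rewrite ler_piMr ?divr_ge0 ?(ltW e0)//.
    by rewrite ler_pdivrMr ?mul1r ?lerDl// ltr_wpDl// mulr_ge0.
  by rewrite ler_pdivrMr ?mul1r ?lerDl// ltr_wpDl.
have q00 : q 0 = 0 by exact: L2distxx.
have qt : q t <= q 0 + 0 * t.
  move: (t0); rewrite le_eqVlt => /predU1P[<-|tp]; first by rewrite mulr0 addr0.
  apply: right_mean_value => //.
  - move=> e e0; have t0' : 0 <= (0 : R) < t by rewrite lexx.
    have [d d0 H] := right 0 t0' 1 ltr01.
    exists (Num.min (Num.min d t) e).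
      by rewrite !lt_min d0 tp e0.
    move=> k /andP[k0]; rewrite !lt_min => /andP[/andP[kd kt] ke].
    have := H k; rewrite k0 kd add0r => /(_ isT (ltW kt)) /le_trans; apply.
    by rewrite add0r mul1r lerD2l ltW.
  - by move=> s /andP[s0 st] e e0; apply: right => //; rewrite ltW.
have vE : ae_eq mu setT (v t) (v 0).
  apply: L2dist_eq0; [exact: v2|exact: v2|].
  by apply/eqP; rewrite eq_le L2dist_ge0 andbT; move: qt; rewrite q00 mul0r addr0.
have := S0 (u t) (u2 _ It); move: vE; rewrite /v subrr subr0.
by apply: filterS2 => x /= + + I => /(_ I) <- /(_ I).
Qed.

(** The mean value inequality for w s = S s f - f - s g, whose right derivative S s g - g is small
    near 0. It moves differentiability from positive times to time 0, as required on a ray of the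
    cone, whose vertex lies outside the domain of holomorphy. *)
Lemma has_generator_derivative S f g : is_semigroup S -> L2 f -> L2 g ->
  (forall s, 0 < s -> forall e, 0 < e -> exists2 d, 0 < d & forall k, 0 < k < d ->
     N2 (fun x => S (s + k) f x - S s f x - k%:C * S s g x) <= e * k) ->
  has_generator S f g.
Proof.
move=> sgS f2 g2 dS; have [bS S0 Ssg Sc] := sgS; split => // e e0.
have [M M0 SM] := semigroup_bounded sgS ler01.
have S2 r h : 0 <= r -> L2 h -> L2 (S r h) by move=> /bS bT; exact: op_L2.
have [d d0 Hd] := Sc g g2 e e0.
exists (Num.min d 1); first by rewrite lt_min d0/=.
move=> h /andP[h0]; rewrite lt_min => /andP[hd h1].
pose w s x := S s f x - f x - s%:C * g x.
have w2 s : 0 <= s -> L2 (w s) by move=> s0; apply: L2B; [apply: L2B => //; exact: S2|exact: L2Z].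
pose q s := N2 (w s).
have q0 : q 0 = 0.
  apply: etrans (@N2_0 R); apply: N2_ae; [by apply/L2_meas/w2|exact: Cmeas_cst|].
  have := S0 f f2; apply: filterS => x /= H I; rewrite /w H//.
  by rewrite subrr mul0r subrr.
have qdist s r : 0 <= s -> 0 <= r -> q s <= q r + L2dist (w s) (w r).
  by move=> s0 r0; apply: N2_leD; exact: w2.
have wdist s r : 0 <= r -> r < s -> s <= 1 ->
    L2dist (w s) (w r) <= M * L2dist (S (s - r) f) f + (s - r) * N2 g.
  move=> r0 rs s1.
  have sr0 : 0 <= s - r by rewrite subr_ge0 ltW.
  have s0 : 0 <= s by rewrite (le_trans r0)// ltW.
  have Sd2 : L2 (fun x => S s f x - S r f x) by apply: L2B; exact: S2.
  rewrite /L2dist (_ : (fun x => _) =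
      fun x => (S s f x - S r f x) - (s - r)%:C * g x); last first.
    by apply/funext => x; rewrite /w rmorphB/=; ring.
  apply: le_trans (N2B Sd2 (L2Z _ g2)) _; apply: lerD.
    have := @semigroup_dist S M 1 sgS ler01 SM r (s - r) f f r0 sr0.
    by rewrite addrC subrK => /(_ s1 f2 f2).
  by rewrite N2Z// nrm_real ger0_norm.
have small e' : 0 < e' -> exists2 d', 0 < d' & forall r s,
    0 <= r -> r < s -> s <= 1 -> s - r < d' -> L2dist (w s) (w r) <= e'.
  move=> e'0; have M1 : 0 < 2 * (M + 1) by rewrite mulr_gt0// ltr_wpDl.
  have N1 : 0 < 2 * (N2 g + 1) by rewrite mulr_gt0// ltr_wpDl// N2_ge0.
  have [d1 d10 H1] := Sc f f2 (e' / (2 * (M + 1))) (divr_gt0 e'0 M1).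
  exists (Num.min d1 (e' / (2 * (N2 g + 1)))); first by rewrite lt_min d10 divr_gt0.
  move=> r s r0 rs s1; rewrite lt_min => /andP[sd1 sd2].
  apply: le_trans (wdist _ _ r0 rs s1) _; rewrite (splitr e'); apply: lerD.
    apply: (@le_trans _ _ (M * (e' / (2 * (M + 1))))).
      by rewrite ler_wpM2l//; apply/ltW/H1; rewrite sd1 subr_gt0 rs.
    have -> : M * (e' / (2 * (M + 1))) = e' / 2 * (M / (M + 1)).
      by field; rewrite gt_eqF//= ltr_wpDl.
    rewrite ler_piMr ?divr_ge0 ?(ltW e'0)//.
    by rewrite ler_pdivrMr ?mul1r ?lerDl// ltr_wpDl.
  apply: (@le_trans _ _ ((e' / (2 * (N2 g + 1))) * N2 g)).
    by rewrite ler_wpM2r ?N2_ge0// ltW.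
  have -> : (e' / (2 * (N2 g + 1))) * N2 g = e' / 2 * (N2 g / (N2 g + 1)).
    by field; rewrite gt_eqF//= ltr_wpDl// N2_ge0.
  rewrite ler_piMr ?divr_ge0 ?(ltW e'0)//.
  by rewrite ler_pdivrMr ?mul1r ?lerDl// ltr_wpDl// N2_ge0.
suff : q h <= q 0 + e * h by rewrite q0 add0r.
apply: right_mean_value; [exact: ltW|exact: ltW| | |].
- move=> e' e'0; have [d' d'0 H] := small e' e'0.
  exists (Num.min d' 1); first by rewrite lt_min d'0/=.
  move=> k /andP[k0]; rewrite lt_min => /andP[kd k1].
  apply: le_trans (qdist k 0 (ltW k0) (lexx _)) _; rewrite lerD2l.
  by apply: H => //; [exact: ltW|rewrite subr0].
- move=> s /andP[s0 sh] e' e'0; have [d' d'0 H] := small e' e'0.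
  exists d' => // r /andP[rd rs] r0.
  apply: le_trans (qdist s r (ltW s0) r0) _; rewrite lerD2l; apply: H => //; last lra.
  by rewrite (le_trans sh)// ltW.
- move=> s /andP[s0 sh] e' e'0; have [d' d'0 H] := dS s s0 e' e'0.
  exists d' => // k /andP[k0 kd] skh.
  have sk0 : 0 <= s + k by rewrite addr_ge0// ltW.
  apply: le_trans (qdist (s + k) s sk0 (ltW s0)) _; rewrite lerD2l.
  have Ssk := S2 _ _ sk0 f2; have Ss := S2 _ _ (ltW s0) f2.
  have Sg := S2 _ _ (ltW s0) g2.
  rewrite /L2dist (_ : (fun x => _) = fun x => (S (s + k) f x - S s f x - k%:C * S s g x)
      + k%:C * (S s g x - g x)); last first.
    by apply/funext => x; rewrite /w rmorphD/=; ring.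
  apply: le_trans (N2D _ _) _.
  + by apply: L2B; [exact: L2B|exact: L2Z].
  + by apply/L2Z/L2B.
  rewrite mulrDl addrC; apply: lerD; last by apply: H; rewrite k0.
  rewrite N2Z; last exact: L2B.
  rewrite nrm_real gtr0_norm// mulrC ler_wpM2r ?(ltW k0)//.
  by apply/ltW/Hd; rewrite s0 (lt_trans _ hd)//; apply: lt_le_trans skh; rewrite ltrDl.
Qed.

End Propagation.


(** * Functions with Gaussian decay *)

Section GaussianDecay.
Context {R : realType}.
Local Notation mu := (@lebesgue_measure R).
Implicit Types f g h : R -> R[i].

Lemma integrable_gauss (d : R) : 0 < d ->
  mu.-integrable setT (EFin \o (fun x : R => expR (- (d * x ^+ 2)))).
Proof.
(* With variance 1 / (2 d) the centred normal density is a multiple of this Gaussian. *)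
move=> d0; pose s := Num.sqrt (2 * d)^-1.
have s0 : s != 0 by rewrite gt_eqF// sqrtr_gt0 invr_gt0 mulr_gt0.
have s2 : s ^+ 2 = (2 * d)^-1 by rewrite sqr_sqrtr// invr_ge0 mulr_ge0// ltW.
have p0 : 0 < normal_peak s by rewrite normal_peak_gt0.
have := integrableZl measurableT (normal_peak s)^-1 (integrable_normal_pdf 0 s).
apply: eq_integrable => // x _; rewrite /= /normal_pdf (negbTE s0)/= -EFinM.
rewrite mulrA mulVf ?gt_eqF// mul1r /normal_fun subr0 s2.
by congr (expR _)%:E; rewrite -mulr_natl; field; rewrite gt_eqF.
Qed.

(** A class with unspecified constants, contained in L^1 and L^2 and stable under multiplication by
    functions of exponential growth; it covers polynomials times Gaussians and test functions
    alike. *)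
Definition gdecay f := Cmeasurable f /\
  exists M d : R, [/\ 0 <= M, 0 < d & forall x, nrm (f x) <= M * expR (- (d * x ^+ 2))].

Lemma gdecay_meas f : gdecay f -> Cmeasurable f. Proof. by case. Qed.

(** Half of the quadratic exponent pays for the linear one: the difference of the exponents is a
    perfect square times d / 2. *)
Lemma expR_abs_quad (k d x : R) : 0 < d ->
  expR (k * `|x|) * expR (- (d * x ^+ 2)) <=
  expR (k ^+ 2 / (2 * d)) * expR (- (d / 2 * x ^+ 2)).
Proof.
move=> d0; rewrite -!expRD ler_expR -(real_normK (num_real x)).
move: `|x| => y; rewrite -subr_ge0.
have -> : k ^+ 2 / (2 * d) + - (d / 2 * y ^+ 2) - (k * y + - (d * y ^+ 2)) =
    (d / 2) * (y - k / d) ^+ 2 by field; rewrite gt_eqF.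
by rewrite mulr_ge0 ?sqr_ge0// divr_ge0// ltW.
Qed.

Lemma gdecay_exp f (C k d : R) : Cmeasurable f -> 0 <= C -> 0 < d ->
  (forall x, nrm (f x) <= C * (expR (k * `|x|) * expR (- (d * x ^+ 2)))) -> gdecay f.
Proof.
move=> mf C0 d0 fC; split => //.
exists (C * expR (k ^+ 2 / (2 * d))), (d / 2); split.
- by rewrite mulr_ge0// expR_ge0.
- by rewrite divr_gt0.
- move=> x; apply: le_trans (fC x) _.
  by rewrite -mulrA ler_wpM2l// expR_abs_quad.
Qed.

Lemma gdecayM h f (C k : R) : gdecay f -> Cmeasurable h ->
  (forall x, nrm (h x) <= C * expR (k * `|x|)) -> gdecay (fun x => h x * f x).
Proof.
move=> [mf [M [d [M0 d0 fM]]]] mh hC.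
have C0 : 0 <= C.
  have := le_trans (nrm_ge0 _) (hC 0); rewrite normr0 mulr0 expR0 mulr1 //.
apply: (@gdecay_exp _ (C * M) k d) => //; first exact: CmeasM.
  exact: mulr_ge0.
by move=> x; rewrite nrmM mulrACA ler_pM ?nrm_ge0.
Qed.

Lemma gdecayD f g : gdecay f -> gdecay g -> gdecay (fun x => f x + g x).
Proof.
move=> [mf [M [d [M0 d0 fM]]]] [mg [N [e [N0 e0 gN]]]]; split; first exact: CmeasD.
exists (M + N), (Num.min d e); split; [exact: addr_ge0|by rewrite lt_min d0|].
move=> x; apply: le_trans (nrmD _ _) _; rewrite mulrDl; apply: lerD.
- apply: le_trans (fM x) _; rewrite ler_wpM2l// ler_expR lerN2.
  by rewrite ler_wpM2r ?sqr_ge0// ge_min lexx.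
- apply: le_trans (gN x) _; rewrite ler_wpM2l// ler_expR lerN2.
  by rewrite ler_wpM2r ?sqr_ge0// ge_min lexx orbT.
Qed.

Lemma gdecayZ (a : R[i]) f : gdecay f -> gdecay (fun x => a * f x).
Proof.
move=> gf; apply: (@gdecayM (fun=> a) _ (nrm a) 0) => //; first exact: Cmeas_cst.
by move=> x; rewrite mul0r expR0 mulr1.
Qed.

Lemma gdecay_L2 f : gdecay f -> L2 f.
Proof.
move=> [mf [M [d [M0 d0 fM]]]]; apply/L2P; split => //.
have d20 : 0 < 2 * d by rewrite mulr_gt0.
have /integrableP[_] := integrableZl measurableT (M ^+ 2) (integrable_gauss d20).
apply: le_lt_trans; apply: ge0_le_integral => //.
- by move=> x _; rewrite lee_fin sqr_ge0.
- exact: meas_nrm_sqr.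
- apply: measurableT_comp => //; apply: measurable_funeM.
  by have /integrableP[] := integrable_gauss d20.
- move=> x _; rewrite /= lee_fin (le_trans _ (ler_norm _))//.
  rewrite [expR _](_ : _ = expR (- (d * x ^+ 2)) ^+ 2); last first.
    by rewrite -expRM_natl; congr expR; ring.
  by rewrite -exprMn ler_pXn2r ?nnegrE ?nrm_ge0 ?mulr_ge0 ?expR_ge0.
Qed.

Lemma gdecay_bound f : gdecay f -> exists2 G : R -> R,
  mu.-integrable setT (EFin \o G) & forall x, nrm (f x) <= G x.
Proof.
move=> [mf [M [d [M0 d0 fM]]]]; exists (fun x => M * expR (- (d * x ^+ 2))) => //.
exact: (integrable_scale M (integrable_gauss d0)).
Qed.

Lemma gdecay_Cintegrable f : gdecay f -> Cintegrable f.
Proof.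
by move=> gf; have [G iG fG] := gdecay_bound gf; apply: Cintegrable_le iG fG; case: gf.
Qed.

Lemma expR_Nsqr_cvg0 (d : R) : 0 < d ->
  (fun n : nat => expR (- (d * n%:R ^+ 2))) @ \oo --> (0 : R).
Proof.
move=> d0; apply/cvgr0Pnorm_le => e e0; near=> n.
rewrite ger0_norm ?expR_ge0// -[leRHS](lnK e0) ler_expR lerNl.
apply: (@le_trans _ _ (d * n%:R)).
  by rewrite mulrC -ler_pdivrMr//; near: n; exact: nbhs_infty_ger.
rewrite ler_wpM2l ?(ltW d0)// -natrX ler_nat.
by move: (n) => [|m]//; rewrite expnS expn1 leq_pmulr.
Unshelve. all: by end_near. Qed.

(** The fundamental theorem of calculus on the intervals [-(n+1), n+1], then dominated
    convergence. *)
Lemma Rintegral_derive_eq0 (F f : R -> R) :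
  (forall x : R, is_derive x 1 F (f x)) ->
  continuous f -> mu.-integrable setT (EFin \o f) ->
  (fun n : nat => F n%:R) @ \oo --> (0 : R) ->
  (fun n : nat => F (- n%:R)) @ \oo --> (0 : R) ->
  \int[mu]_x f x = 0.
Proof.
move=> dF cf intf F1 F2.
have cF : continuous F by move=> x; exact: is_derive_continuous (dF x).
pose g (n : nat) := f \_ `[- n.+1%:R, n.+1%:R].
have gE n : \int[mu]_x g n x = F n.+1%:R - F (- n.+1%:R).
  rewrite /g -Rintegral_mkcond /Rintegral.
  rewrite (@continuous_FTC2 _ f F (- n.+1%:R) n.+1%:R) ?gtrN//.
  - by apply: continuous_subspaceT.
  - split; [by move=> x _; case: (dF x)|apply: cvg_at_right_filter; exact: cF|apply: cvg_at_left_filter; exact: cF].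
  - by move=> x _; rewrite derive1E; exact: derive_val.
have lim1 : (fun n => \int[mu]_x g n x) @ \oo --> \int[mu]_x f x.
  apply: (@Rintegral_dominated _ _ _ (fun x => `|f x|)).
  - move=> n; apply/(measurable_restrictT _ _).1 => //.
    by apply: measurable_funTS; exact: continuous_measurable_fun.
  - by have := integrable_abse intf.
  - by move=> n x; rewrite /g patchE; case: ifP => // _; rewrite normr0.
  - move=> x; apply: cvg_near_cst; near=> n; rewrite /g patchE mem_set//=.
    rewrite in_itv/= -ler_norml (@le_trans _ _ n%:R) ?ler_nat//.
    by near: n; exact: nbhs_infty_ger.
have lim2 : (fun n => \int[mu]_x g n x) @ \oo --> (0 : R).
  rewrite (_ : (fun n => _) = fun n => F n.+1%:R - F (- n.+1%:R)); last exact/funext.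
  by rewrite -(subrr 0); apply: cvgB; [rewrite -(cvg_shiftS) in F1|rewrite -(cvg_shiftS) in F2].
exact: (cvg_unique _ lim1 lim2).
Unshelve. all: by end_near. Qed.

Lemma gdecay_cvg0 f : gdecay f -> forall s : R, s ^+ 2 = 1 ->
  ccvg (fun n => f (s * n%:R)) 0.
Proof.
move=> [mf [M [d [M0 d0 fM]]]] s s1.
have H : (fun n : nat => M * expR (- (d * n%:R ^+ 2))) @ \oo --> (0 : R).
  by rewrite -(mulr0 M); apply: cvgMr; exact: expR_Nsqr_cvg0.
have le n : nrm (f (s * n%:R)) <= M * expR (- (d * n%:R ^+ 2)).
  by apply: le_trans (fM _) _; rewrite exprMn s1 mul1r.
split; apply/cvgr0Pnorm_le => e e0; near=> n.
- apply: le_trans (Re_le_nrm _) (le_trans (le n) (le_trans (ler_norm _) _)).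
  by near: n; move/cvgr0Pnorm_le : H; apply.
- apply: le_trans (Im_le_nrm _) (le_trans (le n) (le_trans (ler_norm _) _)).
  by near: n; move/cvgr0Pnorm_le : H; apply.
Unshelve. all: by end_near. Qed.

Lemma cderive_continuous f df : (forall x, cderive f x (df x)) ->
  continuous (ReC \o f) /\ continuous (ImC \o f).
Proof.
by move=> fdf; split => x; have [f1 f2] := fdf x;
  [exact: (is_derive_continuous f1)|exact: (is_derive_continuous f2)].
Qed.

(** The second derivative [ddf] supplies the continuity of [df] that the fundamental theorem of
    calculus asks for. *)
Lemma Cintegral_derive_eq0 f df ddf : gdecay f -> gdecay df ->
  (forall x, cderive f x (df x)) -> (forall x, cderive df x (ddf x)) ->
  Cintegral df = 0.
Proof.
move=> gf gdf fdf dfddf; have [c1 c2] := cderive_continuous dfddf.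
have [i1 i2] := gdecay_Cintegrable gdf.
have s1 : (1 : R) ^+ 2 = 1 by rewrite expr1n.
have s2 : (-1 : R) ^+ 2 = 1 by rewrite sqrrN expr1n.
have [p1 p2] := gdecay_cvg0 gf s1; have [n1 n2] := gdecay_cvg0 gf s2.
apply: complex_eq => /=.
- apply: (@Rintegral_derive_eq0 (ReC \o f)) => //.
  + by move=> x; case: (fdf x).
  + by move: p1; under eq_fun do rewrite mul1r.
  + by move: n1; under eq_fun do rewrite mulN1r.
- apply: (@Rintegral_derive_eq0 (ImC \o f)) => //.
  + by move=> x; case: (fdf x).
  + by move: p2; under eq_fun do rewrite mul1r.
  + by move: n2; under eq_fun do rewrite mulN1r.
Qed.

End GaussianDecay.


(** * Polynomials times complex Gaussians *)

Section GaussianFunctions.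
Context {R : realType}.
Local Notation mu := (@lebesgue_measure R).
Implicit Types (b s k : R[i]) (p : {poly R[i]}).

Definition gauss b s k (x : R) : R[i] := Cexp (k + s * x%:C - b * (x ^+ 2)%:C).

Definition polygauss p b s k (x : R) : R[i] := p.[x%:C] * gauss b s k x.

(** The polynomial factor of the derivative of p(x) exp(k + s x - b x^2). The family [polygauss] is
    thereby closed under differentiation, so all derivatives exist and decay. *)
Definition dpoly b s p : {poly R[i]} := p^`() + p * (s%:P - (2 * b) *: 'X).

Lemma cderive_sqr (x : R) : cderive (fun x : R => (x ^+ 2)%:C) x (2 * x%:C).
Proof.
have := cderiveM (cderive_id x) (cderive_id x).
rewrite (_ : (fun x : R => x%:C * x%:C) = fun x : R => (x ^+ 2)%:C); last first.
  by apply/funext => y; rewrite -rcM.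
by move=> /cderive_eq; apply; rewrite mul1r mulr1 mulr2n mulrDl mul1r.
Qed.

Lemma cderive_gauss b s k x :
  cderive (gauss b s k) x ((s - 2 * b * x%:C) * gauss b s k x).
Proof.
apply: cderive_Cexp; apply: cderive_eq.
  apply: cderiveB; last exact: cderiveZ (cderive_sqr x).
  by apply: cderiveD; [exact: cderive_cst|apply: cderiveZ; exact: cderive_id].
by rewrite add0r mulr1 mulrCA !mulrA.
Qed.

Lemma cderive_poly p x : cderive (fun x => p.[x%:C]) x p^`().[x%:C].
Proof.
elim/poly_ind: p => [|p c IH].
  rewrite deriv0 horner0 (_ : (fun _ => _) = fun=> 0); first exact: cderive_cst.
  by apply/funext => y; rewrite horner0.
rewrite (_ : (fun _ => _) = fun x : R => p.[x%:C] * x%:C + c); last first.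
  by apply/funext => y; rewrite hornerMXaddC.
apply: cderive_eq.
  by apply: cderiveD; [apply: cderiveM IH (cderive_id x)|exact: cderive_cst].
by rewrite derivD derivM derivX derivC addr0 !mulr1 addr0 hornerD hornerMX.
Qed.

Lemma cderive_polygauss p b s k x :
  cderive (polygauss p b s k) x (polygauss (dpoly b s p) b s k x).
Proof.
have := cderiveM (cderive_poly p x) (cderive_gauss b s k x).
move=> /cderive_eq; apply; rewrite /polygauss /dpoly hornerD hornerM.
by rewrite hornerD hornerN hornerZ hornerC hornerX; ring.
Qed.

Lemma polygauss1 b s k : polygauss 1 b s k = gauss b s k.
Proof. by apply/funext => x; rewrite /polygauss hornerC mul1r. Qed.

Lemma abs_le_expR (x : R) : `|x| <= expR `|x|.
Proof. by apply: le_trans (expR_ge1Dx _); rewrite lerDr. Qed.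

Lemma poly_bound p : exists C d : R, [/\ 0 <= C, 0 <= d &
  forall x : R, nrm p.[x%:C] <= C * expR (d * `|x|)].
Proof.
elim/poly_ind: p => [|p c [C [d [C0 d0 pC]]]].
  by exists 0, 0; split => // x; rewrite horner0 nrm0 mul0r.
exists (C + nrm c), (d + 1); split; [by rewrite addr_ge0// nrm_ge0|exact: addr_ge0|].
move=> x; rewrite hornerMXaddC mulrDl; apply: le_trans (nrmD _ _) _; apply: lerD.
  rewrite nrmM nrm_real mulrDl expRD mulrA mul1r.
  by rewrite ler_pM ?nrm_ge0// abs_le_expR.
rewrite ler_peMr ?nrm_ge0//; rewrite -expR0 ler_expR mulr_ge0//; exact: addr_ge0.
Qed.

Lemma Cmeas_gauss b s k : Cmeasurable (gauss b s k).
Proof. by apply: cderive_Cmeas => x; exact: cderive_gauss. Qed.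

Lemma Cmeas_poly p : Cmeasurable (fun x : R => p.[x%:C]).
Proof. by apply: cderive_Cmeas => x; exact: cderive_poly. Qed.

Lemma nrm_gauss b s k x :
  nrm (gauss b s k x) = expR (ReC k + ReC s * x - ReC b * x ^+ 2).
Proof.
rewrite /gauss nrm_Cexp; congr expR.
by rewrite ReCD ReCD ReCN [s * _]mulrC [b * _]mulrC !Re_scale; ring.
Qed.

Lemma gdecay_gauss b s k : 0 < ReC b -> gdecay (gauss b s k).
Proof.
move=> b0; apply: (@gdecay_exp _ _ (expR (ReC k)) `|ReC s| (ReC b)) => //.
- exact: Cmeas_gauss.
- move=> x; rewrite nrm_gauss -!expRD ler_expR -addrA lerD2l lerD2r.
  by rewrite -normrM ler_norm.
Qed.

Lemma gdecay_polygauss p b s k : 0 < ReC b -> gdecay (polygauss p b s k).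
Proof.
move=> b0; have [C [d [C0 d0 pC]]] := poly_bound p.
exact: gdecayM (gdecay_gauss _ _ b0) (Cmeas_poly p) pC.
Qed.

End GaussianFunctions.

(** * The complex Gaussian integral *)

Section GaussianIntegral.
Context {R : realType}.
Local Notation mu := (@lebesgue_measure R).

Variables q1 m1 : R[i].
(** The open sector |arg q1| < pi/4. It is convex and contains 1, so the segment from 1 to [q1]
    stays inside, and squares of its points have positive real part. *)
Hypothesis q1_cone : `|ImC q1| < ReC q1.

(* The affine change of variable z = q y - m is deformed into the identity;
   sin^2 keeps the deformation parameter in [0, 1]. *)
Let sg (p : R) : R := sin p ^+ 2.
Let Q (p : R) : R[i] := 1 + (sg p)%:C * (q1 - 1).
Let m (p : R) : R[i] := (sg p)%:C * m1.
Let z p y := Q p * y%:C - m p.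
Let w (p y : R) : R[i] := Q p * Cexp (- z p y ^+ 2).
Let sg' (p : R) : R := 2 * sin p * cos p.
Let Q' p : R[i] := (sg' p)%:C * (q1 - 1).
Let m' p : R[i] := (sg' p)%:C * m1.
Let zp p y := Q' p * y%:C - m' p.
Let dw p y := Q' p * Cexp (- z p y ^+ 2) - Q p * (2 * z p y * zp p y) * Cexp (- z p y ^+ 2).

Let sg01 p : 0 <= sg p <= 1.
Proof.
by rewrite /sg sqr_ge0/=; have := cos2Dsin2 p; have := sqr_ge0 (cos p); lra.
Qed.

Let dsg (p : R) : is_derive p 1 sg (sg' p).
Proof.
rewrite /sg /sg'; apply: is_derive_eq; rewrite /GRing.scale/=; ring.
Qed.

Let dQ p : cderive Q p (Q' p).
Proof.
have := cderiveD (cderive_cst 1 p) (cderiveM (cderive_real (dsg p)) (cderive_cst (q1 - 1) p)).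
by move=> /cderive_eq; apply; rewrite add0r mulr0 addr0.
Qed.

Let dm p : cderive m p (m' p).
Proof.
have := cderiveM (cderive_real (dsg p)) (cderive_cst m1 p).
by move=> /cderive_eq; apply; rewrite mulr0 addr0.
Qed.

Let dz p y : cderive (z ^~ y) p (zp p y).
Proof.
apply: cderiveB (dm p); have := cderiveM (dQ p) (cderive_cst y%:C p).
by move=> /cderive_eq; apply; rewrite mulr0 addr0.
Qed.

Let dEp p y : cderive (fun p => Cexp (- z p y ^+ 2)) p
  (- (2 * z p y * zp p y) * Cexp (- z p y ^+ 2)).
Proof.
apply: cderive_Cexp; apply: cderiveN.
have := cderiveM (dz p y) (dz p y).
rewrite (_ : (fun x => z x y * z x y) = fun x => z x y ^+ 2); last exact/funext.
by move=> /cderive_eq; apply; ring.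
Qed.

Let dwp p y : cderive (w ^~ y) p (dw p y).
Proof.
by have := cderiveM (dQ p) (dEp p y); move=> /cderive_eq; apply; rewrite /dw; ring.
Qed.

Let wgauss p y : w p y = polygauss (Q p)%:P (Q p ^+ 2) (2 * Q p * m p) (- m p ^+ 2) y.
Proof.
rewrite /w /polygauss hornerC /gauss; congr (_ * Cexp _).
by rewrite /z rmorphXn/=; ring.
Qed.

(** Its derivative in y is the derivative of [w] in p, because the differential form exp(- z^2) dz
    is closed. The integral of [dw] is therefore that of an exact derivative. *)
Let flux p y : R[i] := zp p y * Cexp (- z p y ^+ 2).

Let fluxE p : flux p = polygauss (Q' p *: 'X - (m' p)%:P) (Q p ^+ 2) (2 * Q p * m p) (- m p ^+ 2).
Proof.
apply/funext => y.
rewrite /flux /polygauss hornerD hornerN hornerZ hornerX hornerC /gauss; congr (_ * Cexp _).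
by rewrite /z rmorphXn/=; ring.
Qed.

Let dwE p : dw p = polygauss (dpoly (Q p ^+ 2) (2 * Q p * m p) (Q' p *: 'X - (m' p)%:P))
  (Q p ^+ 2) (2 * Q p * m p) (- m p ^+ 2).
Proof.
apply/funext => y; rewrite /polygauss /dpoly.
rewrite derivB derivZ derivX derivC subr0.
rewrite !(hornerD, hornerN, hornerM, hornerZ, hornerX, hornerC) /dw /gauss.
rewrite (_ : - m p ^+ 2 + 2 * Q p * m p * y%:C - Q p ^+ 2 * (y ^+ 2)%:C = - z p y ^+ 2); last first.
  by rewrite /z rmorphXn/=; ring.
by rewrite /zp /z; ring.
Qed.

Let kap := Num.min 1 (ReC q1 - `|ImC q1|).

Let kap0 : 0 < kap.
Proof. by rewrite lt_min ltr01 subr_gt0. Qed.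

(** Re (Q^2) = (Re Q + Im Q)(Re Q - Im Q), and each factor interpolates linearly between 1 and Re q1
    + Im q1 or Re q1 - Im q1, all at least [kap]. *)
Let Qre p : kap ^+ 2 <= ReC (Q p ^+ 2).
Proof.
have /andP[s0 s1] := sg01 p.
have ReQ : ReC (Q p) = 1 + sg p * (ReC q1 - 1) by rewrite /Q ReCD Re_scale ReCD ReCN.
have ImQ : ImC (Q p) = sg p * ImC q1 by rewrite /Q ImCD Im_scale ImCD ImCN/= oppr0 add0r addr0.
have k1 : kap <= 1 by rewrite ge_min lexx.
have k2 : kap <= ReC q1 - `|ImC q1| by rewrite ge_min lexx orbT.
have h (t : R) : `|t| = `|ImC q1| -> kap <= 1 + sg p * (ReC q1 - 1) + sg p * t.
  move=> tE; have t1 : - `|ImC q1| <= t by rewrite -tE lerNl -normrN ler_norm.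
  have : 0 <= (1 - sg p) * (1 - kap) by rewrite mulr_ge0// subr_ge0.
  have : 0 <= sg p * (ReC q1 + t - kap) by rewrite mulr_ge0//; lra.
  lra.
have h1 := h (ImC q1) erefl; have h2 := h (- ImC q1) (normrN _).
have -> : ReC (Q p ^+ 2) = (ReC (Q p) + ImC (Q p)) * (ReC (Q p) - ImC (Q p)).
  by rewrite expr2 ReCM; ring.
rewrite ReQ ImQ expr2; apply: ler_pM; rewrite ?(ltW kap0)//.
by move: h2; rewrite mulrN.
Qed.

Let Qgt0 p : 0 < ReC (Q p ^+ 2).
Proof. by apply: lt_le_trans (Qre p); rewrite exprn_gt0. Qed.

Let int_dw p : Cintegral (dw p) = 0.
Proof.
apply: (@Cintegral_derive_eq0 _ (flux p)).
- by rewrite fluxE; exact: gdecay_polygauss.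
- by rewrite dwE; exact: gdecay_polygauss.
- by move=> y; rewrite fluxE dwE; exact: cderive_polygauss.
- by move=> y; rewrite dwE; exact: cderive_polygauss.
Qed.

(** One constant for [Q], [m] and their derivatives, at least 1 so that higher powers absorb lower
    ones. *)
Let A := 4 + 2 * nrm q1 + 2 * nrm m1.
Let A1 : 1 <= A.
Proof. by rewrite /A; have := nrm_ge0 q1; have := nrm_ge0 m1; lra. Qed.

Let nrm1 : nrm (1 : R[i]) = 1. Proof. exact: Normc.normc1. Qed.

Let boundQ p : [/\ nrm (Q p) <= A, nrm (Q' p) <= A, nrm (m p) <= A & nrm (m' p) <= A].
Proof.
have /andP[s0 s1] := sg01 p; have n1 := nrm_ge0 q1; have n2 := nrm_ge0 m1.
have s'2 : `|sg' p| <= 2.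
  rewrite /sg' !normrM (ger0_norm (ler0n _ _)) -mulrA ler_piMr//.
  by rewrite mulr_ile1// ler_norml ?sin_le1 ?sin_geN1 ?cos_le1 ?cos_geN1.
have q1m : nrm (q1 - 1) <= nrm q1 + 1 by rewrite -nrm1; exact: nrmB.
have sl (t : R) : 0 <= t -> sg p * t <= t by move=> t0; rewrite ler_piMl.
have sl' (t u : R) : 0 <= u -> u <= t -> `|sg' p| * u <= 2 * t by move=> t0 ut; rewrite ler_pM.
have qm0 := nrm_ge0 (q1 - 1).
split.
- apply: le_trans (nrmD _ _) _; rewrite nrm1 nrmM nrm_real ger0_norm//.
  have := sl _ qm0; rewrite /A; lra.
- by rewrite nrmM nrm_real; have := sl' _ _ qm0 q1m; rewrite /A; lra.
- by rewrite nrmM nrm_real ger0_norm//; have := sl _ n2; rewrite /A; lra.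
- by rewrite nrmM nrm_real; have := sl' _ _ n2 (lexx _); rewrite /A; lra.
Qed.

Let bound_E p y : nrm (Cexp (- z p y ^+ 2)) <=
  expR (A ^+ 2) * (expR (2 * A ^+ 2 * `|y|) * expR (- (kap ^+ 2 * y ^+ 2))).
Proof.
have [Q1 _ M1 _] := boundQ p.
rewrite nrm_Cexp -!expRD ler_expR.
have -> : - z p y ^+ 2 = - (Q p ^+ 2 * (y ^+ 2)%:C) + (2 * Q p * m p * y%:C - m p ^+ 2).
  by rewrite /z rmorphXn/=; ring.
rewrite ReCD ReCN [Q p ^+ 2 * _]mulrC Re_scale.
have l1 : kap ^+ 2 * y ^+ 2 <= y ^+ 2 * ReC (Q p ^+ 2) by rewrite mulrC ler_wpM2l ?sqr_ge0.
have l2 : ReC (2 * Q p * m p * y%:C - m p ^+ 2) <= 2 * A ^+ 2 * `|y| + A ^+ 2.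
  apply: le_trans (ler_norm _) (le_trans (Re_le_nrm _) (le_trans (nrmB _ _) _)).
  rewrite [nrm (_ * y%:C)]nrmM [nrm (2 * _ * m p)]nrmM [nrm (2 * _)]nrmM nrm_real nrmX.
  rewrite (_ : nrm 2 = 2); last first.
    by rewrite (_ : 2 = (2 : R)%:C) ?nrm_real ?ger0_norm// rmorph_nat.
  apply: lerD; last by rewrite ler_pXn2r ?nnegrE ?nrm_ge0// (le_trans _ A1).
  rewrite ler_wpM2r// -mulrA ler_wpM2l// expr2 ler_pM ?nrm_ge0//.
lra.
Qed.

Let bound_dw p y : nrm (dw p y) <=
  3 * A ^+ 3 * expR (A ^+ 2) * (expR ((2 + 2 * A ^+ 2) * `|y|) * expR (- (kap ^+ 2 * y ^+ 2))).
Proof.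
have [Q1 Q2 M1 M2] := boundQ p.
have A0 : 0 <= A by apply: le_trans A1.
have y1 : 1 <= expR `|y| by rewrite -expR0 ler_expR.
have lin (u v : R[i]) : nrm u <= A -> nrm v <= A -> nrm (u * y%:C - v) <= A * expR `|y|.
  move=> uA vA; apply: le_trans (nrmB _ _) _; rewrite nrmM nrm_real.
  apply: (@le_trans _ _ (A * (1 + `|y|))); last by rewrite ler_wpM2l// expR_ge1Dx.
  by rewrite mulrDr mulr1 addrC; apply: lerD => //; rewrite ler_wpM2r.
have -> : dw p y = (Q' p - Q p * (2 * z p y * zp p y)) * Cexp (- z p y ^+ 2) by rewrite /dw; ring.
rewrite nrmM.
have b1 : nrm (Q' p - Q p * (2 * z p y * zp p y)) <= 3 * A ^+ 3 * expR (2 * `|y|).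
  have e2 : expR (2 * `|y|) = expR `|y| * expR `|y| by rewrite -expRD; congr expR; ring.
  apply: le_trans (nrmB _ _) _.
  rewrite [nrm (Q p * _)]nrmM [nrm (2 * _ * _)]nrmM [nrm (2 * _)]nrmM.
  rewrite (_ : nrm 2 = 2); last first.
    by rewrite (_ : 2 = (2 : R)%:C) ?nrm_real ?ger0_norm// rmorph_nat.
  have l1 : nrm (Q' p) <= A ^+ 3 * expR (2 * `|y|).
    apply: le_trans Q2 _; rewrite -[leLHS]mulr1 ler_pM//.
      by rewrite -[leLHS]expr1 ler_weXn2l.
    by rewrite e2 -[leLHS]mulr1 ler_pM.
  have l2 : nrm (Q p) * (2 * nrm (z p y) * nrm (zp p y)) <=
      A * (2 * (A * expR `|y|) * (A * expR `|y|)).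
    rewrite ler_pM ?nrm_ge0// ?mulr_ge0 ?nrm_ge0// ler_pM ?mulr_ge0 ?nrm_ge0//; last exact: lin.
    by rewrite ler_wpM2l//; exact: lin.
  have -> : 3 * A ^+ 3 * expR (2 * `|y|) =
    A ^+ 3 * expR (2 * `|y|) + A * (2 * (A * expR `|y|) * (A * expR `|y|)).
    by rewrite e2; ring.
  exact: lerD.
apply: le_trans (ler_pM (nrm_ge0 _) (nrm_ge0 _) b1 (bound_E p y)) _.
by rewrite [(2 + _) * `|y|]mulrDl expRD; rewrite le_eqVlt; apply/orP; left; apply/eqP; ring.
Qed.

(** Differentiation under the integral sign, with a majorant [G] that does not depend on p; the
    derivative is the integral of [dw], which vanishes. Since p ranges over the whole line, a zero
    derivative gives constancy at once. *)
Let int_w p : Cintegral (w p) = Cintegral (w 0).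
Proof.
have intw p' : Cintegrable (w p').
  rewrite (_ : w p' = polygauss (Q p')%:P (Q p' ^+ 2) (2 * Q p' * m p') (- m p' ^+ 2)).
    by apply: gdecay_Cintegrable; exact: gdecay_polygauss.
  by apply/funext => y; exact: wgauss.
pose G y := 3 * A ^+ 3 * expR (A ^+ 2) *
   (expR ((2 + 2 * A ^+ 2) ^+ 2 / (2 * kap ^+ 2)) * expR (- (kap ^+ 2 / 2 * y ^+ 2))).
have A0 : 0 <= A by apply: le_trans A1.
have k20 : 0 < kap ^+ 2 by rewrite exprn_gt0.
have G0 y : 0 <= G y by rewrite !mulr_ge0 ?expR_ge0// exprn_ge0.
have iG : mu.-integrable setT (EFin \o G).
  apply: integrable_scale; apply: integrable_scale; apply: integrable_gauss.
  by rewrite divr_gt0.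
have dwG p' y : nrm (dw p' y) <= G y.
  apply: le_trans (bound_dw p' y) _; rewrite ler_wpM2l//.
    by rewrite !mulr_ge0 ?expR_ge0// exprn_ge0.
  exact: expR_abs_quad.
have key (h : R[i] -> R) (hi : forall p', mu.-integrable setT (EFin \o (fun y => h (w p' y)))) 
   (hn : forall u, `|h u| <= nrm u)
   (hd : forall p' y : R, is_derive p' 1 (fun p => h (w p y)) (h (dw p' y))) 
   (h0 : forall p', \int[mu]_y h (dw p' y) = 0) :
   \int[mu]_y h (w p y) = \int[mu]_y h (w 0 y).
  pose F p' := \int[mu]_y h (w p' y).
  suff dF (x : R) : is_derive x 1 F 0 by exact: (@is_derive_0_is_cst _ F p 0 dF).
  have Ix : `]x - 1, x + 1[%classic x by rewrite /= in_itv/=; apply/andP; split; lra.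
  have d1E p' y : partial1of2 (fun p y => h (w p y)) p' y = h (dw p' y).
    by rewrite partial1of2E; have [_ ->] := hd p' y.
  have G_ub x' y : `]x - 1, x + 1[%classic x' -> setT y ->
      `|partial1of2 (fun p y => h (w p y)) x' y| <= G y.
    by move=> _ _; rewrite d1E (le_trans (hn _)).
  have dd x' y : `]x - 1, x + 1[%classic x' -> setT y ->
      derivable (fun p => h (w p y)) x' 1 by move=> _ _; case: (hd x' y).
  have D1 := @derivable_under_integral R _ _ mu (fun p y => h (w p y)) setT measurableT
    x (x - 1) (x + 1) Ix (fun x' _ => hi x') dd G G0 iG G_ub.
  have D2 := @differentiation_under_integral R _ _ mu (fun p y => h (w p y)) setT measurableT
    x (x - 1) (x + 1) Ix (fun x' _ => hi x') dd G G0 iG G_ub.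
  split => //; rewrite -derive1E D2 -(h0 x); apply: eq_Rintegral => y _; exact: d1E.
apply: complex_eq => /=.
- apply: (key ReC).
  + by move=> p'; case: (intw p').
  + exact: Re_le_nrm.
  + by move=> p' y; case: (dwp p' y).
  + by move=> p'; have := congr1 ReC (int_dw p').
- apply: (key ImC).
  + by move=> p'; case: (intw p').
  + exact: Im_le_nrm.
  + by move=> p' y; case: (dwp p' y).
  + by move=> p'; have := congr1 ImC (int_dw p').
Qed.

(** The integral is the same at both ends of the deformation: p = pi/2 gives the integrand of the
    statement, p = 0 the real Gaussian. *)
Lemma integral_gauss_affine :
  Cintegral (fun y => q1 * Cexp (- (q1 * y%:C - m1) ^+ 2)) = (Num.sqrt pi)%:C.
Proof.
have -> : (fun y => q1 * Cexp (- (q1 * y%:C - m1) ^+ 2)) = w (pi / 2).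
  apply/funext => y; rewrite /w /z /Q /m /sg sin_pihalf expr1n rmorph1 !mul1r.
  by rewrite [1 + _]addrC subrK.
rewrite int_w.
have -> : w 0 = fun y => (gauss_fun y)%:C.
  apply/funext => y; rewrite /w /z /Q /m /sg sin0 expr0n/= mul0r addr0 mul0r subr0 !mul1r.
  by rewrite -rmorphXn -rmorphN/= Cexp_real.
apply: complex_eq => /=.
  by rewrite /Rintegral integralT_gauss.
by rewrite /Rintegral integral0.
Qed.

End GaussianIntegral.


(** * Smooth cutoff functions *)

Section Smooth.
Context {R : realType}.
Implicit Types (f g : R -> R) (x : R).

Definition smooth f := forall n x, derivable (derive1n n f) x 1.

(** An invariant for induction on the order of the derivative: a class closed under differentiation
    replaces closed formulas for n-th derivatives. *)
Lemma smooth_class (C : (R -> R) -> Prop) :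
  (forall f, C f -> exists2 g, C g & forall x, is_derive x 1 f (g x)) ->
  forall f, C f -> smooth f.
Proof.
move=> Cd f Cf n; have : C (derive1n n f).
  elim: n => [|n IH]; first by rewrite derive1n0.
  rewrite derive1nS; have [g Cg dg] := Cd _ IH.
  by rewrite (_ : derive1 _ = g)//; apply/funext => x; rewrite derive1E; exact: derive_val.
by move=> /Cd[g _ dg] x; have [] := dg x.
Qed.

Lemma smooth_derive f n : smooth f ->
  forall x, is_derive x 1 (derive1n n f) (derive1n n.+1 f x).
Proof. by move=> sf x; rewrite derive1nS derive1E; exact/derivableP. Qed.

(** Finite sums of products of a derivative of [f] and a derivative of [g] are closed under
    differentiation by the Leibniz rule; a list of pairs of orders avoids binomial coefficients. *)
Lemma smoothM f g : smooth f -> smooth g -> smooth (fun x => f x * g x).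
Proof.
move=> sf sg.
pose C h := exists s : seq (nat * nat),
  h = fun x => \sum_(i <- s) derive1n i.1 f x * derive1n i.2 g x.
apply: (@smooth_class C); last first.
  by exists [:: (0, 0)%N]; apply/funext => x; rewrite big_seq1.
move=> h [s ->].
exists (fun x => \sum_(i <- flatten [seq [:: (i.1.+1, i.2); (i.1, i.2.+1)] | i <- s])
   derive1n i.1 f x * derive1n i.2 g x); first by eexists.
move=> x; elim: s => [|i s IH].
  rewrite /= big_nil (_ : (fun _ => _) = cst 0); first exact: is_derive_cst.
  by apply/funext => y; rewrite big_nil.
rewrite /= !big_cons addrA.
rewrite (_ : (fun _ => _) = (derive1n i.1 f * derive1n i.2 g) +
    (fun x0 => \sum_(i <- s) derive1n i.1 f x0 * derive1n i.2 g x0)); last first.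
  by apply/funext => y; rewrite big_cons.
apply: is_deriveD.
have df := smooth_derive i.1 sf x; have dg := smooth_derive i.2 sg x.
by apply: is_derive_eq; rewrite /GRing.scale/=; ring.
Qed.

Lemma smooth_polygauss (p : {poly R[i]}) (b s k : R[i]) :
  smooth (ReC \o polygauss p b s k) /\ smooth (ImC \o polygauss p b s k).
Proof.
split.
- apply: (@smooth_class (fun h => exists p, h = ReC \o polygauss p b s k)); last by exists p.
  move=> _ [{}p ->]; exists (ReC \o polygauss (dpoly b s p) b s k); first by eexists.
  by move=> x; case: (cderive_polygauss p b s k x).
- apply: (@smooth_class (fun h => exists p, h = ImC \o polygauss p b s k)); last by exists p.
  move=> _ [{}p ->]; exists (ImC \o polygauss (dpoly b s p) b s k); first by eexists.
  by move=> x; case: (cderive_polygauss p b s k x).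
Qed.

(** For j = 0 this is the classical smooth function exp(-1/x) extended by 0. The powers of 1/x are
    included because they arise on differentiating: flat_j' = flat_(j+2) - j flat_(j+1). *)
Definition flat j x : R := if 0 < x then (x^-1) ^+ j * expR (- x^-1) else 0.

Lemma flat_ge0 j x : 0 <= flat j x.
Proof. by rewrite /flat; case: ifP => // x0; rewrite mulr_ge0 ?expR_ge0// exprn_ge0// invr_ge0 ltW. Qed.

Lemma pow_expR_le j (t : R) : 0 < t -> t ^+ j * expR (- t) <= j`!%:R.
Proof.
move=> t0; rewrite expRN ler_pdivrMr ?expR_gt0//.
case: j => [|j]; first by rewrite expr0 mul1r -expR0 ler_expR ltW.
have := expR_ge1Dxn j (ltW t0) => /le_trans; move=> H.
rewrite mulrC -ler_pdivrMr ?ltr0n ?fact_gt0//.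
by apply: le_trans (H _ (lexx _)); rewrite lerDr.
Qed.

Lemma flat_le j x : flat j x <= j`!%:R.
Proof. by rewrite /flat; case: ifP => // x0; apply: pow_expR_le; rewrite invr_gt0. Qed.

(** For x > 0 one has flat_j(x) = x^2 flat_(j+2)(x) with a bounded second factor. The quadratic
    bound gives derivative 0 at the origin. *)
Lemma flat_le_sqr j x : flat j x <= j.+2`!%:R * x ^+ 2.
Proof.
have [x0|x0] := ltP 0 x; last first.
  by rewrite /flat ltNge x0/= mulr_ge0// sqr_ge0.
have := flat_le j.+2 x; rewrite /flat x0 => H.
have x2 : 0 < x ^+ 2 by rewrite exprn_gt0.
rewrite -ler_pdivrMr//; apply: le_trans H; rewrite le_eqVlt; apply/orP; left; apply/eqP.
by rewrite !exprS; field; rewrite gt_eqF.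
Qed.

Lemma is_derive_flat j x : is_derive x 1 (flat j) (flat j.+2 x - j%:R * flat j.+1 x).
Proof.
have [x0|x0|x0] := ltgtP x 0.
- apply: (@near_eq_is_derive _ _ _ (cst 0)).
    near=> y; rewrite /flat ltNge ltW//=.
    by near: y; exact: lt_nbhsl.
  by rewrite /flat !ltNge (ltW x0)/= mulr0 subrr; exact: is_derive_cst.
- apply: (@near_eq_is_derive R R R (fun y : R => (y^-1) ^+ j * expR (- y^-1) : R)).
    near=> y; rewrite /flat ifT//.
    by near: y; exact: lt_nbhsr.
  have dV : is_derive x 1 (fun y : R => y^-1) (- x ^- 2).
    have := @is_deriveV _ id x 1 1 (lt0r_neq0 x0) (is_derive_id x 1).
    by rewrite /GRing.scale/= mulr1.
  rewrite /flat x0.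
  case: j => [|j].
    rewrite (_ : (fun y => _) = fun y => expR (- y^-1)); last first.
      by apply/funext => y; rewrite expr0 mul1r.
    apply: is_derive_eq; rewrite /GRing.scale/= mul0r subr0 exprVn; ring.
  rewrite (_ : (fun y => _) = (fun y : R => y^-1) ^+ j.+1 * (fun y => expR (- y^-1))); last first.
    by apply/funext => y; rewrite fctE; congr (_ * _); rewrite exprfctE.
  apply: is_derive_eq; rewrite /GRing.scale/= ?exprfctE /= !exprS -mulr_natl; field.
  by rewrite gt_eqF.
- rewrite x0; suff d0 : (fun h => h^-1 *: (flat j (h *: 1 + 0) - flat j 0)) @ (0 : R)^' --> (0 : R).
    have -> : flat j.+2 0 - j%:R * flat j.+1 0 = 0 by rewrite /flat ltxx mulr0 subrr.
    by split; [apply/cvg_ex; exists 0|exact/cvg_lim].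
  have f00 : flat j 0 = 0 by rewrite /flat ltxx.
  apply/cvgr0Pnorm_le => e e0; near=> h.
  have h0 : h != 0 by near: h; exact: nbhs_dnbhs_neq.
  rewrite f00 subr0 addr0 /GRing.scale/= mulr1 normrM normfV ger0_norm ?flat_ge0//.
  rewrite ler_pdivrMl ?normr_gt0//; apply: le_trans (flat_le_sqr j h) _.
  rewrite -(real_normK (num_real h)) expr2 mulrCA ler_wpM2l//.
  rewrite mulrC -ler_pdivlMr ?ltr0n ?fact_gt0//.
  near: h; apply: dnbhs0_le; rewrite divr_gt0// ltr0n fact_gt0//.
Unshelve. all: by end_near. Qed.

Lemma smooth_flat j (a b : R) : smooth (fun x => flat j (a * x + b)).
Proof.
pose C h := exists s : seq (R * nat), h = fun x => \sum_(i <- s) i.1 * flat i.2 (a * x + b).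
apply: (@smooth_class C); last first.
  by exists [:: (1, j)]; apply/funext => x; rewrite big_seq1/= mul1r.
move=> h [s ->].
exists (fun x => \sum_(i <- flatten [seq [:: (a * i.1, i.2.+2); (- a * i.2%:R * i.1, i.2.+1)] | i <- s])
   i.1 * flat i.2 (a * x + b)); first by eexists.
move=> x; elim: s => [|i s IH].
  rewrite /= big_nil (_ : (fun _ => _) = cst 0); first exact: is_derive_cst.
  by apply/funext => y; rewrite big_nil.
rewrite /= !big_cons addrA.
rewrite (_ : (fun _ => _) = (cst i.1 * (flat i.2 \o (fun x => a * x + b))) +
    (fun x0 => \sum_(i <- s) i.1 * flat i.2 (a * x0 + b))); last first.
  by apply/funext => y; rewrite big_cons.
apply: is_deriveD.
have da : is_derive x 1 (fun x => a * x + b) a.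
  by apply: is_derive_eq; rewrite /GRing.scale/=; ring.
have df := is_derive_flat i.2 (a * x + b).
have dc := @is_derive1_comp _ (flat i.2) (fun x => a * x + b) x _ _ df da.
by apply: is_derive_eq; rewrite /GRing.scale/=; ring.
Qed.

(** Two regimes of [al] are used: on a fixed interval, [al] tending to infinity gives the indicator
    function; with [al] = 1/n on ]-n, n[ one obtains the dilates of a single bump. *)
Definition cutoff (al a b x : R) : R := flat 0 (al * (x - a)) * flat 0 (al * (b - x)).

Lemma smooth_cutoff al a b : smooth (cutoff al a b).
Proof.
rewrite (_ : cutoff al a b = fun x => flat 0 (al * x + - al * a) * flat 0 (- al * x + al * b)).
  by apply: smoothM; exact: smooth_flat.
by apply/funext => x; congr (flat 0 _ * flat 0 _); ring.
Qed.

Lemma cutoff_ge0 al a b x : 0 <= cutoff al a b x.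
Proof. by rewrite mulr_ge0// flat_ge0. Qed.

Lemma cutoff_le1 al a b x : cutoff al a b x <= 1.
Proof. by rewrite mulr_ile1// ?flat_ge0//; exact: (flat_le 0). Qed.

Lemma cutoff_out al a b x : 0 < al -> ~~ (a < x < b) -> cutoff al a b x = 0.
Proof.
move=> al0; rewrite negb_and -!leNgt /cutoff /flat => /orP[xa|bx].
- by rewrite pmulr_rgt0// subr_gt0 ltNge xa mul0r.
- by rewrite [in X in _ * X]pmulr_rgt0// subr_gt0 [b > x]ltNge bx mulr0.
Qed.

Lemma cutoff_in al a b x : 0 < al -> a < x < b ->
  cutoff al a b x = expR (- (al^-1 * ((x - a)^-1 + (b - x)^-1))).
Proof.
move=> al0 /andP[ax xb]; rewrite /cutoff /flat !pmulr_rgt0// !subr_gt0 ax xb.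
by rewrite !expr0 !mul1r -expRD; congr expR; rewrite !invfM; ring.
Qed.

Lemma test_cutoff al a b : 0 < al -> test_function (cutoff al a b).
Proof.
move=> al0; split; first exact: smooth_cutoff.
exists (`|a| + `|b|) => x xM; apply: cutoff_out => //; apply/negP => /andP[ax xb].
move: xM; apply/negP; rewrite -leNgt ler_norml; apply/andP; split.
- rewrite lerNl; have := ler_norm (- a); rewrite normrN; have := normr_ge0 b; lra.
- have := ler_norm b; have := normr_ge0 a; lra.
Qed.

Lemma cutoff_cvg a b x : (fun n : nat => cutoff n.+1%:R a b x) @ \oo --> (\1_`]a, b[%classic x : R).
Proof.
have [xab|xab] := boolP (a < x < b); last first.
  rewrite indicE memNset /= ?in_itv/=; last exact/negP.
  apply: cvg_near_cst; apply: nearW => n; exact: cutoff_out.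
rewrite indicE; under eq_fun do rewrite cutoff_in//.
have -> : (x \in `]a, b[%classic)%:R = expR (- 0) :> R.
  by rewrite mem_set /= ?in_itv// oppr0 expR0.
apply: (@continuous_cvg _ _ _ _ _ _ (@expR R)); first exact: continuous_expR.
apply: cvgN; rewrite -(mul0r ((x - a)^-1 + (b - x)^-1)).
by apply: cvgMl; exact: cvg_harmonic.
Qed.

End Smooth.


(** * Weak derivatives *)

Section WeakDerivatives.
Context {R : realType}.
Local Notation mu := (@lebesgue_measure R).
Implicit Types (f g v w : R -> R[i]) (phi : R -> R).

Lemma Lp2_integrable_itv (g : R -> R) (a b : R) :
  measurable_fun setT g -> mu.-integrable setT (EFin \o (fun x => g x ^+ 2)) ->
  mu.-integrable setT (EFin \o (fun x => g x * \1_`[a, b]%classic x)).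
Proof.
move=> mg ig.
have i1 : mu.-integrable setT (EFin \o (\1_`[a, b]%classic : R -> R)).
  apply/integrableP; split; first by apply/measurable_EFinP; exact: measurable_indic.
  rewrite (_ : (\int[mu]_x _ = mu (`[a, b]%classic `&` setT))%E).
    by rewrite setIT lebesgue_measure_itv/=; case: ifP => _; rewrite ?ltry// -EFinB ltry.
  rewrite -integral_indic//; apply: eq_integral => x _.
  by rewrite /= ger0_norm// indicE.
apply: (@le_integrable _ _ _ mu setT measurableT _
    (fun x => (g x ^+ 2)%:E + (\1_`[a, b]%classic x)%:E)%E).
- apply/measurable_EFinP; apply: measurable_funM => //; exact: measurable_indic.
- move=> x _; rewrite /= lee_fin [leRHS]ger0_norm; last by rewrite addr_ge0// sqr_ge0.
  rewrite indicE; case: (_ \in _) => /=; rewrite ?mulr1 ?mulr0 ?normr0 ?addr0 ?sqr_ge0//.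
  rewrite -(real_normK (num_real (g x))).
  by have := sqr_ge0 (`|g x| - 1); have := sqr_ge0 (`|g x|); rewrite !expr2; lra.
- exact: integrableD.
Qed.

(** The primitive started at -n vanishes to the right of -n, while by Lebesgue differentiation its
    derivative is [g] almost everywhere; the integers n exhaust the line. *)
Lemma integral_itv_eq0 (g : R -> R) :
  measurable_fun setT g -> mu.-integrable setT (EFin \o (fun x => g x ^+ 2)) ->
  (forall a b : R, a < b -> \int[mu]_x (g x * \1_`]a, b[%classic x) = 0) ->
  ae_eq mu setT g (fun=> 0).
Proof.
move=> mg ig g0.
have iab a b : mu.-integrable `[a, b]%classic (EFin \o g).
  have := Lp2_integrable_itv a b mg ig.
  rewrite (_ : EFin \o _ = (EFin \o g) \_ `[a, b]%classic); last first.
    by apply/funext => x; rewrite /= patchE indicE; case: ifP => _; rewrite ?mulr1 ?mulr0.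
  have [_ +] := @integrable_mkcond _ _ _ mu _ (EFin \o g) (measurable_itv `[a, b]%R).
  exact.
have lg : locally_integrable setT g.
  split => //; first exact: openT.
  move=> K _ cK; have [M [_ KM]] := compact_bounded cK.
  have MK : K `<=` `[- (`|M| + 1), `|M| + 1]%classic.
    move=> x Kx; rewrite /= in_itv/= -ler_norml; apply: (KM (`|M| + 1)) => //.
    by rewrite (le_lt_trans (ler_norm M))// ltrDl.
  have iK : mu.-integrable K (EFin \o g).
    exact: (@integrableS _ _ _ mu _ _ _ (measurable_itv `[- (`|M| + 1), `|M| + 1]%R)
      (compact_measurable cK) MK (iab _ _)).
  by have /integrableP[_] := iK.
have Fn (n : nat) : {ae mu, forall x, - n%:R < x -> g x = 0}.
  have := @FTC1 _ g (BLeft (- n%:R)) (fun y => iab _ _) lg.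
  apply: filterS => x H nx; have [|_ <-] := H; first by rewrite /Order.lt.
  rewrite derive1E (near_eq_derive (g := cst 0)) ?derive_cst//.
  near=> y; rewrite /= -(g0 (- n%:R) y); last by near: y; exact: lt_nbhsr.
  rewrite -Rintegral_itv_obnd_cbnd; last first.
    by apply: integrableS (iab _ _) => //; exact: subset_itv_oc_cc.
  rewrite -Rintegral_itv_bndo_bndc; last first.
    by apply: integrableS (iab _ _) => //; exact: subset_itv_oo_cc.
  rewrite Rintegral_mkcond; apply: eq_Rintegral => z _.
  by rewrite patchE indicE; case: ifP => _; rewrite ?mulr1 ?mulr0.
have /ae_foralln : forall n : nat, {ae mu, forall x, - n%:R < x -> g x = 0} by [].
apply: filterS => x H _; apply: (H (Num.bound `|x|)).
rewrite ltrNl; apply: le_lt_trans (archi_boundP (normr_ge0 x)).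
by rewrite -normrN ler_norm.
Unshelve. all: by end_near. Qed.

(** Steep cutoffs are test functions that tend boundedly to the indicator of an open interval, so
    the integrals of [f] over bounded open intervals vanish. Domination on a bounded interval holds
    because |f| <= |f|^2 + 1. *)
Lemma test_eq0 f : L2 f ->
  (forall phi, test_function phi -> Cintegral (fun x => f x * (phi x)%:C) = 0) ->
  ae_eq mu setT f (fun=> 0).
Proof.
move=> f2 f0; have [m1 m2] := L2_meas f2.
have mn := Cmeas_nrm (L2_meas f2).
have main a b : a < b -> Cintegral (fun x => f x * (\1_`]a, b[%classic x)%:C) = 0.
  move=> ab; apply: (@ccvg_uniq _ (fun n => Cintegral (fun x => f x * (cutoff n.+1%:R a b x)%:C))).
    apply: (@Cintegral_dominated _ _ _ (fun x => nrm (f x) * \1_`[a, b]%classic x)).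
    - move=> n; apply: CmeasM; first exact: L2_meas.
      apply: Cmeas_real; apply: continuous_measurable_fun => x.
      have [+ _] := @test_cutoff R n.+1%:R a b (ltr0Sn _ _).
      by move=> /(_ 0%N x) /derivable1_diffP/differentiable_continuous.
    - exact: Lp2_integrable_itv mn (L2_integrable f2).
    - move=> n x; rewrite nrmM nrm_real ler_wpM2l ?nrm_ge0// ger0_norm ?cutoff_ge0//.
      rewrite indicE; case: (boolP (a < x < b)) => [/andP[ax xb]|xab].
        by rewrite mem_set/= ?cutoff_le1// in_itv/= !ltW.
      by rewrite cutoff_out.
    - by move=> x; apply: ccvgM; [exact: ccvg_cst|apply: ccvg_real; exact: cutoff_cvg].
  rewrite (_ : (fun n => _) = fun=> 0); first exact: ccvg_cst.
  by apply/funext => n; apply: f0; exact: test_cutoff.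
have sq (h : R -> R) : measurable_fun setT h -> (forall x, `|h x| <= nrm (f x)) ->
    mu.-integrable setT (EFin \o (fun x => h x ^+ 2)).
  move=> mh hf; apply: le_integrable (L2_integrable f2) => //.
    by apply/measurable_EFinP; exact: measurable_funX.
  move=> x _; rewrite /= lee_fin !normrX [`|nrm _|]ger0_norm ?nrm_ge0//.
  by rewrite ler_pXn2r ?nnegrE ?nrm_ge0.
have e1 : ae_eq mu setT (ReC \o f) (fun=> 0).
  apply: integral_itv_eq0 => //; first by apply: sq => // x; exact: Re_le_nrm.
  move=> a b /main /(congr1 ReC) /= <-; apply: eq_Rintegral => x _.
  by rewrite mulrC -Re_scale mulrC.
have e2 : ae_eq mu setT (ImC \o f) (fun=> 0).
  apply: integral_itv_eq0 => //; first by apply: sq => // x; exact: Im_le_nrm.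
  move=> a b /main /(congr1 ImC) /= <-; apply: eq_Rintegral => x _.
  by rewrite mulrC -Im_scale mulrC.
by apply: filterS2 e1 e2 => x /= h1 h2 I; apply: complex_eq; rewrite ?h1 ?h2.
Qed.

Lemma test_derive phi : test_function phi -> test_function (derive1 phi).
Proof.
move=> [sphi [M phi0]]; split.
  by move=> n x; have := sphi n.+1 x; rewrite /derive1n iterSr.
exists M => x Mx; rewrite derive1E (near_eq_derive (g := cst 0)) ?derive_cst//.
near=> y; rewrite /= phi0//; near: y.
have : open [set y : R | M < `|y|].
  rewrite (_ : mkset _ = Num.norm @^-1` [set y | M < y]); last by [].
  by apply: open_comp => [y _|]; [exact: norm_continuous|exact: open_gt].
by move=> oM; exact: (open_nbhs_nbhs (conj oM Mx)).
Unshelve. all: by end_near. Qed.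

Lemma test_continuous phi : test_function phi -> continuous phi.
Proof.
by move=> [+ _] x => /(_ 0%N x) /derivable1_diffP/differentiable_continuous.
Qed.

Lemma test_cderive phi x : test_function phi ->
  cderive (fun x => (phi x)%:C) x (derive1 phi x)%:C.
Proof.
move=> [+ _] => /(_ 0%N x) d; apply: cderive_real.
by rewrite derive1E; exact/derivableP.
Qed.

Lemma test_bounded phi : test_function phi ->
  exists M C : R, [/\ 0 <= C, forall x, `|phi x| <= C & forall x, M < `|x| -> phi x = 0].
Proof.
move=> tphi; have [_ [M phi0]] := tphi; exists M.
have ab : - `|M| <= `|M| by rewrite lerNl -normrN (le_trans _ (normr_ge0 _))// lerNl oppr0.
have cn : {within `[- `|M|, `|M|], continuous (fun x => `|phi x|)}.
  apply: continuous_subspaceT => x.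
  by apply: (@continuous_comp _ _ _ phi (@Num.norm _ R)); [exact: test_continuous|exact: norm_continuous].
have [d _ dmax] := EVT_max ab cn.
exists `|phi d|; split => // x; have [xM|xM] := lerP `|x| `|M|.
  by apply: dmax; rewrite in_itv/= -ler_norml.
by rewrite phi0 ?normr0// (le_lt_trans _ xM)// ler_norm.
Qed.

Lemma test_gdecay phi : test_function phi -> gdecay (fun x => (phi x)%:C).
Proof.
move=> tphi; have [M [C [C0 phiC phi0]]] := test_bounded tphi.
split; first by apply: Cmeas_real; apply: continuous_measurable_fun; exact: test_continuous tphi.
exists (C * expR (M ^+ 2)), 1; split => //; first by rewrite mulr_ge0// expR_ge0.
move=> x; rewrite nrm_real -mulrA -expRD mul1r; have [xM|xM] := lerP `|x| `|M|.
  apply: le_trans (phiC x) _; rewrite ler_peMr// -expR0 ler_expR subr_ge0.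
  by rewrite -(real_normK (num_real x)) -(real_normK (num_real M)) ler_pXn2r ?nnegrE.
by rewrite phi0 ?normr0 ?mulr_ge0 ?expR_ge0// (le_lt_trans _ xM)// ler_norm.
Qed.

Lemma test_gdecayM phi f : test_function phi -> gdecay f ->
  gdecay (fun x => f x * (phi x)%:C).
Proof.
move=> tphi gf; have [M [C [C0 phiC phi0]]] := test_bounded tphi.
rewrite (_ : (fun x => _) = fun x => (phi x)%:C * f x); last first.
  by apply/funext => x; rewrite mulrC.
apply: (gdecayM (C := C) (k := 0) gf); first exact: gdecay_meas (test_gdecay tphi).
by move=> x; rewrite nrm_real mul0r expR0 mulr1.
Qed.

Lemma weak_derivative_uniq f g h : L2 g -> L2 h ->
  is_weak_derivative f g -> is_weak_derivative f h -> ae_eq mu setT g h.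
Proof.
move=> g2 h2 fg fh; suff : ae_eq mu setT (fun x => g x - h x) (fun=> 0).
  by apply: filterS => x /= H /H /eqP; rewrite subr_eq0 => /eqP.
apply: test_eq0; first exact: L2B.
move=> phi tphi; have p2 := gdecay_L2 (test_gdecay tphi).
have ig := L2_Cintegrable g2 p2; have ih := L2_Cintegrable h2 p2.
under eq_fun do rewrite mulrBl -mulN1r.
rewrite CintegralD// ?CintegralZ//; last exact: CintegrableZ.
rewrite mulN1r; apply/eqP; rewrite subr_eq0; apply/eqP.
by apply: oppr_inj; rewrite -fg// -fh.
Qed.

Lemma gdecay_weak_derivative f df ddf : gdecay f -> gdecay df ->
  (forall x, cderive f x (df x)) -> (forall x, cderive df x (ddf x)) ->
  is_weak_derivative f df.
Proof.
move=> gf gdf fdf dfddf phi tphi.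
have tphi' := test_derive tphi; have tphi'' := test_derive tphi'.
have g1 := test_gdecayM tphi gdf; have g2 := test_gdecayM tphi' gf.
have : Cintegral (fun x => df x * (phi x)%:C + f x * (derive1 phi x)%:C) = 0.
  apply: (@Cintegral_derive_eq0 _ (fun x => f x * (phi x)%:C)).
  - exact: test_gdecayM.
  - exact: gdecayD.
  - by move=> x; apply: cderiveM (fdf x) (test_cderive x tphi).
  - move=> x; apply: cderiveD.
      exact: cderiveM (dfddf x) (test_cderive x tphi).
    exact: cderiveM (fdf x) (test_cderive x tphi').
rewrite CintegralD; [|exact: gdecay_Cintegrable..].
by move=> /eqP; rewrite addrC addr_eq0 => /eqP.
Qed.

(** These are dilates of one bump, so they tend to its value at 0. That value is exp(-2) rather than
    1, and it is cancelled from both sides where the limit is used. *)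
Lemma dilated_cutoff_cvg x : (fun n : nat => cutoff n.+1%:R^-1 (- n.+1%:R) n.+1%:R x) @ \oo -->
  (cutoff 1 (-1) 1 0 : R).
Proof.
have fc (y : R) : {for y, continuous (flat (R := R) 0)}.
  exact: is_derive_continuous (is_derive_flat 0 y).
have h : (fun n : nat => n.+1%:R^-1 * x) @ \oo --> (0 : R).
  by rewrite -(mul0r x); apply: cvgMl; exact: cvg_harmonic.
rewrite /cutoff; apply: cvgM.
- apply: continuous_cvg; first exact: fc.
  rewrite (_ : (fun n => _) = fun n : nat => n.+1%:R^-1 * x + 1); last first.
    by apply/funext => n; rewrite opprK mulrDr mulVf.
  by rewrite opprK mul1r; apply: cvgD => //; exact: cvg_cst.
- apply: continuous_cvg; first exact: fc.
  rewrite (_ : (fun n => _) = fun n : nat => 1 - n.+1%:R^-1 * x); last first.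
    by apply/funext => n; rewrite mulrBr mulVf.
  by rewrite subr0 mul1r -[X in _ --> X]subr0; apply: cvgB => //; exact: cvg_cst.
Qed.

Lemma cutoff_derive (al a b x : R) : is_derive x 1 (cutoff al a b)
  (al * (flat 2 (al * (x - a)) * flat 0 (al * (b - x)) -
         flat 0 (al * (x - a)) * flat 2 (al * (b - x)))).
Proof.
have d1 : is_derive x 1 (fun x : R => al * (x - a)) al.
  by apply: is_derive_eq; rewrite /GRing.scale/=; ring.
have d2 : is_derive x 1 (fun x : R => al * (b - x)) (- al).
  by apply: is_derive_eq; rewrite /GRing.scale/=; ring.
have f1 := @is_derive1_comp _ (flat 0) (fun x => al * (x - a)) x _ _ (is_derive_flat 0 _) d1.
have f2 := @is_derive1_comp _ (flat 0) (fun x => al * (b - x)) x _ _ (is_derive_flat 0 _) d2.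
rewrite (_ : cutoff al a b = (flat 0 \o (fun x => al * (x - a))) * (flat 0 \o (fun x => al * (b - x))))//.
by apply: is_derive_eq; rewrite /GRing.scale/=; ring.
Qed.

Lemma cutoff_derive_le (al a b x : R) : 0 <= al -> `|derive1 (cutoff al a b) x| <= 4 * al.
Proof.
move=> al0; rewrite derive1E; have [_ ->] := cutoff_derive al a b x.
rewrite normrM (ger0_norm al0) mulrC ler_wpM2r//.
have f2 (y : R) : flat 2 y <= 2 by exact: (flat_le 2).
have f0 (y : R) : flat 0 y <= 1 by exact: (flat_le 0).
have h (y z : R) : 0 <= flat 2 y * flat 0 z <= 2.
  by rewrite mulr_ge0 ?flat_ge0//= -[leRHS]mulr1 ler_pM// flat_ge0.
have /andP[h1 h2] := h (al * (x - a)) (al * (b - x)).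
have /andP[h3 h4] := h (al * (b - x)) (al * (x - a)).
rewrite [flat 0 _ * flat 2 _]mulrC ler_norml; apply/andP; split; lra.
Qed.

(* cut the Gaussian off by cutoffs supported on ]-n, n[ *)
Lemma weak_derivative_polygauss v w (p : {poly R[i]}) (b s k : R[i]) : 0 < ReC b ->
  L2 v -> L2 w -> is_weak_derivative v w ->
  Cintegral (fun x => v x * polygauss (dpoly b s p) b s k x) =
  - Cintegral (fun x => w x * polygauss p b s k x).
Proof.
move=> b0 v2 w2 vw.
set psi := polygauss p b s k; set dpsi := polygauss (dpoly b s p) b s k.
have gpsi : gdecay psi by exact: gdecay_polygauss.
have gdpsi : gdecay dpsi by exact: gdecay_polygauss.
have psi2 := gdecay_L2 gpsi; have dpsi2 := gdecay_L2 gdpsi.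
pose chi (n : nat) : R -> R := cutoff n.+1%:R^-1 (- n.+1%:R) n.+1%:R.
have al0 n : 0 < n.+1%:R^-1 :> R by rewrite invr_gt0.
have tchi n : test_function (chi n) by exact: test_cutoff.
have chi1 n x : `|chi n x| <= 1 by rewrite ger0_norm ?cutoff_ge0// cutoff_le1.
have dchi n (x : R) : is_derive x 1 (chi n) (derive1 (chi n) x).
  by have [+ _] := tchi n => /(_ 0%N x) d; rewrite derive1E; exact/derivableP.
have [sR sI] := smooth_polygauss p b s k.
have dpsiE x := cderive_polygauss p b s k x.
have tst (h : R[i] -> R) n : smooth (h \o psi) -> test_function (fun x => chi n x * h (psi x)).
  move=> sh; have [sc _] := tchi n; split; first exact: smoothM sc sh.
  have [_ [M chi0]] := tchi n; exists M => x /chi0 ->; by rewrite mul0r.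
have dtst (h : R[i] -> R) n (x : R) : is_derive x 1 (h \o psi) (h (dpsi x)) ->
    derive1 (fun x => chi n x * h (psi x)) x =
    derive1 (chi n) x * h (psi x) + chi n x * h (dpsi x).
  move=> dh; have dc := dchi n x; rewrite derive1E.
  have H : is_derive x 1 (chi n * (h \o psi)) (derive1 (chi n) x * h (psi x) + chi n x * h (dpsi x)).
    by apply: is_derive_eq; rewrite /GRing.scale/=; ring.
  by have [_ <-] := H.
have cutC n : test_function (derive1 (chi n)) by exact: test_derive.
have L2c (phi : R -> R) g : test_function phi -> L2 g -> (exists2 C : R, 0 <= C & forall x, `|phi x| <= C) ->
    L2 (fun x => (phi x)%:C * g x).
  move=> tphi g2 [C C0 phiC]; apply: (L2_le _ (L2Z C%:C g2)).
    by apply: CmeasM; [exact: gdecay_meas (test_gdecay tphi)|exact: L2_meas].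
  by move=> x; rewrite !nrmM !nrm_real ler_wpM2r ?nrm_ge0// (ger0_norm C0).
(* Test functions are real, so the weak derivative is tested against the real and imaginary parts of
   the truncated Gaussian separately, and the two identities are recombined with the factor i. *)
have eqn n : Cintegral (fun x => v x * ((derive1 (chi n) x)%:C * psi x + (chi n x)%:C * dpsi x)) =
    - Cintegral (fun x => w x * ((chi n x)%:C * psi x)).
  have t1 := tst ReC n sR; have t2 := tst ImC n sI.
  have E1 := vw _ t1; have E2 := vw _ t2.
  have gt g phi : L2 g -> test_function phi -> Cintegrable (fun x => g x * (phi x)%:C).
    by move=> g2 tphi; apply: L2_Cintegrable => //; exact: gdecay_L2 (test_gdecay tphi).
  have t1' := test_derive t1; have t2' := test_derive t2.
  have split0 (u1 u2 : R -> R) (u g : R -> R[i]) :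
      (forall x, u x = u1 x +i* u2 x) ->
      Cintegrable (fun x => g x * (u1 x)%:C) -> Cintegrable (fun x => g x * (u2 x)%:C) ->
      Cintegral (fun x => g x * u x) = Cintegral (fun x => g x * (u1 x)%:C) +
        'i * Cintegral (fun x => g x * (u2 x)%:C).
    move=> uE i1 i2; rewrite -CintegralZ// -CintegralD//; last exact: CintegrableZ.
    congr Cintegral; apply/funext => x; rewrite uE mulrCA -mulrDr; congr (_ * _).
    by apply: complex_eq; rewrite !(ReCD, ImCD, ReCM, ImCM) /=; ring.
  rewrite (split0 _ _ _ _ _ (gt _ _ v2 t1') (gt _ _ v2 t2')); last first.
    move=> x; have [dR dI] := dpsiE x; rewrite (dtst ReC)// (dtst ImC)//.
    by apply: complex_eq; rewrite !(ReCD, ImCD, Re_scale, Im_scale).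
  rewrite (split0 _ _ _ _ _ (gt _ _ w2 t1) (gt _ _ w2 t2)); last first.
    by move=> x; apply: complex_eq; rewrite !(Re_scale, Im_scale).
  by rewrite E1 E2 opprD mulrN.
have c0 : cutoff 1 (-1) 1 0 != 0 :> R.
  by rewrite cutoff_in// ?gt_eqF ?expR_gt0//; apply/andP; split; lra.
set cc : R := cutoff 1 (-1) 1 0 in c0.
have lim1 : ccvg (fun n => Cintegral (fun x => v x * ((derive1 (chi n) x)%:C * psi x + (chi n x)%:C * dpsi x)))
    (Cintegral (fun x => v x * (cc%:C * dpsi x))).
  have i1 := L2_mul_integrable v2 psi2; have i2 := L2_mul_integrable v2 dpsi2.
  apply: (@Cintegral_dominated _ _ _ (fun x => 4 * (nrm (v x) * nrm (psi x)) + nrm (v x) * nrm (dpsi x))).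
  - move=> n; apply: CmeasM; first exact: L2_meas.
    by apply: CmeasD; apply: CmeasM; first [exact: gdecay_meas (test_gdecay _)|exact: gdecay_meas].
  - rewrite /comp; under eq_fun do rewrite EFinD; apply: integrableD => //.
    exact: (integrable_scale 4 i1).
  - move=> n x; rewrite nrmM [4 * _]mulrCA -mulrDr ler_wpM2l ?nrm_ge0//.
    apply: le_trans (nrmD _ _) _.
    rewrite [nrm (_ * psi x)]nrmM [nrm (_ * dpsi x)]nrmM !nrm_real; apply: lerD.
      rewrite ler_wpM2r ?nrm_ge0//; apply: le_trans (cutoff_derive_le _ _ _ (ltW (al0 n))) _.
      by rewrite ler_piMr// invf_le1// ler1n.
    by rewrite ler_piMl ?nrm_ge0.
  - move=> x; apply: ccvgM; first exact: ccvg_cst.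
    rewrite -[X in ccvg _ X]add0r -[X in ccvg _ (X + _)](mul0r (psi x)).
    apply: ccvgD; apply: ccvgM; try exact: ccvg_cst; apply: ccvg_real.
      apply/cvgr0Pnorm_le => e e0; near=> n.
      apply: le_trans (cutoff_derive_le _ _ _ (ltW (al0 n))) _.
      rewrite -ler_pdivlMl//; near: n.
      have := @cvg_harmonic R => /cvgr0Pnorm_le /(_ (4^-1 * e)).
      rewrite mulr_gt0 ?invr_gt0// => /(_ isT); apply: filterS => n /=.
      by apply: le_trans; exact: ler_norm.
    exact: dilated_cutoff_cvg.
have lim2 : ccvg (fun n => Cintegral (fun x => w x * ((chi n x)%:C * psi x)))
    (Cintegral (fun x => w x * (cc%:C * psi x))).
  apply: (@Cintegral_dominated _ _ _ (fun x => nrm (w x) * nrm (psi x))).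
  - move=> n; apply: CmeasM; first exact: L2_meas.
    by apply: CmeasM; first [exact: gdecay_meas (test_gdecay _)|exact: gdecay_meas].
  - exact: L2_mul_integrable.
  - move=> n x; rewrite nrmM [nrm (_ * psi x)]nrmM ler_wpM2l ?nrm_ge0// nrm_real.
    by rewrite ler_piMl ?nrm_ge0.
  - move=> x; apply: ccvgM; first exact: ccvg_cst.
    by apply: ccvgM; [apply: ccvg_real; exact: dilated_cutoff_cvg|exact: ccvg_cst].
have lim1' : ccvg (fun n => - Cintegral (fun x => w x * ((chi n x)%:C * psi x)))
    (Cintegral (fun x => v x * (cc%:C * dpsi x))).
  by rewrite (_ : (fun n => _) = fun n => Cintegral (fun x => v x *
    ((derive1 (chi n) x)%:C * psi x + (chi n x)%:C * dpsi x)))//; apply/funext => n.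
have := ccvg_uniq lim1' (ccvgN lim2).
have pull g u : Cintegrable (fun x => g x * u x) ->
    Cintegral (fun x => g x * (cc%:C * u x)) = cc%:C * Cintegral (fun x => g x * u x).
  by move=> i; rewrite -CintegralZ//; congr Cintegral; apply/funext => x; rewrite mulrCA.
rewrite !pull; [|exact: L2_Cintegrable..].
rewrite -mulrN; apply: mulfI.
by rewrite -nrm_eq0 nrm_real normr_eq0.
Unshelve. all: by end_near. Qed.

End WeakDerivatives.


(** * Coherent states *)

Section CoherentStates.
Context {R : realType}.
Local Notation mu := (@lebesgue_measure R).
Implicit Types (b s k c : R[i]) (v : R -> R[i]).

Lemma conjM (z w : R[i]) : conjc (z * w) = conjc z * conjc w.
Proof. exact: rmorphM. Qed.

Lemma conjB (z w : R[i]) : conjc (z - w) = conjc z - conjc w.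
Proof. exact: rmorphB. Qed.

Lemma conj_Cexp (z : R[i]) : conjc (Cexp z) = Cexp (conjc z).
Proof.
apply: complex_eq.
- by rewrite ReCJ !Re_Cexp ReCJ ImCJ cosN.
- by rewrite ImCJ !Im_Cexp ReCJ ImCJ sinN mulrN.
Qed.

Lemma conj_gauss b s k x : conjc (gauss b s k x) = gauss (conjc b) (conjc s) (conjc k) x.
Proof.
rewrite /gauss conj_Cexp; congr Cexp.
by apply: complex_eq; rewrite !(ReCD, ImCD, ReCN, ImCN, ReCM, ImCM, ReCJ, ImCJ) /=; ring.
Qed.

Lemma polygauss_d1 b s k x :
  polygauss (dpoly b s 1) b s k x = (s - 2 * b * x%:C) * gauss b s k x.
Proof.
rewrite /polygauss /dpoly; congr (_ * _).
by rewrite -polyC1 derivC add0r mul1r hornerD hornerN hornerZ hornerX hornerC.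
Qed.

Lemma polygauss_d2 b s k x : polygauss (dpoly b s (dpoly b s 1)) b s k x =
  ((s - 2 * b * x%:C) ^+ 2 - 2 * b) * gauss b s k x.
Proof.
rewrite /polygauss /dpoly; congr (_ * _).
rewrite -polyC1 derivC add0r mul1r derivB derivC derivZ derivX sub0r.
by rewrite !(hornerD, hornerN, hornerZ, hornerX, hornerC, hornerM); ring.
Qed.

Lemma W12_weak_derivative v : W12 v ->
  L2 (weak_derivative v) /\ is_weak_derivative v (weak_derivative v).
Proof. by move=> [_ [g g2 vg]]; apply: (@xgetPex _ _ [set g | L2 g /\ is_weak_derivative v g]); exists g. Qed.

Lemma gauss_W12 b s k : 0 < ReC b -> W12 (gauss b s k).
Proof.
move=> b0; split; first exact/gdecay_L2/gdecay_gauss.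
exists (polygauss (dpoly b s 1) b s k); first exact/gdecay_L2/gdecay_polygauss.
rewrite -[gauss b s k]polygauss1.
apply: (gdecay_weak_derivative (ddf := polygauss (dpoly b s (dpoly b s 1)) b s k)).
- exact: gdecay_polygauss.
- exact: gdecay_polygauss.
- by move=> x; exact: cderive_polygauss.
- by move=> x; exact: cderive_polygauss.
Qed.

(** With 4 b^2 = c the quadratic terms of - u'' and c x^2 u cancel, leaving a polynomial of degree
    one times u. The form identity is an integration by parts in which the conjugate of u', again a
    polynomial times a Gaussian, replaces the test function. *)
Lemma Hop_gauss c b s k : 4 * b ^+ 2 = c -> 0 < ReC b ->
  Hop c (gauss b s k) (fun x => (4 * b * s * x%:C - s ^+ 2 + 2 * b) * gauss b s k x).
Proof.
move=> bc b0; set u := gauss b s k; set h := (fun x => _).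
have u12 : W12 u by exact: gauss_W12.
pose u1 := polygauss (dpoly b s 1) b s k.
pose u2 := polygauss (dpoly b s (dpoly b s 1)) b s k.
have u12L : L2 u1 by exact/gdecay_L2/gdecay_polygauss.
have u22L : L2 u2 by exact/gdecay_L2/gdecay_polygauss.
have hE : h = polygauss ((4 * b * s) *: 'X + (2 * b - s ^+ 2)%:P) b s k.
  apply/funext => x; rewrite /h /polygauss hornerD hornerZ hornerX hornerC.
  by congr (_ * _); rewrite addrAC addrA.
have h2 : L2 h by rewrite hE; exact/gdecay_L2/gdecay_polygauss.
have xx : L2 (fun x => (x ^+ 2)%:C * u x).
  rewrite (_ : (fun x => _) = polygauss 'X^2 b s k).
    exact/gdecay_L2/gdecay_polygauss.
  by apply/funext => x; rewrite /polygauss hornerXn rmorphXn.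
split => //.
  split => //.
  have : L2 (polygauss 'X b s k) by exact/gdecay_L2/gdecay_polygauss.
  move=> /L2P[_]; apply: le_lt_trans; rewrite le_eqVlt; apply/orP; left; apply/eqP.
  apply: eq_integral => x _; congr EFin.
  by rewrite /polygauss hornerX [nrm (x%:C * _)]nrmM nrm_real [RHS]exprMn (real_normK (num_real x)).
move=> v [v12 _]; have [w2 vw] := W12_weak_derivative v12.
set w := weak_derivative v in w2 vw *.
have [du2 du] := W12_weak_derivative u12.
have v2 : L2 v by case: v12.
have cv2 := L2_conj v2; have cw2 := L2_conj w2.
(* [weak_derivative] is picked by choice, so it agrees with the classical derivative only almost
   everywhere. *)
have duE : ae_eq mu setT (weak_derivative u) u1.
  apply: weak_derivative_uniq du2 u12L du _.
  rewrite /u -[gauss b s k]polygauss1.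
  apply: (gdecay_weak_derivative (ddf := u2)).
  - exact: gdecay_polygauss.
  - exact: gdecay_polygauss.
  - by move=> x; exact: cderive_polygauss.
  - by move=> x; exact: cderive_polygauss.
have cb0 : 0 < ReC (conjc b) by rewrite ReCJ.
have ibp := weak_derivative_polygauss (dpoly (conjc b) (conjc s) 1) (conjc s) (conjc k) cb0 v2 w2 vw.
have j1 x : conjc (u1 x) = polygauss (dpoly (conjc b) (conjc s) 1) (conjc b) (conjc s) (conjc k) x.
  by rewrite /u1 !polygauss_d1 conjM conj_gauss conjB !conjM conjc_real conjc_nat.
have j2 x : conjc (u2 x) = polygauss (dpoly (conjc b) (conjc s) (dpoly (conjc b) (conjc s) 1))
    (conjc b) (conjc s) (conjc k) x.
  by rewrite /u2 !polygauss_d2 conjM conj_gauss conjB expr2 !conjM conjB !conjM conjc_real conjc_nat -expr2.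
have ibp' : Cintegral (fun x => u1 x * conjc (w x)) = - Cintegral (fun x => u2 x * conjc (v x)).
  rewrite (_ : (fun x => u1 x * conjc (w x)) = fun x => conjc (w x * conjc (u1 x))); last first.
    by apply/funext => x; rewrite conjM conjcK mulrC.
  rewrite (_ : (fun x => u2 x * conjc (v x)) = fun x => conjc (v x * conjc (u2 x))); last first.
    by apply/funext => x; rewrite conjM conjcK mulrC.
  rewrite !Cintegral_conj; try by apply: L2_Cintegrable => //; exact: L2_conj.
  rewrite -rmorphN; congr conjc.
  rewrite (_ : (fun x => w x * conjc (u1 x)) = fun x => w x *
    polygauss (dpoly (conjc b) (conjc s) 1) (conjc b) (conjc s) (conjc k) x); last first.
    by apply/funext => x; rewrite j1.
  rewrite (_ : (fun x => v x * conjc (u2 x)) = fun x => v x *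
    polygauss (dpoly (conjc b) (conjc s) (dpoly (conjc b) (conjc s) 1)) (conjc b) (conjc s) (conjc k) x); last first.
    by apply/funext => x; rewrite j2.
  by rewrite ibp opprK.
rewrite /Qform -/w.
have -> : Cintegral (fun x => weak_derivative u x * conjc (w x)) = Cintegral (fun x => u1 x * conjc (w x)).
  apply: Cintegral_ae.
  - by apply: CmeasM; [exact: L2_meas|exact: L2_meas].
  - by apply: CmeasM; [exact: L2_meas|exact: L2_meas].
  - by move: duE; apply: filterS => x /= H I; rewrite H.
have i1 := L2_Cintegrable u22L cv2; have i2 := L2_Cintegrable xx cv2.
rewrite ibp' -mulN1r -!CintegralZ// -CintegralD; [|exact: CintegrableZ..].
congr Cintegral; apply/funext => x.
by rewrite /u2 polygauss_d2 -/u /h -bc rmorphXn/=; ring.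
Qed.

Section Path.
Variables (q e s0 : R[i]).
Hypotheses (q0 : 0 < ReC q) (qe0 : 0 <= ReC (q * e)).

(** Here [e] is the direction of a ray and [r] the time along it. Comparing the coefficients of x
    and of 1 in u' = - e H_c u gives sigma' = - 2 q e sigma and kappa' = e (sigma^2 - q);
    [coh_sigma] and [coh_kappa] solve these equations with sigma(0) = s0 and kappa(0) = 0. *)
Definition coh_lambda (r : R) : R[i] := Cexp (- (2 * q * e * r%:C)).
Definition coh_sigma r := s0 * coh_lambda r.
Definition coh_kappa (r : R) : R[i] :=
  - (q * e * r%:C) + s0 ^+ 2 * (1 - coh_lambda r ^+ 2) / (4 * q).
Definition coherent r := gauss (q / 2) (coh_sigma r) (coh_kappa r).
Definition coherent_rate r (x : R) : R[i] :=
  - e * (2 * q * coh_sigma r * x%:C - coh_sigma r ^+ 2 + q).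
Definition coherent_deriv r x := coherent_rate r x * coherent r x.

Local Notation lam := coh_lambda.
Local Notation sig := coh_sigma.
Local Notation kap := coh_kappa.
Local Notation P := coherent_rate.

Let q_neq0 : q != 0.
Proof. by apply/eqP => q00; move: q0; rewrite q00 ltxx. Qed.

Let dlam r : cderive lam r (- (2 * q * e) * lam r).
Proof.
apply: cderive_Cexp; apply: cderiveN.
by have := cderiveZ (2 * q * e) (cderive_id r); rewrite mulr1.
Qed.

Let dsig r : cderive sig r (- (2 * q * e) * sig r).
Proof. by have := cderiveZ s0 (dlam r) => /cderive_eq; apply; rewrite /sig; ring. Qed.

Let dsig2 r : cderive (fun r => sig r ^+ 2) r (- (4 * q * e) * sig r ^+ 2).
Proof.
have := cderiveM (dsig r) (dsig r).
rewrite (_ : (fun x => sig x * sig x) = fun x => sig x ^+ 2); last exact/funext.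
by move=> /cderive_eq; apply; ring.
Qed.

Let dkap r : cderive kap r (- (q * e) + e * sig r ^+ 2).
Proof.
have d1 := cderiveN (cderiveZ (q * e) (cderive_id r)).
have d2 := cderiveZ (4 * q)^-1 (cderiveB (cderive_cst (s0 ^+ 2) r) (dsig2 r)).
have := cderiveD d1 d2.
rewrite (_ : (fun x => _) = kap); last first.
  by apply/funext => x; rewrite /kap /sig; ring.
by move=> /cderive_eq; apply; rewrite mulr1 sub0r; field.
Qed.

Let dcoh r x : cderive (fun r => coherent r x) r (coherent_deriv r x).
Proof.
apply: cderive_eq.
  apply: cderive_Cexp; apply: cderiveB; last exact: cderive_cst.
  by apply: cderiveD (dkap r) _; apply: cderiveM (dsig r) (cderive_cst _ _).
by rewrite /coherent_deriv /P; congr (_ * _); ring.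
Qed.

(** The second derivative in time; it controls the Taylor remainder that turns pointwise
    differentiability into differentiability in L^2. *)
Definition coherent_deriv2 r x :=
  (4 * q * e * e * (q * sig r * x%:C - sig r * sig r) + P r x ^+ 2) * coherent r x.

Let ddcoh r x : cderive (fun r => coherent_deriv r x) r (coherent_deriv2 r x).
Proof.
apply: cderive_eq.
  apply: cderiveM (dcoh r x).
  apply: cderiveZ; apply: cderiveD; last exact: (cderive_cst q).
  apply: cderiveB (dsig2 r).
  apply: cderiveM (cderive_cst _ _).
  exact: cderiveZ (dsig r).
by rewrite /coherent_deriv2 /coherent_deriv; ring.
Qed.

Let nlam r : 0 <= r -> nrm (lam r) <= 1.
Proof.
move=> r0; rewrite nrm_Cexp -expR0 ler_expR ReCN oppr_le0.
rewrite (_ : 2 * q * e * r%:C = (2 * r)%:C * (q * e)); last by rewrite rcM rmorph_nat; ring.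
by rewrite Re_scale mulr_ge0// mulr_ge0.
Qed.

Let A := nrm s0 + nrm q + nrm e + 1.
Let A1 : 1 <= A.
Proof. by rewrite lerDr !addr_ge0 ?nrm_ge0. Qed.
Let A0 : 0 <= A. Proof. exact: le_trans A1. Qed.

Let nsig r : 0 <= r -> nrm (sig r) <= A.
Proof.
move=> r0; rewrite nrmM; apply: (@le_trans _ _ (nrm s0)).
  by rewrite ler_piMr ?nrm_ge0// nlam.
by rewrite /A; have := nrm_ge0 q; have := nrm_ge0 e; lra.
Qed.

Let nq : nrm q <= A.
Proof. by rewrite /A; have := nrm_ge0 s0; have := nrm_ge0 e; lra. Qed.
Let ne : nrm e <= A.
Proof. by rewrite /A; have := nrm_ge0 s0; have := nrm_ge0 q; lra. Qed.

Let nrm_nat n : nrm (n%:R : R[i]) = n%:R.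
Proof. by rewrite -(rmorph_nat (real_complex R)) nrm_real ger0_norm. Qed.

(** Accounts for [coh_kappa]: its second term has modulus at most A^2 / |q|, and its first term has
    nonpositive real part. *)
Let C0 := expR (A ^+ 2 * (nrm q)^-1).

Let ncoh r x : 0 <= r -> nrm (coherent r x) <=
  C0 * (expR (A * `|x|) * expR (- (ReC q / 2 * x ^+ 2))).
Proof.
move=> r0; rewrite nrm_gauss -!expRD ler_expR.
rewrite Re_half addrA lerD2r; apply: lerD.
  rewrite /kap ReCD -[leRHS]add0r; apply: lerD.
    rewrite ReCN oppr_le0 (_ : q * e * r%:C = r%:C * (q * e)); last by rewrite mulrC.
    by rewrite Re_scale mulr_ge0.
  apply: le_trans (ler_norm _) (le_trans (Re_le_nrm _) _).
  rewrite nrmM nrmV [nrm (4 * q)]nrmM nrm_nat nrmM nrmX.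
  have n1 : nrm (1 - lam r ^+ 2) <= 2.
    apply: le_trans (nrmB _ _) _; rewrite nrmX (_ : nrm 1 = 1); last exact: Normc.normc1.
    by have := exprn_ile1 2 (nrm_ge0 _) (nlam r0); lra.
  have s2 : nrm s0 ^+ 2 <= A ^+ 2.
    by rewrite ler_pXn2r ?nnegrE ?nrm_ge0// /A; have := nrm_ge0 q; have := nrm_ge0 e; lra.
  have qi : 0 <= (nrm q)^-1 by rewrite invr_ge0 nrm_ge0.
  rewrite invfM mulrA ler_wpM2r// mulrC ler_pdivrMl//.
  apply: le_trans (ler_pM _ _ s2 n1) _; rewrite ?sqr_ge0 ?nrm_ge0//.
  by have := sqr_ge0 A; lra.
apply: le_trans (ler_norm _) _; rewrite normrM ler_wpM2r//.
by apply: le_trans (Re_le_nrm _) (nsig r0).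
Qed.

Let ex1 (x : R) : 1 <= expR `|x|. Proof. by rewrite -expR0 ler_expR. Qed.

Let nrmM_le (u v : R[i]) (a b : R) : nrm u <= a -> nrm v <= b -> nrm (u * v) <= a * b.
Proof. by move=> ua vb; rewrite nrmM ler_pM ?nrm_ge0. Qed.

Let nrmB_le (u v : R[i]) (a b : R) : nrm u <= a -> nrm v <= b -> nrm (u - v) <= a + b.
Proof. by move=> ua vb; apply: le_trans (nrmB _ _) (lerD ua vb). Qed.

Let nrmD_le (u v : R[i]) (a b : R) : nrm u <= a -> nrm v <= b -> nrm (u + v) <= a + b.
Proof. by move=> ua vb; apply: le_trans (nrmD _ _) (lerD ua vb). Qed.

Let n_nat n : nrm (n%:R : R[i]) <= n%:R. Proof. by rewrite nrm_nat. Qed.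

Let n_x (x : R) : nrm x%:C <= expR `|x|. Proof. by rewrite nrm_real abs_le_expR. Qed.

Let le_pow_exp n m (x : R) : (n <= m)%N -> A ^+ n <= A ^+ m * expR `|x|.
Proof.
move=> nm; apply: (@le_trans _ _ (A ^+ m)); first exact: ler_weXn2l.
by rewrite ler_peMr// exprn_ge0.
Qed.

Let nP r x : 0 <= r -> nrm (P r x) <= 4 * A ^+ 3 * expR `|x|.
Proof.
move=> r0; have s1 := nsig r0; have ne' : nrm (- e) <= A by rewrite nrmN.
have := nrmM_le ne' (nrmD_le (nrmB_le (nrmM_le (nrmM_le (nrmM_le (n_nat 2) nq) s1) (n_x x))
  (nrmM_le s1 s1)) nq).
rewrite -expr2 => /le_trans; apply.
have := le_pow_exp x (isT : (3 <= 3)%N); have := le_pow_exp x (isT : (2 <= 3)%N).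
rewrite -!expr2.
have -> : A * (2 * A * A * expR `|x| + A * A + A) = 2 * A ^+ 3 * expR `|x| + A ^+ 3 + A ^+ 2 by ring.
lra.
Qed.

(** The first term bounds the factor of the first time derivative, the bracket that of the second.
    With it, [G] dominates both derivatives for all r >= 0 simultaneously. *)
Let D := 4 * A ^+ 3 + (8 * A ^+ 5 + (4 * A ^+ 3) ^+ 2).
Let D0 : 0 <= D. Proof. by rewrite !addr_ge0// ?mulr_ge0// ?exprn_ge0// ?mulr_ge0 ?exprn_ge0. Qed.
Let G (x : R) := D * C0 * (expR ((A + 2) ^+ 2 / (2 * (ReC q / 2))) * expR (- (ReC q / 2 / 2 * x ^+ 2))).

Let C00 : 0 <= C0. Proof. exact: expR_ge0. Qed.
Let qh0 : 0 < ReC q / 2. Proof. by rewrite divr_gt0. Qed.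

Let G2 : L2 (fun x => (G x)%:C).
Proof.
apply: gdecay_L2; apply: (@gdecay_exp _ _ (D * C0 * expR ((A + 2) ^+ 2 / (2 * (ReC q / 2)))) 0 (ReC q / 2 / 2)).
- apply: Cmeas_real; have /integrableP[] : mu.-integrable setT (EFin \o G).
    by apply: integrable_scale; apply: integrable_scale; apply: integrable_gauss; rewrite divr_gt0.
  by move=> /measurable_EFinP.
- by rewrite !mulr_ge0// expR_ge0.
- by rewrite divr_gt0.
- move=> x; rewrite nrm_real ger0_norm ?mul0r ?expR0 ?mul1r; last by rewrite !mulr_ge0// expR_ge0.
  by rewrite /G mulrA mulrA.
Qed.

Let bound_gen r x (z : R[i]) : 0 <= r -> nrm z <= D * expR (2 * `|x|) ->
  nrm (z * coherent r x) <= G x.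
Proof.
move=> r0 zD; rewrite nrmM.
apply: le_trans (ler_pM (nrm_ge0 _) (nrm_ge0 _) zD (ncoh x r0)) _.
have -> : D * expR (2 * `|x|) * (C0 * (expR (A * `|x|) * expR (- (ReC q / 2 * x ^+ 2)))) =
    D * C0 * (expR ((A + 2) * `|x|) * expR (- (ReC q / 2 * x ^+ 2))).
  by rewrite [(A + 2) * _]mulrDl expRD; ring.
by rewrite ler_wpM2l ?mulr_ge0// expR_abs_quad.
Qed.

Let e2x (x : R) : expR `|x| <= expR (2 * `|x|).
Proof. by rewrite ler_expR ler_peMl// ler1n. Qed.

Let A30 : 0 <= 4 * A ^+ 3. Proof. by rewrite mulr_ge0// exprn_ge0. Qed.

Let bound1 r x : 0 <= r -> nrm (coherent_deriv r x) <= G x.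
Proof.
move=> r0; apply: bound_gen => //; apply: le_trans (nP x r0) _.
by rewrite ler_pM ?expR_ge0// /D lerDl addr_ge0 ?sqr_ge0// mulr_ge0// exprn_ge0.
Qed.

Let bound2 r x : 0 <= r -> nrm (coherent_deriv2 r x) <= G x.
Proof.
move=> r0; apply: bound_gen => //.
have h1 : nrm (P r x ^+ 2) <= (4 * A ^+ 3) ^+ 2 * expR (2 * `|x|).
  rewrite nrmX (_ : expR (2 * `|x|) = expR `|x| ^+ 2); last by rewrite -expRM_natl.
  by rewrite -exprMn ler_pXn2r ?nnegrE ?nrm_ge0 ?mulr_ge0 ?expR_ge0 ?nP ?exprn_ge0.
have s1 := nsig r0.
have h2 : nrm (4 * q * e * e * (q * sig r * x%:C - sig r * sig r)) <= 8 * A ^+ 5 * expR `|x|.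
  have := nrmM_le (nrmM_le (nrmM_le (nrmM_le (n_nat 4) nq) ne) ne)
    (nrmB_le (nrmM_le (nrmM_le nq s1) (n_x x)) (nrmM_le s1 s1)).
  move=> /le_trans; apply.
  have := le_pow_exp x (isT : (5 <= 5)%N).
  have -> : 4 * A * A * A * (A * A * expR `|x| + A * A) = 4 * (A ^+ 5 * expR `|x|) + 4 * A ^+ 5 by ring.
  lra.
apply: le_trans (nrmD_le h2 h1) _; rewrite /D.
have h3 : 8 * A ^+ 5 * expR `|x| <= 8 * A ^+ 5 * expR (2 * `|x|).
  by rewrite ler_wpM2l// mulr_ge0// exprn_ge0.
have h4 : 0 <= 4 * A ^+ 3 * expR (2 * `|x|) by rewrite mulr_ge0// expR_ge0.
have -> : (4 * A ^+ 3 + (8 * A ^+ 5 + (4 * A ^+ 3) ^+ 2)) * expR (2 * `|x|) =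
    4 * A ^+ 3 * expR (2 * `|x|) + 8 * A ^+ 5 * expR (2 * `|x|) +
    (4 * A ^+ 3) ^+ 2 * expR (2 * `|x|) by rewrite !mulrDl addrA.
lra.
Qed.

Let coherent_gdecay r : gdecay (coherent r).
Proof. by apply: gdecay_gauss; rewrite Re_half. Qed.

Let coherent_deriv_gdecay r : gdecay (coherent_deriv r).
Proof.
rewrite (_ : coherent_deriv r = polygauss ((- e * (2 * q * sig r)) *: 'X + (- e * (q - sig r ^+ 2))%:P)
   (q / 2) (sig r) (kap r)).
  by apply: gdecay_polygauss; rewrite Re_half.
apply/funext => x; rewrite /coherent_deriv /polygauss hornerD hornerZ hornerX hornerC.
by congr (_ * _); rewrite /P; ring.
Qed.

Let coh_lip r h x : 0 <= r -> 0 <= h ->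
  nrm (coherent (r + h) x - coherent r x) <= 2 * h * G x.
Proof.
move=> r0 h0; apply: le_trans (cderive_lipschitz (M := G x) _ (fun y _ => dcoh y x) _) _.
- by rewrite lerDl.
- by move=> y /andP[ry _]; apply: bound1; exact: le_trans ry.
- by rewrite addrAC subrr add0r mulrCA mulrC mulrA.
Qed.

(** The mean value inequality is applied twice, to the first derivative and then to the remainder;
    each application costs a factor 2. *)
Let coh_taylor r h x : 0 <= r -> 0 <= h ->
  nrm (coherent (r + h) x - coherent r x - h%:C * coherent_deriv r x) <= 4 * h ^+ 2 * G x.
Proof.
move=> r0 h0; have rh : r <= r + h by rewrite lerDl.
have rhr : r + h - r = h by rewrite addrAC subrr add0r.
have d2 y : r <= y <= r + h -> nrm (coherent_deriv y x - coherent_deriv r x) <= 2 * (G x * h).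
  move=> /andP[ry yrh].
  apply: le_trans (cderive_lipschitz (M := G x) ry (fun y _ => ddcoh y x) _) _.
    by move=> y' /andP[ry' _]; apply: bound2; exact: le_trans ry'.
  rewrite ler_wpM2l// ler_wpM2l//.
    by apply: le_trans (bound1 x r0); exact: nrm_ge0.
  by rewrite -rhr lerD2r.
pose f y := coherent y x - y%:C * coherent_deriv r x.
have df y : cderive f y (coherent_deriv y x - coherent_deriv r x).
  apply: cderiveB; first exact: dcoh.
  by have := cderiveM (cderive_id y) (cderive_cst (coherent_deriv r x) y); rewrite mul1r mulr0 addr0.
have := cderive_lipschitz rh (fun y _ => df y) d2.
rewrite rhr /f (_ : _ - _ - _ = coherent (r + h) x - coherent r x - h%:C * coherent_deriv r x); last first.
  by rewrite rcD; ring.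
by move=> /le_trans; apply; rewrite le_eqVlt; apply/orP; left; apply/eqP; ring.
Qed.

Let N2_le_G f (C : R) : 0 <= C -> L2 f -> (forall x, nrm (f x) <= C * G x) ->
  N2 f <= C * N2 (fun x => (G x)%:C).
Proof.
move=> Cp f2 fG; rewrite -[C in leRHS](ger0_norm Cp) -nrm_real -N2Z//.
apply: le_N2 => //; first exact: L2Z.
move=> x; apply: le_trans (fG x) _; rewrite nrmM !nrm_real ger0_norm// ler_wpM2l//.
exact: ler_norm.
Qed.

Lemma coherent_propagation (S : R -> (R -> R[i]) -> R -> R[i]) (t : R) :
  is_semigroup S -> 0 <= t ->
  (forall r, 0 <= r -> has_generator S (coherent r) (coherent_deriv r)) ->
  ae_eq mu setT (S t (coherent 0)) (coherent t).
Proof.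
move=> sgS t0 gen.
have NG := N2_ge0 (fun x => (G x)%:C).
apply: (semigroup_propagation (u := coherent) (B := coherent_deriv)) => //.
- by move=> s /andP[sge0 _]; exact: gen.
- move=> s /andP[sge0 st] eps eps0.
  exists (eps / (4 * (N2 (fun x => (G x)%:C) + 1))).
    by rewrite divr_gt0// mulr_gt0// ltr_wpDl.
  move=> h /andP[h0 hd].
  have hp := ltW h0.
  apply: le_trans (N2_le_G (C := 4 * h ^+ 2) _ _ _) _.
  + by rewrite mulr_ge0// sqr_ge0.
  + apply: L2B; first by apply: L2B; exact: gdecay_L2.
    by apply: L2Z; exact: gdecay_L2.
  + by move=> x; exact: coh_taylor.
  + rewrite ltr_pdivlMr in hd; last by rewrite mulr_gt0// ltr_wpDl.
    rewrite expr2 (_ : 4 * (h * h) * _ = (4 * h * N2 (fun x => (G x)%:C)) * h); last by ring.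
    rewrite ler_wpM2r//; move: hd; rewrite mulrDr mulr1 mulrDr; lra.
- move=> s /andP[sge0 st] eps eps0.
  exists (eps / (2 * (N2 (fun x => (G x)%:C) + 1))).
    by rewrite divr_gt0// mulr_gt0// ltr_wpDl.
  move=> r /andP[rd rs] r0.
  have sr : 0 <= s - r by rewrite subr_ge0 ltW.
  apply: le_trans (N2_le_G (C := 2 * (s - r)) _ _ _) _.
  + by rewrite mulr_ge0.
  + by apply: L2B; exact: gdecay_L2.
  + by move=> x; have := coh_lip x r0 sr; rewrite (_ : r + (s - r) = s)//; lra.
  + have hd : s - r < eps / (2 * (N2 (fun x => (G x)%:C) + 1)) by lra.
    rewrite ltr_pdivlMr in hd; last by rewrite mulr_gt0// ltr_wpDl.
    by move: hd; rewrite mulrDr mulr1 mulrDr; lra.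
Qed.

End Path.
End CoherentStates.


(** * The sector of analyticity *)

Section Sector.
Context {R : realType}.
Implicit Types (z w c tau : R[i]).

(** Balls of [R[i]^o] have radii in [R[i]]; a positive radius is real, so neighbourhoods can be
    described with the real modulus. *)
Lemma nbhs_complexP (z : R[i]^o) (B : set R[i]^o) :
  nbhs z B <-> exists2 d : R, 0 < d & forall w : R[i], nrm (z - w) < d -> B w.
Proof.
split.
- move=> /nbhs_ballP[e /= e0 eB].
  have eE : e = (ReC e)%:C by rewrite RRe_real// ger0_real// ltW.
  have e0' : 0 < ReC e by move: e0; rewrite eE ltcR.
  exists (ReC e) => // w zw; apply: eB.
  by rewrite /ball /= eE normc_def -nrmE ltcR.
- move=> [d d0 dB]; apply/nbhs_ballP; exists d%:C; first by rewrite /= ltcR.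
  by move=> w; rewrite /ball /= normc_def -nrmE ltcR; exact: dB.
Qed.

Lemma Re_div_nrm_itv z : -1 <= ReC z / nrm z <= 1.
Proof.
rewrite -ler_norml normrM normfV (ger0_norm (nrm_ge0 z)).
have [->|z0] := eqVneq z 0; first by rewrite nrm0 invr0 mulr0.
by rewrite ler_pdivrMr ?nrm_gt0// mul1r Re_le_nrm.
Qed.

Lemma Carg_itv z : - pi <= Carg z <= pi.
Proof.
have itv := Re_div_nrm_itv z.
have := acos_ge0 itv; have := acos_lepi itv; have := pi_ge0 R.
by rewrite /Carg; case: ifP => _ *; apply/andP; split; lra.
Qed.

Lemma cos_Carg z : z != 0 -> cos (Carg z) = ReC z / nrm z.
Proof.
move=> z0; have nz : 0 < nrm z by rewrite nrm_gt0.
have itv := Re_div_nrm_itv z.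
by rewrite /Carg; case: ifP => _; rewrite ?cosN acosK// in_itv.
Qed.

Lemma sin_Carg z : z != 0 -> sin (Carg z) = ImC z / nrm z.
Proof.
move=> z0; have nz : 0 < nrm z by rewrite nrm_gt0.
have itv := Re_div_nrm_itv z.
have E : Num.sqrt (1 - (ReC z / nrm z) ^+ 2) = `|ImC z| / nrm z.
  rewrite -[X in _ = _ / X](gtr0_norm nz) -normfV -normrM -sqrtr_sqr; congr Num.sqrt.
  rewrite !exprMn exprVn; apply: (@mulIf _ (nrm z ^+ 2)); first by rewrite gt_eqF// exprn_gt0.
  by rewrite mulrBl !mulfVK ?mul1r ?sqr_nrm; [ring|rewrite -sqr_nrm gt_eqF// exprn_gt0..].
rewrite /Carg; case: ifP => [i0|/negbT]; rewrite ?sinN sin_acos// E.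
  by rewrite ger0_norm.
by rewrite -ltNge => i0; rewrite ltr0_norm// mulNr opprK.
Qed.

Lemma complex_polar z : z != 0 -> z = (nrm z)%:C * Cexp (0 +i* Carg z).
Proof.
move=> z0; have nz : nrm z != 0 by rewrite nrm_eq0.
apply: complex_eq.
- by rewrite Re_scale Re_Cexp /= expR0 mul1r cos_Carg// mulrCA divff// mulr1.
- by rewrite Im_scale Im_Cexp /= expR0 mul1r sin_Carg// mulrCA divff// mulr1.
Qed.

Lemma cos_le0_itv (x : R) : pi / 2 <= x <= pi -> cos x <= 0.
Proof.
move=> /andP[x1 x2]; rewrite -[x](subrK (pi / 2)) cosD cos_pihalf mulr0 sub0r sin_pihalf mulr1.
rewrite oppr_le0 sin_ge0_pi//; apply/andP; split; have := pi_ge0 R; lra.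
Qed.

Lemma cos_gt0_pihalf_iff (x : R) : - pi <= x <= pi ->
  (0 < cos x) = (- (pi / 2) < x < pi / 2).
Proof.
move=> /andP[x1 x2]; apply/idP/idP => [c0|]; last exact: cos_gt0_pihalf.
apply/andP; split; rewrite ltNge; apply/negP => H.
- have : cos (- x) <= 0 by apply: cos_le0_itv; apply/andP; split; lra.
  by rewrite cosN leNgt c0.
- have : cos x <= 0 by apply: cos_le0_itv; rewrite H.
  by rewrite leNgt c0.
Qed.

Lemma Re_gt0_Carg z : z != 0 -> (0 < ReC z) = (- (pi / 2) < Carg z < pi / 2).
Proof.
move=> z0; rewrite -cos_gt0_pihalf_iff ?Carg_itv// cos_Carg//.
by rewrite pmulr_lgt0// invr_gt0 nrm_gt0.
Qed.

Lemma Re_mul_Carg z w : z != 0 -> w != 0 ->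
  (0 < ReC (z * w)) = (0 < cos (Carg z + Carg w)).
Proof.
move=> z0 w0; rewrite {1}(complex_polar z0) {1}(complex_polar w0).
rewrite mulrACA -CexpD -rcM Re_scale Re_Cexp /= addr0 expR0 mul1r.
by rewrite pmulr_rgt0// mulr_gt0// nrm_gt0.
Qed.

(** The interior of S_c, written without arguments as an intersection of two open half-planes;
    openness and stability under sums and positive multiples become linear facts. *)
Definition holo_cone c : set R[i]^o := [set z : R[i] | 0 < ReC z /\ 0 < ReC (c * z)].

Lemma Carg_sign c : 0 < ReC c ->
  [/\ 0 < ImC c -> 0 <= Carg c, ImC c < 0 -> Carg c <= 0 & ImC c = 0 -> Carg c = 0].
Proof.
move=> c0; split.
- by rewrite /Carg => /ltW ->; exact: acos_ge0 (Re_div_nrm_itv c).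
- move=> i0; rewrite /Carg ifF; last by apply/negbTE; rewrite -ltNge.
  by rewrite oppr_le0 acos_ge0// Re_div_nrm_itv.
- move=> i0; rewrite /Carg i0 lexx nrmE i0 expr0n addr0 sqrtr_sqr gtr0_norm//.
  by rewrite divff ?gt_eqF// acos1.
Qed.

(** In polar form Re (c z) > 0 means cos (arg z + arg c) > 0. When both arguments lie in ]-pi/2,
    pi/2[ their sum stays in [-pi, pi], so the cosine condition bounds arg z, on a side that depends
    on the sign of Im c. *)
Lemma SsetE c : 0 < ReC c -> Sset c =
  if ImC c == 0 then holo_cone c else closure (holo_cone c) `\ 0.
Proof.
move=> c0; have cn0 : c != 0 by apply/eqP => ce; move: c0; rewrite ce ltxx.
have [sp sn sz] := Carg_sign c0.
have zn0 z : 0 < ReC z -> z != 0 by move=> zr; apply/eqP => ze; move: zr; rewrite ze ltxx.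
have cc := Re_gt0_Carg cn0; rewrite c0 in cc; have /esym/andP[cc1 cc2] := cc.
have pi0 := pi_gt0 R.
have Hp : 0 < ImC c -> sector (- (pi / 2)) (pi / 2 - Carg c) = holo_cone c.
  move=> /sp cp; apply/seteqP; split => z /=.
    move=> [z0 /andP[z1 z2]]; split.
      by rewrite Re_gt0_Carg// z1/=; lra.
    by rewrite Re_mul_Carg// cos_gt0_pihalf//; apply/andP; split; lra.
  move=> [zr zc]; have z0 := zn0 _ zr; split => //.
  have := Re_gt0_Carg z0; rewrite zr => /esym/andP[z1 z2]; rewrite z1/=.
  move: zc; rewrite Re_mul_Carg// cos_gt0_pihalf_iff; last by apply/andP; split; lra.
  by move=> /andP[_]; lra.
have Hn : ImC c < 0 -> sector (- (pi / 2) - Carg c) (pi / 2) = holo_cone c.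
  move=> /sn cp; apply/seteqP; split => z /=.
    move=> [z0 /andP[z1 z2]]; split.
      by rewrite Re_gt0_Carg// z2 andbT; lra.
    by rewrite Re_mul_Carg// cos_gt0_pihalf//; apply/andP; split; lra.
  move=> [zr zc]; have z0 := zn0 _ zr; split => //.
  have := Re_gt0_Carg z0; rewrite zr => /esym/andP[z1 z2]; rewrite z2 andbT.
  move: zc; rewrite Re_mul_Carg// cos_gt0_pihalf_iff; last by apply/andP; split; lra.
  by move=> /andP[+ _]; lra.
have Hz : ImC c = 0 -> sector (- (pi / 2)) (pi / 2) = holo_cone c.
  move=> i0; apply/seteqP; split => z /=.
    move=> [z0 z12]; have zr : 0 < ReC z by rewrite Re_gt0_Carg.
    by split => //; rewrite ReCM i0 mul0r subr0 mulr_gt0.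
  by move=> [zr _]; have z0 := zn0 _ zr; split => //; rewrite -Re_gt0_Carg.
rewrite /Sset; have [i0|i0|i0] := ltgtP 0 (ImC c).
- by rewrite Hp.
- by rewrite Hn.
- by rewrite Hz.
Qed.

Lemma closure_holo_cone c z : closure (holo_cone c) z -> 0 <= ReC z /\ 0 <= ReC (c * z).
Proof.
move=> clz; have main d : 0 < d -> exists2 w, holo_cone c w & nrm (z - w) < d.
  move=> d0; have : nbhs (z : R[i]^o) [set w : R[i]^o | nrm (z - w) < d].
    by apply/nbhs_complexP; exists d.
  by move=> /clz[w [cw zw]]; exists w.
split; rewrite leNgt; apply/negP => H.
- have [w [w1 _] zw] : exists2 w, holo_cone c w & nrm (z - w) < - ReC z by apply: main; lra.
  have := Re_le_nrm (z - w); rewrite ReCD ReCN => h.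
  have := ler_norm (- (ReC z - ReC w)); rewrite normrN; lra.
- have n0 : 0 < nrm c + 1 by rewrite ltr_wpDl ?nrm_ge0.
  have d0 : 0 < - ReC (c * z) / (nrm c + 1) by rewrite divr_gt0//; lra.
  have [w [_ w2] zw] := main _ d0.
  have := Re_le_nrm (c * (z - w)); rewrite nrmM mulrBr ReCD ReCN => h.
  have := ler_norm (- (ReC (c * z) - ReC (c * w))); rewrite normrN => h'.
  have h3 : nrm c * nrm (z - w) <= - ReC (c * z).
    apply: (@le_trans _ _ ((nrm c + 1) * (- ReC (c * z) / (nrm c + 1)))).
      by rewrite ler_pM ?nrm_ge0// ?lerDl// ltW.
    by rewrite mulrCA divff ?mulr1// gt_eqF.
  lra.
Qed.

Lemma SsetP c tau : 0 < ReC c -> Sset c tau ->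
  [/\ tau != 0, 0 <= ReC tau, 0 <= ReC (c * tau) & ImC c = 0 -> 0 < ReC tau].
Proof.
move=> c0; rewrite SsetE//; case: eqP => [i0 [t1 t2]|i0 [clt t0]].
  split => //; [by apply/eqP => te; move: t1; rewrite te ltxx|exact: ltW|exact: ltW].
by have [h1 h2] := closure_holo_cone clt; split => //; exact/eqP.
Qed.

Lemma holo_cone_open c z : holo_cone c z -> nbhs (z : R[i]^o) (holo_cone c).
Proof.
move=> [z1 z2]; have n0 : 0 < nrm c + 1 by rewrite ltr_wpDl ?nrm_ge0.
apply/nbhs_complexP; exists (Num.min (ReC z) (ReC (c * z) / (nrm c + 1))).
  by rewrite lt_min z1 divr_gt0.
move=> w; rewrite lt_min => /andP[w1 w2]; split.
  have := ler_norm (ReC (z - w)); have := Re_le_nrm (z - w).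
  by rewrite ReCD ReCN; lra.
have := Re_le_nrm (c * (z - w)); rewrite nrmM mulrBr ReCD ReCN => h.
have := ler_norm (ReC (c * z) - ReC (c * w)) => h'.
move: w2; rewrite ltr_pdivlMr// mulrDr mulr1 => w2.
have := nrm_ge0 (z - w); move: h; rewrite [nrm c * _]mulrC; lra.
Qed.

Lemma interior_Sset c : 0 < ReC c -> interior (Sset c) = holo_cone c.
Proof.
move=> c0; apply/seteqP; split => z.
- move=> zi; have zS := interior_subset zi.
  have [z0 z1 z2 _] := SsetP c0 zS.
  move: zi => /nbhs_complexP[d d0 dS]; split; rewrite lt_neqAle ?z1 ?z2 andbT; apply/eqP => E.
  + have : Sset c (z - (d / 2)%:C).
      apply: dS; rewrite opprB addrC subrK nrm_real gtr0_norm ?divr_gt0//.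
      by rewrite ltr_pdivrMr// ltr_pMr// ltr1n.
    move=> /(SsetP c0)[_ + _ _]; rewrite ReCD ReCN/= -E sub0r oppr_ge0 leNgt.
    by rewrite divr_gt0.
  + have nc : 0 < nrm c by rewrite nrm_gt0; apply/eqP => ce; move: c0; rewrite ce ltxx.
    have t0 : 0 < d / (2 * nrm c) by rewrite divr_gt0// mulr_gt0.
    (* A displacement against [conjc c] makes Re (c z) strictly smaller, which is impossible inside
       S_c when it is already 0. *)
    have : Sset c (z - (d / (2 * nrm c))%:C * conjc c).
      apply: dS; rewrite opprB addrC subrK nrmM nrm_real gtr0_norm// nrmJ.
      rewrite invfM mulrA mulfVK ?gt_eqF//.
      by rewrite ltr_pdivrMr// ltr_pMr// ltr1n.
    move=> /(SsetP c0)[_ _ + _]; rewrite mulrBr ReCD ReCN -E sub0r oppr_ge0 leNgt.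
    rewrite mulrCA Re_scale pmulr_rgt0// ReCM ReCJ ImCJ mulrN opprK -!expr2 -sqr_nrm.
    by rewrite exprn_gt0.
- move=> zc; have PS : holo_cone c `<=` Sset c.
    rewrite SsetE//; case: eqP => [_|_ w wc]; first exact: subset_refl.
    split.
      by move=> B /nbhs_complexP[d d0 dB]; exists w; split; [exact: wc|apply: dB; rewrite subrr nrm0].
    by move=> we; have [+ _] : holo_cone c w by []; rewrite we ltxx.
  exact: filterS PS (holo_cone_open zc).
Qed.

End Sector.



(** * Rays of a holomorphic semigroup *)

Section Rays.
Context {R : realType}.
Local Notation mu := (@lebesgue_measure R).
Local Notation fct := (R -> R[i]).
Implicit Types (z w c tau : R[i]) (f g : fct) (T : R[i] -> fct -> fct).

Lemma holo_cone_ray c tau (r : R) : holo_cone c tau -> 0 < r -> holo_cone c (r%:C * tau).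
Proof.
by move=> [t1 t2] r0; split; rewrite ?Re_scale ?mulr_gt0// mulrCA Re_scale mulr_gt0.
Qed.

Lemma holo_coneD c z w : holo_cone c z -> holo_cone c w -> holo_cone c (z + w).
Proof. by move=> [z1 z2] [w1 w2]; split; rewrite ?mulrDr ReCD addr_gt0. Qed.

Lemma holo_cone_real c (r : R) : 0 < ReC c -> 0 < r -> holo_cone c r%:C.
Proof. by move=> c0 r0; split => //; rewrite mulrC Re_scale mulr_gt0. Qed.

(** The vertex 0 is not in the open cone, so at time 0 the boundedness and the identity are taken
    from the C0-semigroup on the real axis. *)
Lemma holo_ray_semigroup c A T tau : 0 < ReC c ->
  holomorphic_contraction_semigroup (holo_cone c) A T -> holo_cone c tau ->
  is_semigroup (fun r => T (r%:C * tau)).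
Proof.
move=> c0 [[C0T _] bT Tsg Tc Td] ct.
have [bT0 T0 _ _] := C0T.
have r0 : (0 : R)%:C * tau = 0%:C by rewrite mul0r.
have bS (r : R) : 0 <= r -> bounded_operator (T (r%:C * tau)).
  rewrite le_eqVlt => /orP[/eqP <-|rp]; first by rewrite r0; exact: bT0.
  by have [] := bT _ (holo_cone_ray ct rp).
split => //.
- by move=> f f2; rewrite r0; exact: T0.
- move=> s t f; rewrite le_eqVlt => /orP[/eqP <- t0 f2|sp].
    rewrite add0r r0; have := T0 _ (op_L2 (bS t t0) f2).
    by apply: filterS => x + I => ->.
  rewrite le_eqVlt => /orP[/eqP <- f2|tp f2].
    rewrite addr0 r0; have [_ + _ _] := bS s (ltW sp); apply => //; first exact: op_L2 (bT0 _ _) _.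
    by have := T0 _ f2; apply: filterS => x + I => ->.
  by rewrite rcD mulrDl; apply: Tsg => //; exact: holo_cone_ray.
- move=> f f2 e e0.
  have nH : nbhs (0 : R[i]^o) [set z : R[i]^o | holo_cone c z ->
      (L2norm (fun x => T z f x - f x)%R < e%:E)%E] by exact: cvg_ereal0_lt (Tc f f2) e0.
  have [d d0 dP] := proj1 (nbhs_complexP _ _) nH.
  have nt : 0 < nrm tau by rewrite nrm_gt0; apply/eqP => te; case: ct; rewrite te ltxx.
  exists (d / nrm tau); first exact: divr_gt0.
  move=> t /andP[t0 td]; have ctt := holo_cone_ray ct t0.
  have : (L2norm (fun x => T (t%:C * tau) f x - f x)%R < e%:E)%E.
    apply: dP => //; rewrite sub0r nrmN nrmM nrm_real gtr0_norm//.
    by rewrite -ltr_pdivlMr.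
  rewrite L2norm_fin ?lte_fin//; apply: L2B => //; exact: op_L2 (bS _ (ltW t0)) _.
Qed.

(** The complex derivative of z |-> T z f does not depend on the direction of approach: real
    increments identify it as T z g, and increments along [tau] then give the derivative tau T z g
    of the ray orbit at positive times, which [has_generator_derivative] extends to time 0. *)
Lemma holo_ray_generator c A T tau f g : 0 < ReC c ->
  holomorphic_contraction_semigroup (holo_cone c) A T -> holo_cone c tau ->
  generator (fun t => T t%:C) f g ->
  has_generator (fun r => T (r%:C * tau)) f (fun x => tau * g x).
Proof.
move=> c0 holoT ct [f2 g2 fg]; have sgS := holo_ray_semigroup c0 holoT ct.
have [[C0T _] bT Tsg Tc Td] := holoT.
have nt : 0 < nrm tau by rewrite nrm_gt0; apply/eqP => te; case: ct; rewrite te ltxx.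
apply: has_generator_derivative => //; first exact: L2Z.
move=> s s0 e e0; have cs := holo_cone_ray ct s0; set z := s%:C * tau in cs *.
have bz : bounded_operator (T z) by have [] := bT _ cs.
have cz : forall f, L2 f -> N2 (T z f) <= 1 * N2 f.
  move=> h h2; rewrite mul1r -lee_fin -!L2norm_fin//; last exact: op_L2.
  by have [_] := bT _ cs; apply.
have L2T w h : holo_cone c w -> L2 h -> L2 (T w h).
  by move=> cw; apply: op_L2; have [] := bT _ cw.
have [g' g'2 dT] := Td z f cs f2.
have Tzf := L2T _ _ cs f2; have Tzg := L2T _ _ cs g2.
have near0 eps : 0 < eps -> exists2 d : R, 0 < d & forall w, holo_cone c w ->
    nrm w < d -> N2 (fun x => w^-1 * (T (z + w) f x - T z f x) - g' x) < eps.
  move=> eps0; have nH : nbhs (0 : R[i]^o) [set w : R[i]^o | w != 0 ->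
      (L2norm (fun x => (w : R[i])^-1 * (T (z + (w : R[i])) f x - T z f x) - g' x)%R < eps%:E)%E] by exact: cvg_ereal0_lt dT eps0.
  have [d d0 dP] := proj1 (nbhs_complexP _ _) nH.
  exists d => // w cw wd; rewrite -lte_fin -L2norm_fin.
    apply: dP; first by rewrite sub0r nrmN.
    by apply/eqP => w0; case: cw; rewrite w0 ltxx.
  by apply: L2B => //; apply: L2Z; apply: L2B => //; apply: L2T => //; exact: holo_coneD.
(* For real h, T (z + h) f - T z f = T z (T h f - f), and the contraction [T z] preserves the
   convergence of the quotient (T h f - f) / h to [g]. *)
have g'E : ae_eq mu setT g' (T z g).
  apply: L2dist_eq0 => //; apply/eqP; rewrite eq_le L2dist_ge0 andbT.
  apply/ler_addgt0Pl => eps eps0; rewrite addr0.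
  have eps2 : 0 < eps / 2 by rewrite divr_gt0.
  have [d1 d10 dP1] := near0 _ eps2.
  have [d2 d20 dP2] := at_right0P (cvg_ereal0_lt fg eps2).
  pose h := Num.min d1 d2 / 2.
  have m0 : 0 < Num.min d1 d2 by rewrite lt_min d10.
  have h0 : 0 < h by rewrite divr_gt0.
  have hm : h < Num.min d1 d2 by rewrite ltr_pdivrMr// ltr_pMr// ltr1n.
  move: hm; rewrite lt_min => /andP[hd1 hd2].
  have ch := holo_cone_real c0 h0.
  have Thf := L2T _ _ ch f2.
  pose D := fun x => (h%:C)^-1 * (T (z + h%:C) f x - T z f x).
  pose D0 := fun x => (h^-1)%:C * (T h%:C f x - f x).
  have D02 : L2 D0 by apply/L2Z/L2B.
  have D2 : L2 D by apply/L2Z/L2B => //; apply: L2T => //; exact: holo_coneD.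
  have DE : ae_eq mu setT D (T z D0).
    have e1 := Tsg z h%:C f cs ch f2.
    have e2 := opZ (h^-1)%:C bz (L2B Thf f2).
    have e3 := opB bz Thf f2.
    apply: filterS3 e1 e2 e3 => x e1 e2 e3 I.
    by rewrite /D0 e2// e3// /D e1// fmorphV.
  have a1 : L2dist g' D <= eps / 2.
    rewrite L2distC//; apply/ltW/dP1 => //.
    by rewrite nrm_real gtr0_norm.
  have a2 : L2dist D (T z g) <= eps / 2.
    rewrite (L2dist_ae D2 (op_L2 bz D02) Tzg Tzg DE); last exact: ae_eq_refl.
    apply: le_trans (op_dist bz cz D02 g2) _; rewrite mul1r.
    apply: ltW; rewrite -lte_fin -L2norm_fin; last exact: L2B.
    by apply: dP2; rewrite h0.
  have := L2dist_triangle g'2 D2 Tzg; lra.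
have en : 0 < e / nrm tau by rewrite divr_gt0.
have [d d0 dP] := near0 _ en; exists (d / nrm tau); first exact: divr_gt0.
move=> k /andP[k0 kd]; have ck := holo_cone_ray ct k0; set w := k%:C * tau in ck *.
have w0 : w != 0 by apply/eqP => we; case: ck; rewrite we ltxx.
have nw : nrm w = k * nrm tau by rewrite nrmM nrm_real gtr0_norm.
have Tzw := L2T _ _ (holo_coneD cs ck) f2.
rewrite rcD mulrDl -/z -/w.
have D2 : L2 (fun x => w^-1 * (T (z + w) f x - T z f x) - g' x).
  by apply: L2B => //; apply/L2Z/L2B.
have -> : N2 (fun x => T (z + w) f x - T z f x - k%:C * T z (fun x => tau * g x) x) =
    N2 (fun x => w * (w^-1 * (T (z + w) f x - T z f x) - g' x)).
  apply: N2_ae.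
  - apply: CmeasB; first by apply: CmeasB; exact: L2_meas.
    by apply/CmeasZ/L2_meas/op_L2 => //; exact: L2Z.
  - exact/L2_meas/L2Z.
  - apply: filterS2 g'E (opZ tau bz g2) => x e1 e2 I.
    by rewrite e2// e1// [RHS]mulrBr mulVKf// mulrA.
rewrite N2Z// nw.
have : nrm w < d by rewrite nw -ltr_pdivlMr.
move=> /(dP _ ck)/ltW H; apply: le_trans (ler_wpM2l _ H) _.
  by rewrite mulr_ge0// ltW.
by rewrite mulrCA -mulrA mulfV ?gt_eqF// mulr1 mulrC.
Qed.

End Rays.



(** * The Mehler kernel *)

Section RealBounds.
Context {R : realType}.

Lemma abs_sin_le (t : R) : `|sin t| <= `|t|.
Proof.
wlog t0 : t / 0 <= t => [H|].
  have [/H//|t0] := leP 0 t.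
  by rewrite -normrN -sinN -[leRHS]normrN; apply: H; rewrite oppr_ge0 ltW.
have [s _] : exists2 s, s \in `[0, t] & sin t - sin 0 = cos s * (t - 0).
  apply: MVT_segment => //.
  by apply: continuous_subspaceT => x; exact: continuous_sin.
rewrite sin0 !subr0 => ->; rewrite normrM ler_piMl//; exact: cos_max.
Qed.

(** That is, sinh t > t. The strictness keeps Re w2 positive on the edges of S_c, where the estimate
    for q tau may be an equality. *)
Lemma lt_sinh (t : R) : 0 < t -> 2 * t < expR t - expR (- t).
Proof.
move=> t0.
have [s] : exists2 s, s \in `]0, t[ &
    (expR t - expR (- t) - 2 * t) - (expR 0 - expR (- 0) - 2 * 0) =
    (expR s + expR (- s) - 2) * (t - 0).
  pose F (x : R) : R := expR x - expR (- x) - 2 * x.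
  have D (x : R) : is_derive x 1 F (expR x + expR (- x) - 2).
    by apply: is_derive_eq; rewrite /GRing.scale/=; ring.
  apply: (@MVT R F (fun x => expR x + expR (- x) - 2) 0 t t0 (fun x _ => D x)).
  by apply: continuous_subspaceT => x; exact: is_derive_continuous (D x).
rewrite in_itv/= => /andP[s0 _]; rewrite oppr0 mulr0 !subr0 subrr subr0 => E.
have s1 : 1 + s < expR s by rewrite expR_gt1Dx// gt_eqF.
have s2 : 1 + - s < expR (- s) by rewrite expR_gt1Dx// oppr_eq0 gt_eqF.
by rewrite -subr_gt0 E mulr_gt0//; lra.
Qed.

End RealBounds.

(** * Principal powers *)

Section PrincipalPowers.
Context {R : realType}.
Implicit Types (z c : R[i]) (a : R).

Lemma nrm_Cpow z a : nrm (Cpow z a) = nrm z `^ a.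
Proof. by rewrite nrmM nrm_Cexp expR0 mulr1 nrm_real ger0_norm// powR_ge0. Qed.

Lemma CpowD z a b : z != 0 -> Cpow z (a + b) = Cpow z a * Cpow z b.
Proof.
move=> z0; rewrite /Cpow powRD; last by rewrite nrm_eq0 z0 implybT.
rewrite rcM [RHS]mulrACA -CexpD; congr (_ * Cexp _).
by apply: complex_eq; rewrite ?ReCD ?ImCD /= ?addr0// mulrDl.
Qed.

Lemma Cpow1 z : z != 0 -> Cpow z 1 = z.
Proof. by move=> z0; rewrite [RHS]complex_polar// /Cpow powRr1 ?nrm_ge0// mul1r. Qed.

Lemma CpowN z a : z != 0 -> Cpow z (- a) = (Cpow z a)^-1.
Proof.
move=> z0; apply: (@mulIf _ (Cpow z a)).
  by rewrite -nrm_eq0 nrm_Cpow gt_eqF// powR_gt0// nrm_gt0.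
rewrite -CpowD// addNr /Cpow powRr0 mul0r mul1r (_ : 0 +i* 0 = 0)// Cexp0 mulVf//.
by rewrite mulf_neq0 ?Cexp_neq0//; apply/eqP => -[/eqP]; rewrite gt_eqF// powR_gt0// nrm_gt0.
Qed.

Lemma Carg_lt_pihalf z : 0 < ReC z -> `|Carg z| < pi / 2.
Proof.
move=> zr; have z0 : z != 0 by apply/eqP => ze; move: zr; rewrite ze ltxx.
by move: zr; rewrite Re_gt0_Carg// ltr_norml.
Qed.

(* The argument of the product is [a arg z + b arg w]. *)
Lemma Re_CpowM z w a b : 0 < ReC z -> 0 < ReC w -> `|a| + `|b| <= 1 ->
  0 < ReC (Cpow z a * Cpow w b).
Proof.
move=> zr wr ab.
have nz : 0 < nrm z by rewrite nrm_gt0; apply/eqP => ze; move: zr; rewrite ze ltxx.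
have nw : 0 < nrm w by rewrite nrm_gt0; apply/eqP => ze; move: wr; rewrite ze ltxx.
rewrite /Cpow mulrACA -rcM -CexpD Re_scale mulr_gt0//; first by rewrite mulr_gt0// powR_gt0.
rewrite Re_Cexp /= addr0 expR0 mul1r cos_gt0_pihalf// -ltr_norml.
apply: le_lt_trans (ler_normD _ _) _; rewrite !normrM.
have zp := Carg_lt_pihalf zr; have wp := Carg_lt_pihalf wr.
have [ab0|ab0] := eqVneq (`|a| + `|b|) 0.
  have a0 : `|a| = 0 by have := normr_ge0 a; have := normr_ge0 b; lra.
  have b0 : `|b| = 0 by lra.
  by rewrite a0 b0 !mul0r addr0 divr_gt0// pi_gt0.
apply: (@lt_le_trans _ _ ((`|a| + `|b|) * (pi / 2))); last first.
  by rewrite ler_piMl// divr_ge0// pi_ge0.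
rewrite mulrDl; have [a0|a0] := eqVneq a 0.
  have b0 : 0 < `|b| by rewrite lt_neqAle normr_ge0 andbT eq_sym; move: ab0; rewrite a0 normr0 add0r.
  by rewrite a0 normr0 !mul0r !add0r ltr_pM2l.
by apply: ltr_leD; [rewrite ltr_pM2l// normr_gt0|rewrite ler_wpM2l// ltW].
Qed.

Lemma Re_Cpow z a : 0 < ReC z -> `|a| <= 1 -> 0 < ReC (Cpow z a).
Proof.
move=> zr a1; rewrite -[Cpow z a]mulr1.
have -> : 1 = Cpow (1 : R[i]) 0 by rewrite /Cpow powRr0 mul0r mul1r (_ : 0 +i* 0 = 0)// Cexp0.
by apply: Re_CpowM => //=; rewrite normr0 addr0.
Qed.

End PrincipalPowers.

(** * Decay of the Mehler kernel and its action on Gaussians *)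

Section KernelAlgebra.
Context {R : realType}.
Local Notation mu := (@lebesgue_measure R).
Implicit Types (c tau z : R[i]).

(** With z = q tau, both |q|^2 Re tau = Re q Re z + Im q Im z and Re (c tau) = Re q Re z - Im q Im z
    are nonnegative, which is the inequality. If Re z were 0, then either z = 0, excluded by tau !=
    0, or q is real, and then Re tau > 0. *)
Lemma Sset_sqrt c q tau : 0 < ReC q -> q ^+ 2 = c -> 0 < ReC c -> Sset c tau ->
  0 < ReC (q * tau) /\ `|ImC q * ImC (q * tau)| <= ReC q * ReC (q * tau).
Proof.
move=> q0 qc c0 /(SsetP c0)[tau0 t1 t2 t3].
have nq : 0 < ReC q ^+ 2 + ImC q ^+ 2.
  by rewrite ltr_wpDr ?sqr_ge0// exprn_gt0.
set z := q * tau.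
have E1 : (ReC q ^+ 2 + ImC q ^+ 2) * ReC tau = ReC q * ReC z + ImC q * ImC z.
  by rewrite /z ReCM ImCM; ring.
have E2 : ReC (c * tau) = ReC q * ReC z - ImC q * ImC z.
  by rewrite -qc expr2 -mulrA -/z ReCM.
have h1 : 0 <= ReC q * ReC z + ImC q * ImC z by rewrite -E1 mulr_ge0// ltW.
have h2 : `|ImC q * ImC z| <= ReC q * ReC z by rewrite ler_norml; apply/andP; split; lra.
split => //; have : 0 <= ReC q * ReC z by exact: le_trans h2.
rewrite pmulr_rge0// le_eqVlt => /orP[/eqP zr|//].
move: h2; rewrite -zr mulr0 normr_le0 mulf_eq0 => /orP[/eqP b0|/eqP zi].
- have : 0 < ReC tau by apply: t3; rewrite -qc expr2 ImCM b0 mulr0 mul0r addr0.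
  by move=> tr; have := mulr_gt0 nq tr; rewrite E1 -zr b0 mulr0 mul0r addr0 ltxx.
- have : z = 0 by apply: complex_eq; rewrite /= ?zi -?zr.
  move=> /eqP; rewrite mulf_eq0 (negbTE tau0) orbF => /eqP qe.
  by move: q0; rewrite qe ltxx.
Qed.

(** Multiplying through by the conjugate of 1 - m, the sign is that of Re q (1 - |m|^2) - 2 Im q Im
    m. With |m| = exp(-X), X = 4 Re z, the first term exceeds 2 X exp(-X) Re q by [lt_sinh], and
    |sin t| <= |t| bounds the second by the same quantity. *)
Lemma Re_w2_gt0 q z : 0 < ReC q -> 0 < ReC z ->
  `|ImC q * ImC z| <= ReC q * ReC z ->
  forall m, m = Cexp (- (4 * z)) -> 0 < ReC (q * (1 + m) / (2 * (1 - m))).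
Proof.
move=> q0 z0 qz m mE.
have Rz : ReC (- (4 * z)) = - (4 * ReC z).
  by rewrite ReCN (_ : 4 = (4 : R)%:C) ?Re_scale// rmorph_nat.
have Iz : ImC (- (4 * z)) = - (4 * ImC z).
  by rewrite ImCN (_ : 4 = (4 : R)%:C) ?Im_scale// rmorph_nat.
set X := 4 * ReC z in Rz.
have X0 : 0 < X by rewrite mulr_gt0.
have r1 : nrm m < 1 by rewrite mE nrm_Cexp Rz expR_lt1 oppr_lt0.
have m1 : 1 - m != 0.
  by apply/eqP => /eqP; rewrite subr_eq0 => /eqP me; move: r1; rewrite -me (_ : nrm 1 = 1) ?ltxx//; exact: Normc.normc1.
have nm : 0 < nrm (1 - m) ^+ 2 by rewrite exprn_gt0// nrm_gt0.
have key : ReC (q * (1 + m) * conjc (1 - m)) =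
    ReC q * (1 - expR (- X) ^+ 2) + 2 * expR (- X) * (ImC q * sin (4 * ImC z)).
  have cd := cos2Dsin2 (- (4 * ImC z)).
  have hR : ReC m = expR (- X) * cos (- (4 * ImC z)) by rewrite mE Re_Cexp Rz Iz.
  have hI : ImC m = expR (- X) * sin (- (4 * ImC z)) by rewrite mE Im_Cexp Rz Iz.
  rewrite !(ReCM, ImCM, ReCJ, ImCJ, ReCD, ImCD, ReCN, ImCN) hR hI /=.
  rewrite -[sin (4 * _)]opprK -sinN.
  set C := cos _ in cd *; set S := sin _ in cd *; set r := expR _.
  have -> : r ^+ 2 = r ^+ 2 * (C ^+ 2 + S ^+ 2) by rewrite cd mulr1.
  ring.
have kpos : 0 < ReC (q * (1 + m) * conjc (1 - m)).
  rewrite key; set r := expR (- X).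
  have r0 : 0 < r by exact: expR_gt0.
  have sh : 2 * r * X < 1 - r ^+ 2.
    have := lt_sinh X0; rewrite -(ltr_pM2l r0) mulrBr -expRD addNr expR0 -/r -expr2.
    by rewrite mulrCA mulrA.
  have sb : `|ImC q * sin (4 * ImC z)| <= ReC q * X.
    rewrite normrM; apply: (@le_trans _ _ (`|ImC q| * `|4 * ImC z|)).
      by rewrite ler_wpM2l// abs_sin_le.
    rewrite [`|4 * _|]normrM ger0_norm// mulrCA -normrM /X [ReC q * _]mulrCA.
    by rewrite ler_pM2l.
  have a1 : - (2 * r * (ReC q * X)) <= 2 * r * (ImC q * sin (4 * ImC z)).
    rewrite -mulrN ler_wpM2l ?mulr_ge0 ?(ltW r0)//.
    by move: sb; rewrite ler_norml => /andP[].
  have a2 : ReC q * (2 * r * X) < ReC q * (1 - r ^+ 2) by rewrite ltr_pM2l.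
  by move: a1 a2; rewrite mulrCA; lra.
have -> : q * (1 + m) / (2 * (1 - m)) =
    ((2 * nrm (1 - m) ^+ 2)^-1)%:C * (q * (1 + m) * conjc (1 - m)).
  have nE : ((nrm (1 - m)) ^+ 2)%:C = (1 - m) * conjc (1 - m).
    apply: complex_eq; first by rewrite /= sqr_nrm !(ReCM, ImCM, ReCJ, ImCJ) ; ring.
    by rewrite /= !(ReCM, ImCM, ReCJ, ImCJ); ring.
  rewrite fmorphV rmorphM/= nE rmorph_nat; have cm : conjc (1 - m) != 0 by rewrite -nrm_eq0 nrmJ nrm_eq0.
  by move: (conjc (1 - m)) cm => cj cm; field; rewrite m1 cm.
by rewrite Re_scale mulr_gt0// invr_gt0 mulr_gt0.
Qed.

Section MehlerKernel.
Variables (c tau : R[i]).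
Hypotheses (c0 : 0 < ReC c) (ctau : Sset c tau).

Let q := Cpow c 2^-1.
Let lam := Cexp (- (2 * q * tau)).

Let w2 := q * (1 + lam ^+ 2) / (2 * (1 - lam ^+ 2)).
Let w3 := 2 * q * lam / (1 - lam ^+ 2).
Let q14 := Cpow c 4^-1.
Let v := Cpow (pi%:C * (1 - lam ^+ 2)) (- 2^-1).

Let c_neq0 : c != 0. Proof. by apply/eqP => ce; move: c0; rewrite ce ltxx. Qed.

Lemma Re_sqrt_gt0 : 0 < ReC q.
Proof. by apply: Re_Cpow => //; rewrite ger0_norm ?invr_ge0// invf_le1// ler1n. Qed.

Let q_neq0 : q != 0. Proof. by apply/eqP => qe; have := Re_sqrt_gt0; rewrite qe ltxx. Qed.

Lemma sqrt_sqr : q ^+ 2 = c.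
Proof. by rewrite expr2 -CpowD// (_ : 2^-1 + 2^-1 = 1) ?Cpow1//; field. Qed.

Lemma Re_sqrt_tau : 0 < ReC (q * tau).
Proof. by have [] := Sset_sqrt Re_sqrt_gt0 sqrt_sqr c0 ctau. Qed.

Let lamX : lam ^+ 2 = Cexp (- (4 * (q * tau))).
Proof. by rewrite /lam -CexpX; congr Cexp; ring. Qed.

Let Re_lamX : 0 < ReC (1 - lam ^+ 2).
Proof.
have : nrm (lam ^+ 2) < 1.
  rewrite lamX nrm_Cexp expR_lt1 ReCN oppr_lt0 (_ : 4 = (4 : R)%:C); last by rewrite rmorph_nat.
  by rewrite Re_scale mulr_gt0// Re_sqrt_tau.
by have := Re_le_nrm (lam ^+ 2); rewrite ReCD ReCN /= ler_norml => /andP[_]; lra.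
Qed.

Let lamX_neq0 : 1 - lam ^+ 2 != 0.
Proof. by apply/eqP => le; have := Re_lamX; rewrite le ltxx. Qed.

Let Re_w2 : 0 < ReC w2.
Proof.
have [h1 h2] := Sset_sqrt Re_sqrt_gt0 sqrt_sqr c0 ctau.
by apply: Re_w2_gt0 h1 h2 _ lamX; exact: Re_sqrt_gt0.
Qed.

Let Re_p : 0 < ReC (w2 + q / 2).
Proof. by rewrite ReCD addr_gt0// Re_half divr_gt0// Re_sqrt_gt0. Qed.

Let kernelE x : mehler_kernel c tau x = fun y =>
  q14 * Cexp (- (q * tau)) * v * gauss w2 (w3 * x%:C) (- (w2 * (x ^+ 2)%:C)) y.
Proof.
apply/funext => y; rewrite /mehler_kernel -/q -/lam -/w2 -/w3 -/q14 -/v /gauss.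
by congr (_ * Cexp _); rewrite rcM rcD; ring.
Qed.

Lemma mehler_kernel_gdecay x : gdecay (mehler_kernel c tau x).
Proof. by rewrite kernelE; apply/gdecayZ/gdecay_gauss. Qed.

(** In y the exponents combine to the quadratic coefficient w2 + q / 2 = q / (1 - lambda^2). The
    prefactor w1 contains exactly its square root [q1] divided by sqrt pi, so the affine Gaussian
    integral leaves a pure exponential. *)
Lemma mehler_kernel_coherent s x :
  Cintegral (fun y => mehler_kernel c tau x y * gauss (q / 2) s 0 y) =
  gauss (q / 2) (s * lam) (- (q * tau) + s ^+ 2 * (1 - lam ^+ 2) / (4 * q)) x.
Proof.
pose sp : R[i] := (Num.sqrt (pi : R))%:C.
have sp2 : sp ^+ 2 = pi%:C by rewrite /sp -rmorphXn/= sqr_sqrtr// pi_ge0.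
have pi_neq0 : (pi : R)%:C != 0 by rewrite -nrm_eq0 nrm_real normr_eq0 gt_eqF// pi_gt0.
have sp0 : sp != 0 by apply/eqP => e; move: pi_neq0; rewrite -sp2 e expr0n eqxx.
(* Built from the same principal branches as w1. Its argument is below pi/8 + pi/4 in modulus, hence
   Re q1 > 0 and the right square root is selected. *)
pose q1 := sp * (q14 * v).
have q14q : q14 ^+ 2 = q.
  by rewrite expr2 -CpowD// /q; congr Cpow; field.
have vv : v ^+ 2 = (pi%:C * (1 - lam ^+ 2))^-1.
  have w0 : pi%:C * (1 - lam ^+ 2) != 0 by rewrite mulf_neq0.
  by rewrite expr2 -CpowD// -opprD (_ : 2^-1 + 2^-1 = 1) ?CpowN ?Cpow1//; field.
have q1q : q1 ^+ 2 = q / (1 - lam ^+ 2).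
  rewrite /q1 exprMn [(q14 * v) ^+ 2]exprMn sp2 q14q vv.
  by move: (pi%:C) pi_neq0 => p p_neq0; field; rewrite p_neq0 lamX_neq0.
have q1w : q1 ^+ 2 = w2 + q / 2 by rewrite q1q /w2; field.
have q1p : 0 < ReC q1.
  rewrite Re_scale mulr_gt0 ?sqrtr_gt0 ?pi_gt0//; apply: Re_CpowM => //.
    by rewrite Re_scale mulr_gt0// pi_gt0.
  by rewrite normrN !ger0_norm// -lerBrDr; lra.
have q1_neq0 : q1 != 0 by apply/eqP => e; move: q1p; rewrite e ltxx.
(* Re (q1^2) > 0 gives |Im q1| < |Re q1|, and Re q1 > 0 removes the modulus. *)
have q1c : `|ImC q1| < ReC q1.
  have : 0 < ReC (q1 ^+ 2) by rewrite q1w.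
  rewrite expr2 ReCM subr_gt0 -!expr2 -[X in X < _]real_normK ?num_real//.
  by rewrite ltr_pXn2r ?nnegrE// ltW.
pose m1 := (w3 * x%:C + s) / (2 * q1).
have m1E : 2 * q1 * m1 = w3 * x%:C + s by rewrite /m1; field.
have int1 : Cintegrable (fun y : R => q1 * Cexp (- (q1 * y%:C - m1) ^+ 2)).
  apply: gdecay_Cintegrable; apply: gdecayZ.
  rewrite (_ : (fun _ => _) = gauss (q1 ^+ 2) (2 * q1 * m1) (- m1 ^+ 2)).
    by apply: gdecay_gauss; rewrite q1w.
  by apply/funext => y; rewrite /gauss rmorphXn/=; congr Cexp; ring.
rewrite kernelE.
pose K0 := sp^-1 * Cexp (- (q * tau) + m1 ^+ 2 - w2 * (x ^+ 2)%:C).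
have -> : (fun y => q14 * Cexp (- (q * tau)) * v *
      gauss w2 (w3 * x%:C) (- (w2 * (x ^+ 2)%:C)) y * gauss (q / 2) s 0 y) =
    fun y => K0 * (q1 * Cexp (- (q1 * y%:C - m1) ^+ 2)).
  apply/funext => y.
  have -> : q14 * Cexp (- (q * tau)) * v * gauss w2 (w3 * x%:C) (- (w2 * (x ^+ 2)%:C)) y *
      gauss (q / 2) s 0 y =
      q14 * v * (Cexp (- (q * tau)) * (gauss w2 (w3 * x%:C) (- (w2 * (x ^+ 2)%:C)) y *
      gauss (q / 2) s 0 y)) by ring.
  have -> : K0 * (q1 * Cexp (- (q1 * y%:C - m1) ^+ 2)) =
      q14 * v * (Cexp (- (q * tau) + m1 ^+ 2 - w2 * (x ^+ 2)%:C) *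
        Cexp (- (q1 * y%:C - m1) ^+ 2)) by rewrite /K0 /q1; field.
  rewrite /gauss -!CexpD; congr (_ * Cexp _).
  have -> : (q1 * y%:C - m1) ^+ 2 = q1 ^+ 2 * y%:C ^+ 2 - (2 * q1 * m1) * y%:C + m1 ^+ 2 by ring.
  by rewrite m1E q1w rmorphXn/=; ring.
rewrite CintegralZ// integral_gauss_affine// mulrC mulrA mulfV// mul1r /gauss; congr Cexp.
have -> : m1 ^+ 2 = (w3 * x%:C + s) ^+ 2 / (4 * q1 ^+ 2) by rewrite -m1E; field.
by rewrite q1q /w2 /w3 rmorphXn/=; field; rewrite q_neq0.
Qed.

End MehlerKernel.
End KernelAlgebra.



(** * Agreement of the semigroup and the kernel on Gaussians *)

Section ExpOscillator.
Context {R : realType}.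
Local Notation mu := (@lebesgue_measure R).
Implicit Types (c q e s tau : R[i]) (E : (R -> R[i]) -> R -> R[i]).

Lemma coherent0 q e s : coherent q e s 0 = gauss (q / 2) s 0.
Proof.
by rewrite /coherent /coh_sigma /coh_kappa /coh_lambda !mulr0 oppr0 Cexp0 expr1n
  subrr mulr0 mul0r addr0 mulr1.
Qed.

Lemma coherentE q e s (r : R) (lam := Cexp (- (2 * q * (r%:C * e)))) :
  coherent q e s r =
  gauss (q / 2) (s * lam) (- (q * (r%:C * e)) + s ^+ 2 * (1 - lam ^+ 2) / (4 * q)).
Proof.
rewrite /coherent /coh_sigma /coh_kappa /coh_lambda.
rewrite (_ : 2 * q * e * r%:C = 2 * q * (r%:C * e)); last by ring.
by rewrite (_ : q * e * r%:C = q * (r%:C * e)); last by ring.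
Qed.

Lemma Hop_coherent c q e s (r : R) : 0 < ReC q -> q ^+ 2 = c ->
  exists2 h, Hop c (coherent q e s r) h &
    coherent_deriv q e s r = fun x => - e * h x.
Proof.
move=> q0 qc; have b0 : 0 < ReC (q / 2) by rewrite Re_half divr_gt0.
have bc : 4 * (q / 2) ^+ 2 = c by rewrite -qc; field.
eexists; first exact: Hop_gauss.
apply/funext => x; rewrite /coherent_deriv /coherent_rate [RHS]mulrA; congr (_ * _).
by congr (_ * _); field.
Qed.

Lemma exp_oscillator_coherent c tau E : 0 < ReC c -> Sset c tau ->
  is_exp_oscillator c tau E -> bounded_operator E /\
  forall s, ae_eq mu setT (E (gauss (Cpow c 2^-1 / 2) s 0))
    (fun x => Cintegral (fun y =>
       mehler_kernel c tau x y * gauss (Cpow c 2^-1 / 2) s 0 y)).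
Proof.
move=> c0 ctau; set q := Cpow c 2^-1.
have q0 : 0 < ReC q := Re_sqrt_gt0 c0; have qc : q ^+ 2 = c := sqrt_sqr c0.
have qt : 0 < ReC (q * tau) := Re_sqrt_tau c0 ctau.
pose lam := Cexp (- (2 * q * tau)).
have KE s : (fun x => Cintegral (fun y => mehler_kernel c tau x y * gauss (q / 2) s 0 y)) =
    gauss (q / 2) (s * lam) (- (q * tau) + s ^+ 2 * (1 - lam ^+ 2) / (4 * q)).
  by apply/funext => x; exact: mehler_kernel_coherent.
move=> [[]|[]].
- rewrite interior_Sset// => ctau' [T holoT ->].
  have [[_ AT] bT _ _ _] := holoT; split; first by have [] := bT _ ctau'.
  move=> s; have sgS := holo_ray_semigroup c0 holoT ctau'.
  (* Interior case: the direction is [tau] itself and the time is 1. *)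
  have := coherent_propagation q0 (ltW qt) sgS ler01 (s0 := s).
  rewrite coherent0 coherentE rmorph1 !mul1r.
  move=> H; have {}H := H _; rewrite KE.
  apply: H => r r0; have [h Hh dE] := Hop_coherent tau s r q0 qc.
  have /AT gen : scale_operator (-1) (Hop c) (coherent q tau s r) (fun x => -1 * h x).
    by exists h.
  have := holo_ray_generator c0 holoT ctau' gen; rewrite dE.
  by congr has_generator; apply/funext => x; rewrite mulrA mulrN1.
- move=> _ [t [theta [T [t0 tauE [C0T AT] ->]]]].
  have sgT := C0_semigroup_is C0T; have [bT _ _ _] := C0T.
  split; first by apply: bT; exact: ltW.
  set e := Cexp (0 +i* theta) in tauE AT *.
  have qe : 0 <= ReC (q * e).
    move: qt; rewrite tauE mulrCA Re_scale pmulr_rgt0//; exact: ltW.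
  (* Edge case: the direction is the unit vector [e] and the time is the modulus [t]. *)
  move=> s; have := coherent_propagation q0 qe sgT (ltW t0) (s0 := s).
  rewrite coherent0 coherentE -tauE.
  move=> H; have {}H := H _; rewrite KE.
  apply: H => r r0; have [h Hh dE] := Hop_coherent e s r q0 qc.
  by apply: (generator_has bT); apply/AT; exists h.
Qed.

End ExpOscillator.



(** * From Gaussians to L^2 *)

Section SineSteps.
Context {R : realType}.
Implicit Types (s t x : R).

(** Together with [bernoulli_ge], this reduces the limit of (1 - s)^n to that of n s: the power
    tends to 1 when n s tends to 0, and to 0 when n s tends to infinity. *)
Lemma bernoulli_le s n : 0 <= s <= 1 -> 1 - n%:R * s <= (1 - s) ^+ n.
Proof.
move=> /andP[s0 s1]; elim: n => [|n IH]; first by rewrite mul0r subr0 expr0.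
have s1' : 0 <= 1 - s by rewrite subr_ge0.
rewrite exprS; apply: le_trans (ler_wpM2l s1' IH).
have : 0 <= n%:R * s * s by rewrite !mulr_ge0.
by rewrite -natr1; lra.
Qed.

Lemma bernoulli_ge s n : 0 <= s <= 1 -> (1 - s) ^+ n * (1 + n%:R * s) <= 1.
Proof.
move=> /andP[s0 s1]; elim: n => [|n IH]; first by rewrite mul0r addr0 expr0 mulr1.
have s1' : 0 <= 1 - s by rewrite subr_ge0.
apply: le_trans IH; rewrite exprS mulrAC [leRHS]mulrC ler_wpM2r ?exprn_ge0//.
have : 0 <= n%:R * s * s by rewrite !mulr_ge0.
have : 0 <= s * s by rewrite mulr_ge0.
by rewrite -natr1; lra.
Qed.

(** Each of the n terms of the geometric sum is at least s^n, and the sum times 1 - s is 1 - s^n. *)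
Lemma geometric_le s n : 0 <= s < 1 -> n%:R * s ^+ n * (1 - s) <= 1.
Proof.
move=> /andP[s0 s1]; have : 1 - s ^+ n = (1 - s) * (\sum_(i < n) s ^+ i).
  by rewrite -opprB subrX1 -mulNr opprB.
move=> E; apply: (@le_trans _ _ (1 - s ^+ n)); last by rewrite gerBl exprn_ge0.
rewrite E mulrC ler_wpM2l ?subr_ge0 ?(ltW s1)//.
rewrite -[n in n%:R]card_ord -sum1_card natr_sum mulr_suml ler_sum// => i _.
by rewrite mul1r ler_wiXn2l// ?(ltW s1)// ltnW.
Qed.

(** The mean value theorem for the sine, with cos u = 1 - 2 sin^2(u/2) >= 1 - t^2/2. *)
Lemma abs_sin_ge t : `|t| * (1 - t ^+ 2 / 2) <= `|sin t|.
Proof.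
wlog t0 : t / 0 <= t => [H|].
  have [/H//|t0] := leP 0 t.
  by have := H (- t); rewrite oppr_ge0 sinN !normrN sqrrN; apply; exact: ltW.
have [u] : exists2 u, u \in `[0, t] & sin t - sin 0 = cos u * (t - 0).
  by apply: MVT_segment => //; apply: continuous_subspaceT => x; exact: continuous_sin.
rewrite in_itv/= => /andP[u0 ut]; rewrite sin0 !subr0 => E.
apply: le_trans (ler_norm (sin t)); rewrite E ger0_norm// mulrC ler_wpM2r//.
have -> : cos u = 1 - 2 * sin (u / 2) ^+ 2.
  by rewrite {1}[u]splitr cosD -!expr2 cos2sin2; lra.
have h : sin (u / 2) ^+ 2 <= (t / 2) ^+ 2.
  rewrite -real_normK ?num_real// -[leRHS]real_normK ?num_real//.
  rewrite ler_pXn2r ?nnegrE//; apply: le_trans (abs_sin_le _) _.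
  by rewrite !ger0_norm ?divr_ge0// ?ler_pM2r//; exact: le_trans ut.
by move: h; rewrite expr_div_n; lra.
Qed.

Lemma sin_sqr_le1 t : sin t ^+ 2 <= 1.
Proof. by rewrite sin2cos2 gerBl sqr_ge0. Qed.

(** Let K = k + 1 and r = |y| / l. The outer exponent times the power of the sine behaves like K
    r^(2K), which tends to 0 for r < 1 and to infinity for r >= 1. The slope 1/K makes the sine so
    nearly linear that its error survives the 2K-th power. *)
Definition sine_step (l : R) (k : nat) (y : R) : R :=
  (1 - sin (y / (k.+1%:R * l)) ^+ (2 * k.+1)) ^+ (k.+1 * k.+1 ^ (2 * k.+1)).

Lemma sine_step_itv l k y : 0 <= sine_step l k y <= 1.
Proof.
have s0 : 0 <= sin (y / (k.+1%:R * l)) ^+ (2 * k.+1) by rewrite exprM exprn_ge0 ?sqr_ge0.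
have s1 : sin (y / (k.+1%:R * l)) ^+ (2 * k.+1) <= 1.
  by rewrite exprM exprn_ile1 ?sqr_ge0// sin_sqr_le1.
by rewrite /sine_step exprn_ge0 ?exprn_ile1// ?subr_ge0// gerBl.
Qed.

(* The extra factor [k.+1] in the exponent makes the limit 0 at [|y| = l]. *)
Lemma sine_step_cvg l y : 0 < l ->
  (fun k => sine_step l k y) @ \oo --> ((`|y| < l)%R%:R : R).
Proof.
move=> l0; pose r := `|y| / l; have r0 : 0 <= r by rewrite divr_ge0// ltW.
pose s k := sin (y / (k.+1%:R * l)) ^+ (2 * k.+1).
pose N k := (k.+1 * k.+1 ^ (2 * k.+1))%N.
have s01 k : 0 <= s k <= 1.
  by rewrite /s exprM exprn_ge0 ?sqr_ge0//= exprn_ile1 ?sqr_ge0// sin_sqr_le1.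
have k0 k : 0 < k.+1%:R :> R by [].
have uE k : `|y / (k.+1%:R * l)| = r / k.+1%:R.
  by rewrite normrM normfV [`|_ * l|]gtr0_norm ?mulr_gt0// invfM mulrA mulrAC.
have sE k : s k = `|sin (y / (k.+1%:R * l))| ^+ (2 * k.+1).
  by rewrite /s !exprM real_normK ?num_real.
have NE k : (N k)%:R = k.+1%:R * k.+1%:R ^+ (2 * k.+1) :> R by rewrite natrM natrX.
have rl : (`|y| < l) = (r < 1) by rewrite ltr_pdivrMr// mul1r.
rewrite rl; have [r1|r1] := ltP r 1.
- apply: (@squeeze_cvgr _ _ _ _ (fun k => 1 - (1 - r)^-1 * r ^+ k.+1) (fun=> 1)).
  + apply: nearW => k; have /andP[_ ->] := sine_step_itv l k y; rewrite andbT.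
    have := bernoulli_le (N k) (s01 k); rewrite -/(sine_step l k y) => /(le_trans _); apply.
    rewrite lerD2l lerN2 NE.
    have h1 : s k <= (r / k.+1%:R) ^+ (2 * k.+1).
      rewrite sE -uE ler_pXn2r ?nnegrE//; exact: abs_sin_le.
    have h2 : k.+1%:R * k.+1%:R ^+ (2 * k.+1) * s k <= k.+1%:R * r ^+ (2 * k.+1).
      rewrite -mulrA ler_wpM2l//.
      apply: le_trans (ler_wpM2l _ h1) _; first by rewrite exprn_ge0.
      by rewrite -exprMn mulrCA divff ?mulr1// gt_eqF.
    apply: le_trans h2 _; rewrite mul2n -addnn exprD mulrA ler_wpM2r ?exprn_ge0//.
    by rewrite -[leRHS]mul1r ler_pdivlMr ?subr_gt0// geometric_le// r0.
  + rewrite -[X in _ --> X]subr0 -(mulr0 (1 - r)^-1); apply: cvgB; first exact: cvg_cst.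
    apply: cvgM; first exact: cvg_cst.
    rewrite (cvg_shiftS (fun k => r ^+ k)); apply: cvg_expr; by rewrite ger0_norm.
  + exact: cvg_cst.
- apply/cvgr0Pnorm_le => e e0; near=> k.
  have /andP[h0 _] := sine_step_itv l k y; rewrite ger0_norm//.
  (* Then N s >= 1/e by the next estimate, and [bernoulli_ge] bounds the step by 1 / (1 + N s) <=
     e. *)
  have kr : r ^+ 2 + e^-1 <= k.+1%:R.
    apply: (@le_trans _ _ k%:R); last by rewrite ler_nat.
    by near: k; exact: nbhs_infty_ger.
  have ei0 : 0 < e^-1 by rewrite invr_gt0.
  have kr2 : r ^+ 2 / k.+1%:R <= 1 by rewrite ler_pdivrMr// mul1r; lra.
  (* With K = k + 1, the lower bound for the sine and Bernoulli's inequality give s >= (r/K)^(2K) (1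
     - r^2/K). Multiplication by N = K K^(2K) leaves r^(2K) (K - r^2), and r >= 1. *)
  have h1 : k.+1%:R - r ^+ 2 <= (N k)%:R * s k.
    have a1 : (r / k.+1%:R) * (1 - (r / k.+1%:R) ^+ 2 / 2) <= `|sin (y / (k.+1%:R * l))|.
      by rewrite -uE real_normK ?num_real// abs_sin_ge.
    have q0 : 0 <= (r / k.+1%:R) ^+ 2 / 2 <= 1.
      rewrite divr_ge0 ?sqr_ge0//= expr_div_n expr2 invfM mulrA -expr2.
      apply: (@le_trans _ _ (k.+1%:R^-1 / 2)); last first.
        by rewrite -invfM invf_le1 ?mulr_gt0// -natrM ler1n muln_gt0.
      by rewrite ler_pM2r// ler_piMl// invr_ge0.
    have a2 : (r / k.+1%:R) ^+ (2 * k.+1) * (1 - (2 * k.+1)%:R * ((r / k.+1%:R) ^+ 2 / 2)) <= s k.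
      rewrite sE; apply: (@le_trans _ _ ((r / k.+1%:R * (1 - (r / k.+1%:R) ^+ 2 / 2)) ^+ (2 * k.+1))).
        rewrite [leRHS]exprMn; apply: ler_wpM2l; last exact: bernoulli_le q0.
        by rewrite exprn_ge0// divr_ge0.
      have q1 : 0 <= 1 - (r / k.+1%:R) ^+ 2 / 2 by rewrite subr_ge0; case/andP : q0.
      by apply: lerXn2r a1; rewrite nnegrE// mulr_ge0// divr_ge0.
    have a3 : (2 * k.+1)%:R * ((r / k.+1%:R) ^+ 2 / 2) = r ^+ 2 / k.+1%:R.
      by rewrite natrM; field; rewrite gt_eqF.
    have : (N k)%:R * ((r / k.+1%:R) ^+ (2 * k.+1) * (1 - r ^+ 2 / k.+1%:R)) <= (N k)%:R * s k.
      by rewrite ler_wpM2l// -a3.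
    apply: le_trans; rewrite NE mulrA -[k.+1%:R * _ * _]mulrA -exprMn mulrCA divff ?gt_eqF// mulr1.
    rewrite -mulrA [X in _ <= X]mulrC -mulrA.
    have -> : (1 - r ^+ 2 / k.+1%:R) * k.+1%:R = k.+1%:R - r ^+ 2.
      by field; rewrite gt_eqF.
    rewrite mulrC ler_peMr ?exprn_ege1//; have := k0 k; lra.
  have h2 := bernoulli_ge (N k) (s01 k); rewrite -/(sine_step l k y) in h2.
  have p0 : 0 < 1 + (N k)%:R * s k by lra.
  have : sine_step l k y <= (1 + (N k)%:R * s k)^-1 by rewrite -[leRHS]mul1r ler_pdivlMr.
  move=> /le_trans; apply; rewrite -[leRHS]invrK lef_pV2 ?posrE//; lra.
Unshelve. all: by end_near. Qed.

End SineSteps.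



(** * Agreement of the two operators and the algebra of multipliers *)

Section Density.
Context {R : realType}.
Local Notation mu := (@lebesgue_measure R).
Local Notation fct := (R -> R[i]).
Variables (E : fct -> fct) (K : R -> fct).
Hypotheses (bE : bounded_operator E) (gK : forall x, gdecay (K x)).

Let kernel_op (f : fct) x := Cintegral (fun y => K x y * f y).

Definition agree (f : fct) := L2 f /\ ae_eq mu setT (E f) (kernel_op f).

Let kernel_Cintegrable x f : L2 f -> Cintegrable (fun y => K x y * f y).
Proof. exact: L2_Cintegrable (gdecay_L2 (gK x)). Qed.

Lemma agree_lin a f g : agree f -> agree g -> agree (fun x => a * f x + g x).
Proof.
move=> [f2 Ef] [g2 Eg]; split; first by apply: L2D => //; exact: L2Z.
have [_ _ lin _] := bE.
apply: filterS3 (lin a f g f2 g2) Ef Eg => x e1 e2 e3 I; rewrite e1// e2// e3// /kernel_op.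
rewrite -CintegralZ; last exact: kernel_Cintegrable.
rewrite -CintegralD; [|by apply: CintegrableZ; exact: kernel_Cintegrable|exact: kernel_Cintegrable].
by congr Cintegral; apply/funext => y; ring.
Qed.

Lemma agreeD f g : agree f -> agree g -> agree (fun x => f x + g x).
Proof.
by move=> af ag; have := agree_lin 1 af ag; under eq_fun do rewrite mul1r.
Qed.

Lemma agreeZ a f : agree f -> agree (fun x => a * f x).
Proof.
(* The zero function is obtained as - f + f, a combination of functions known to agree. *)
move=> af; have := agree_lin a af (agree_lin (-1) af af).
by under eq_fun do rewrite mulN1r addNr addr0.
Qed.

(** Dominated convergence in L^2 and the boundedness of [E] give convergence of E (g n) in norm; for
    each x, the kernel integrals converge by domination by |K x| |G|. [N2_fatou], applied to E (g n)
    - E f, identifies the two limits. *)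
Lemma agree_cvg (g : nat -> fct) f (G : fct) : (forall n, agree (g n)) -> L2 G ->
  (forall n x, nrm (g n x) <= nrm (G x)) -> (forall x, ccvg (g ^~ x) (f x)) -> agree f.
Proof.
move=> ag G2 gG gf.
have g2 n : L2 (g n) by case: (ag n).
have fG x : nrm (f x) <= nrm (G x).
  rewrite -(cvg_lim _ (ccvg_nrm (gf x)))//; apply: limr_le.
    by apply/cvg_ex; exists (nrm (f x)); exact: ccvg_nrm.
  by apply: nearW => n.
have f2 : L2 f by apply: L2_le G2 fG; apply: Cmeas_cvg gf => n; exact: L2_meas.
split=> //.
have [M M0 EM] := op_bound bE.
have d0 : (fun n => L2dist (g n) f) @ \oo --> (0 : R).
  apply: (N2_dominated (g := fun x => 2 * G x)).
  - by move=> n; apply: CmeasB; exact: L2_meas.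
  - exact: L2Z.
  - move=> n x; apply: le_trans (nrmB _ _) _; rewrite nrmM (_ : nrm 2 = 2).
      by rewrite mulr2n mulrDl !mul1r lerD.
    by rewrite (_ : 2 = (2 : R)%:C) ?nrm_real ?ger0_norm// rmorph_nat.
  - by move=> x; rewrite -(subrr (f x)); apply: ccvgB (gf x) _; exact: ccvg_cst.
have Ed0 : (fun n => N2 (fun x => E (g n) x - E f x)) @ \oo --> (0 : R).
  apply: (@squeeze_cvgr _ _ _ _ (fun=> 0) (fun n => M * L2dist (g n) f)).
  - apply: nearW => n; rewrite N2_ge0/=; exact: op_dist.
  - exact: cvg_cst.
  - by rewrite -[X in _ --> X](mulr0 M); apply: cvgM d0; exact: cvg_cst.
have EgK : {ae mu, forall x, forall n, E (g n) x = kernel_op (g n) x}.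
  by apply: ae_foralln => n; have [_] := ag n; apply: filterS => x + ; apply.
have cvgK x : ccvg (fun n => kernel_op (g n) x) (kernel_op f x).
  apply: (Cintegral_dominated (G := fun y => nrm (K x y) * nrm (G y))).
  - by move=> n; apply: CmeasM; [case: (gK x)|exact: L2_meas].
  - exact: L2_mul_integrable (gdecay_L2 (gK x)) G2.
  - by move=> n y; rewrite nrmM ler_wpM2l// nrm_ge0.
  - by move=> y; apply: ccvgM (gf y); exact: ccvg_cst.
have := @N2_fatou R (fun n x => E (g n) x - E f x) (fun x => kernel_op f x - E f x) _ Ed0 _.
move=> H; have {}H : {ae mu, forall x, kernel_op f x - E f x = 0}.
  apply: H => [n|]; first by apply: L2B; exact: op_L2.
  apply: filterS EgK => x Egx; apply: ccvgB; last exact: ccvg_cst.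
  by under eq_fun do rewrite Egx; exact: cvgK.
by apply: filterS H => x /eqP; rewrite subr_eq0 => /eqP.
Qed.

Definition shifted_agree (f : fct) := forall s : R[i], agree (fun x => Cexp (s * x%:C) * f x).

(** Quantified over all [f] and mapping [shifted_agree] into itself, so that a product of
    multipliers is a composition of two such maps. Agreement of single functions has no such closure
    under products. *)
Definition multiplier (h : fct) :=
  forall f, shifted_agree f -> shifted_agree (fun x => h x * f x).

Lemma multiplier_cst a : multiplier (fun=> a).
Proof. by move=> f sf s; under eq_fun do rewrite mulrCA; exact/agreeZ/sf. Qed.

Lemma multiplierD h k : multiplier h -> multiplier k -> multiplier (fun x => h x + k x).
Proof.
move=> mh mk f sf s; under eq_fun do rewrite mulrDl mulrDr.
by apply: agreeD; [exact: mh|exact: mk].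
Qed.

Lemma multiplierM h k : multiplier h -> multiplier k -> multiplier (fun x => h x * k x).
Proof.
move=> mh mk f sf; under eq_fun do rewrite -mulrA.
by apply: mh; exact: mk.
Qed.

Lemma multiplierZ a h : multiplier h -> multiplier (fun x => a * h x).
Proof. by apply: multiplierM; exact: multiplier_cst. Qed.

Lemma multiplierB h k : multiplier h -> multiplier k -> multiplier (fun x => h x - k x).
Proof.
by move=> mh mk; under eq_fun do rewrite -mulN1r; exact: multiplierD mh (multiplierZ (-1) mk).
Qed.

Lemma multiplierX h n : multiplier h -> multiplier (fun x => h x ^+ n).
Proof.
move=> mh; elim: n => [|n IH]; first by under eq_fun do rewrite expr0; exact: multiplier_cst.
by under eq_fun do rewrite exprS; exact: multiplierM.
Qed.

Lemma multiplier_cvg (h : nat -> fct) k (C : R) : (forall n, multiplier (h n)) ->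
  (forall n x, nrm (h n x) <= C) -> (forall x, ccvg (h ^~ x) (k x)) -> multiplier k.
Proof.
move=> mh hC hk f sf s.
apply: (@agree_cvg (fun n x => Cexp (s * x%:C) * (h n x * f x)) _
  (fun x => C%:C * (Cexp (s * x%:C) * f x))).
- by move=> n; exact: mh.
- by apply: L2Z; have [] := sf s.
- move=> n x; rewrite mulrCA [nrm (h n x * _)]nrmM [nrm (C%:C * _)]nrmM ler_wpM2r ?nrm_ge0//.
  by rewrite nrm_real; apply: le_trans (hC n x) (ler_norm _).
- move=> x; apply: ccvgM; first exact: ccvg_cst.
  by apply: ccvgM (hk x) _; exact: ccvg_cst.
Qed.

Lemma multiplier_Cexp s : multiplier (fun x => Cexp (s * x%:C)).
Proof.
by move=> f sf t; under eq_fun do rewrite mulrA -CexpD -mulrDl; exact: sf.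
Qed.

Lemma multiplier_sin (a m : R) : multiplier (fun x => (sin (a * (x - m)))%:C).
Proof.
have -> : (fun x : R => (sin (a * (x - m)))%:C) = fun x =>
    (0 +i* - 2^-1) * Cexp (0 +i* - (a * m)) * Cexp ((0 +i* a) * x%:C) +
    (0 +i* 2^-1) * Cexp (0 +i* (a * m)) * Cexp ((0 +i* - a) * x%:C).
  apply/funext => x; rewrite -[X in _ = X + _]mulrA -[X in _ = _ + X]mulrA -!CexpD.
  have -> : 0 +i* - (a * m) + (0 +i* a) * x%:C = 0 +i* (a * (x - m)).
    by apply: complex_eq; rewrite ?(ReCD, ImCD, ReCM, ImCM) /=; ring.
  have -> : 0 +i* (a * m) + (0 +i* - a) * x%:C = 0 +i* - (a * (x - m)).
    by apply: complex_eq; rewrite ?(ReCD, ImCD, ReCM, ImCM) /=; ring.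
  have CexpI (t : R) : Cexp (0 +i* t) = cos t +i* sin t.
    by apply: complex_eq; rewrite ?Re_Cexp ?Im_Cexp /= expR0 mul1r.
  by rewrite !CexpI cosN sinN; apply: complex_eq; rewrite !(ReCD, ImCD, ReCM, ImCM) /=; lra.
by apply: multiplierD; apply: multiplierZ; exact: multiplier_Cexp.
Qed.

Definition multiplier_set (A : set R) := multiplier (fun x => (\1_A x)%:C).

Lemma multiplier_set_ball (m l : R) : 0 < l -> multiplier_set [set x | `|x - m| < l].
Proof.
move=> l0; apply: (@multiplier_cvg (fun k x => (sine_step l k (x - m))%:C) _ 1).
- move=> k; rewrite /sine_step; under eq_fun do rewrite rmorphXn rmorphB rmorphXn/=.
  apply: multiplierX; apply: multiplierB; first exact: multiplier_cst.
  apply: multiplierX; under eq_fun do rewrite mulrC; exact: multiplier_sin.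
- move=> k x; have /andP[h0 h1] := sine_step_itv l k (x - m).
  by rewrite nrm_real ger0_norm.
- move=> x; apply: ccvg_real; rewrite indicE.
  have -> : (x \in [set x : R | `|x - m| < l]) = (`|x - m| < l) by apply/idP/idP; rewrite in_setE.
  exact: sine_step_cvg.
Qed.

Lemma multiplier_set0 : multiplier_set set0.
Proof. by rewrite /multiplier_set indic0; exact: (multiplier_cst 0). Qed.

Lemma multiplier_setC A : multiplier_set A -> multiplier_set (~` A).
Proof.
move=> mA; rewrite /multiplier_set (_ : (fun x => _) = fun x => 1 - (\1_A x)%:C).
  exact: multiplierB (multiplier_cst 1) mA.
apply/funext => x; rewrite !indicE in_setC.
by case: (x \in A); rewrite /= ?subrr ?subr0.
Qed.

Lemma multiplier_setU A B : multiplier_set A -> multiplier_set B -> multiplier_set (A `|` B).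
Proof.
move=> mA mB; rewrite /multiplier_set (_ : (fun x => _) =
    fun x => (\1_A x)%:C + (\1_B x)%:C - (\1_A x)%:C * (\1_B x)%:C).
  exact: multiplierB (multiplierD mA mB) (multiplierM mA mB).
apply/funext => x; rewrite !indicE in_setU.
by case: (x \in A); case: (x \in B); apply: complex_eq;
  rewrite !(ReCD, ImCD, ReCN, ImCN, ReCM, ImCM) /=; lra.
Qed.

Lemma multiplier_set_bigcup (A : (set R)^nat) :
  (forall n, multiplier_set (A n)) -> multiplier_set (\bigcup_n A n).
Proof.
move=> mA; have mU n : multiplier_set (\big[setU/set0]_(i < n) A i).
  elim: n => [|n IH]; first by rewrite big_ord0; exact: multiplier_set0.
  by rewrite big_ord_recr/=; exact: multiplier_setU IH (mA n).
apply: (@multiplier_cvg (fun n x => (\1_(\big[setU/set0]_(i < n) A i) x)%:C) _ 1) => //.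
- by move=> n x; rewrite nrm_real indicE; case: (_ \in _); rewrite /= ?normr1 ?normr0.
- move=> x; apply: ccvg_real; rewrite !indicE.
  have [[i _ Ai]|nA] := pselect ((\bigcup_n A n) x).
  + rewrite mem_set; last by exists i.
    apply: cvg_near_cst; near=> n; rewrite indicE mem_set// -bigcup_mkord.
    by exists i => //=; near: n; exists i.+1.
  + rewrite memNset//; apply: cvg_near_cst; apply: nearW => n.
    by rewrite indicE memNset// -bigcup_mkord => -[i _ Ai]; apply: nA; exists i.
Unshelve. all: by end_near. Qed.

(** The sets whose indicators are multipliers form a sigma-algebra: unions of two sets come from
    products, countable ones from bounded limits. It contains the bounded open intervals, which are
    the balls treated above. *)
Lemma multiplier_set_measurable (A : set R) : measurable A -> multiplier_set A.
Proof.
move=> mA; have : (@ocitv R).-sigma.-measurable A by exact: mA.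
rewrite (RGenOpens.measurableE R); apply: smallest_sub.
  split; [exact: multiplier_set0| |exact: multiplier_set_bigcup].
  by move=> B; rewrite setTD; exact: multiplier_setC.
move=> _ [a [b ->]]; have [ab|ab] := ltP a b; last first.
  rewrite set_itv_ge; first exact: multiplier_set0.
  by rewrite bnd_simp -leNgt.
rewrite (_ : [set` _] = [set x | `|x - (a + b) / 2| < (b - a) / 2]).
  by apply: multiplier_set_ball; rewrite divr_gt0// subr_gt0.
apply/seteqP; split => x /=; rewrite in_itv/= ltr_norml => /andP[h1 h2]; apply/andP; split; lra.
Qed.

Lemma multiplier_sum (F : nat -> fct) n : (forall j, multiplier (F j)) ->
  multiplier (fun x => \sum_(j < n) F j x).
Proof.
move=> mF; elim: n => [|n IH].
  by under eq_fun do rewrite big_ord0; exact: multiplier_cst.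
by under eq_fun do rewrite big_ord_recr; exact: multiplierD.
Qed.

(** The sum counts the natural numbers below t, that is, the ceiling of t. *)
Lemma count_lt_itv (t : R) n : 0 <= t <= n%:R ->
  t <= \sum_(j < n) (j%:R < t)%R%:R <= t + 1.
Proof.
elim: n => [|n IH] /andP[t0 tn]; first by rewrite big_ord0; apply/andP; split; lra.
rewrite big_ord_recr/=; have [nt|nt] := ltP n%:R t; last by rewrite addr0 IH// t0.
rewrite (eq_bigr (fun=> 1)); last first.
  by move=> j _; rewrite (lt_trans _ nt)// ltr_nat.
by rewrite sumr_const card_ord/=; move: tn; rewrite -natr1 => tn; apply/andP; split; lra.
Qed.

(** With N = n + 1, the function [g n] is the ceiling of N h divided by N, written as an average of
    indicators of the superlevel sets {h > j/N}; it exceeds h by at most 1/N. *)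
Lemma multiplier_unit_measurable (h : R -> R) : measurable_fun setT h ->
  (forall x, 0 <= h x <= 1) -> multiplier (fun x => (h x)%:C).
Proof.
move=> mh h01; pose A n j := [set x | j%:R < n.+1%:R * h x].
pose g n x : R := n.+1%:R^-1 * \sum_(j < n.+1) \1_(A n j) x.
have gh n x : 0 <= g n x - h x <= n.+1%:R^-1.
  have n0 : 0 < n.+1%:R :> R by [].
  have /count_lt_itv : 0 <= n.+1%:R * h x <= n.+1%:R.
    by have /andP[h0 h1] := h01 x; rewrite mulr_ge0//= ler_piMr.
  rewrite (eq_bigr (fun j : 'I_n.+1 => \1_(A n j) x)); last first.
    move=> j _; rewrite indicE; congr (_%:R); congr nat_of_bool.
    by apply/idP/idP; rewrite in_setE.
  move=> /andP[a1 a2]; rewrite subr_ge0 lerBlDl /g.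
  apply/andP; split; first by rewrite mulrC ler_pdivlMr// mulrC.
  by rewrite mulrC ler_pdivrMr// mulrDl mulVf ?gt_eqF// [h x * _]mulrC.
apply: (@multiplier_cvg (fun n x => (g n x)%:C) _ 2).
- move=> n; rewrite /g; under eq_fun do rewrite rmorphM rmorph_sum/=.
  apply: multiplierZ; apply: (multiplier_sum (F := fun j x => (\1_(A n j) x)%:C)) => j.
  apply: multiplier_set_measurable; rewrite -[A n j]setCK; apply: measurableC.
  rewrite (_ : ~` A n j = [set x | n.+1%:R * h x <= j%:R]); last first.
    by apply/seteqP; split => x /=; rewrite leNgt => /negP.
  rewrite -[X in measurable X]setTI; apply: measurable_fun_le => //.
  by apply: measurable_funM => //; exact: measurable_cst.
- move=> n x; have /andP[a1 a2] := gh n x; have /andP[h0 h1] := h01 x.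
  have : n.+1%:R^-1 <= 1 :> R by rewrite invf_le1// ler1n.
  have g0 : 0 <= g n x by rewrite (le_trans h0)// -subr_ge0.
  move=> n1; rewrite nrm_real ger0_norm// -[g n x](subrK (h x)).
  by rewrite (_ : 2 = 1 + 1)// lerD// (le_trans a2).
- move=> x; apply: ccvg_real.
  apply: (@squeeze_cvgr _ _ _ _ (fun=> h x) (fun n => h x + n.+1%:R^-1)).
  + apply: nearW => n; have /andP[a1 a2] := gh n x.
    by rewrite -subr_ge0 a1/= -lerBlDl.
  + exact: cvg_cst.
  + rewrite -[X in _ --> X]addr0; apply: cvgD; first exact: cvg_cst.
    exact: cvg_harmonic.
Qed.

Lemma multiplier_bounded_measurable h (C : R) : Cmeasurable h ->
  (forall x, nrm (h x) <= C) -> multiplier h.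
Proof.
move=> [m1 m2] hC; pose D := `|C| + 1.
have D0 : 0 < D by rewrite /D ltr_wpDl.
have hD x : nrm (h x) < D by rewrite (le_lt_trans (hC x))// /D (le_lt_trans (ler_norm C))// ltrDl.
have mreal (u : R -> R) : measurable_fun setT u -> (forall x, `|u x| < D) ->
    multiplier (fun x => (u x)%:C).
  move=> mu uD; rewrite (_ : (fun _ => _) =
      fun x => (2 * D)%:C * ((u x + D) / (2 * D))%:C - D%:C); last first.
    apply/funext => x; rewrite -rcM mulrC divfK ?gt_eqF ?mulr_gt0//.
    by rewrite rcD addrK.
  apply: multiplierB; last exact: multiplier_cst.
  apply: multiplierZ; apply: multiplier_unit_measurable.
    apply: measurable_funM; last exact: measurable_cst.
    by apply: measurable_funD => //; exact: measurable_cst.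
  move=> x; have := uD x; rewrite ltr_norml => /andP[a1 a2].
  by rewrite divr_ge0 ?ler_pdivrMr ?mulr_gt0//; [lra| |]; rewrite ?mulr_ge0 ?(ltW D0)//; lra.
rewrite (_ : h = fun x => (ReC (h x))%:C + (0 +i* 1) * (ImC (h x))%:C).
  apply: multiplierD; last apply: multiplierZ; apply: mreal => // x.
    exact: le_lt_trans (Re_le_nrm _) (hD x).
  exact: le_lt_trans (Im_le_nrm _) (hD x).
by apply/funext => x; apply: complex_eq; rewrite !(ReCD, ImCD, ReCM, ImCM) /=; ring.
Qed.

(** Dividing by the Gaussian, f = w exp(- b x^2) with [w] measurable but possibly unbounded. On {|w|
    <= n} it is a bounded multiplier of the Gaussian, and the truncations of [f] tend to [f] with
    |f| as majorant. *)
Lemma agree_all b : 0 < ReC b -> (forall s, agree (gauss b s 0)) ->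
  forall f, L2 f -> agree f.
Proof.
move=> b0 ag f f2.
have sg : shifted_agree (gauss b 0 0).
  move=> s; rewrite (_ : (fun _ => _) = gauss b s 0) => //.
  apply/funext => x; rewrite /gauss -CexpD; congr Cexp; ring.
pose w x := f x * gauss (- b) 0 0 x.
have mw : Cmeasurable w by apply: CmeasM; [exact: L2_meas|exact: Cmeas_gauss].
have wE x : w x * gauss b 0 0 x = f x.
  rewrite /w -mulrA /gauss -CexpD (_ : _ + _ = 0) ?Cexp0 ?mulr1//; ring.
pose A n := [set x | nrm (w x) <= n%:R].
have mA n : measurable (A n).
  rewrite -[A n]setTI; apply: (measurable_fun_le (g := cst n%:R)) => //.
  exact: Cmeas_nrm.
have mh n : multiplier (fun x => w x * (\1_(A n) x)%:C).
  apply: (@multiplier_bounded_measurable _ n%:R).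
    by apply: CmeasM => //; apply: Cmeas_real; exact: measurable_indic.
  move=> x; rewrite nrmM nrm_real indicE.
  have [/set_mem wn|_] := boolP (x \in A n); first by rewrite normr1 mulr1.
  by rewrite normr0 mulr0.
apply: (@agree_cvg (fun n x => (\1_(A n) x)%:C * f x) f f) => //.
(* The exponential shift is taken with parameter 0, where it is the constant 1. *)
- move=> n; have := mh n _ sg 0.
  rewrite (_ : (fun _ => _) = fun x => (\1_(A n) x)%:C * f x) => //.
  by apply/funext => x; rewrite mul0r Cexp0 mul1r mulrAC wE mulrC.
- move=> n x; rewrite nrmM nrm_real ler_piMl ?nrm_ge0// indicE.
  by case: (_ \in _); rewrite ?normr1 ?normr0.
- move=> x; rewrite -[X in ccvg _ X]mul1r; apply: ccvgM; last exact: ccvg_cst.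
  apply: (@ccvg_real _ _ 1); apply: cvg_near_cst; near=> n.
  rewrite indicE mem_set// /A /=; near: n; exact: nbhs_infty_ger.
Unshelve. all: by end_near. Qed.

End Density.

Theorem theorem7 (R : realType) (c : R[i]) (hc : 0 < ReC c)
  (tau : R[i]) (htau : Sset c tau)
  (E : (R -> R[i]) -> (R -> R[i])) (hE : is_exp_oscillator c tau E)
  (f : R -> R[i]) (hf : L2 f) :
  {ae (@lebesgue_measure R), forall x,
     Cintegrable (fun y => mehler_kernel c tau x y * f y) /\
     E f x = Cintegral (fun y => mehler_kernel c tau x y * f y)}.
Proof.
have [bE Ecoh] := exp_oscillator_coherent hc htau hE.
have gK := mehler_kernel_gdecay hc htau.
have b0 : 0 < ReC (Cpow c 2^-1 / 2) by rewrite Re_half divr_gt0// Re_sqrt_gt0.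
have [|_ Ef] := agree_all bE gK b0 _ hf.
  by move=> s; split; [exact/gdecay_L2/gdecay_gauss|exact: Ecoh].
apply: filterS Ef => x /(_ I) ->; split => //.
exact: L2_Cintegrable (gdecay_L2 (gK x)) hf.
Qed.
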